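(* For $i=1,\dots,N$ consider the parabolic agent $$\dot x_i(z,t)=\lambda_ix_i''(z,t)+a_i(z,t)x_i(z,t)+\tilde g_{1,i}^\top(z,t)v_i(t),\quad x_i'(0,t)=q_i(t)x_i(0,t)+\tilde g_{2,i}^\top(t)v_i(t),$$ $$x_i'(1,t)=q_i^\ell(t)x_i(1,t)+b_iu_i(t)+\tilde g_{3,i}^\top(t)v_i(t),\quad \eta_i(t)=c_{m,i}x_i(1,t),\quad \dot v_i(t)=S_iv_i(t)$$ ($z\in(0,1)$, $t>t_0$) and the observer $$\dot{\hat v}_i=S_i\hat v_i+l_{v_i}(t)(\eta_i-c_{m,i}\hat x_i(1,t)),$$ $$\dot{\hat x}_i=\lambda_i\hat x_i''+a_i\hat x_i+\tilde g_{1,i}^\top\hat v_i+l_{x_i}(z,t)(\eta_i-c_{m,i}\hat x_i(1,t)),$$ $$\hat x_i'(0,t)=q_i(t)\hat x_i(0,t)+\tilde g_{2,i}^\top(t)\hat v_i(t),$$ $$\hat x_i'(1,t)=\tfrac{q_i^\ell(t)}{c_{m,i}}\eta_i(t)+b_iu_i(t)+\tilde g_{3,i}^\top(t)\hat v_i(t)+l_{1,i}(t)(\eta_i(t)-c_{m,i}\hat x_i(1,t)).$$ Let the observer gains be $$l_{1,i}(t)=-\tfrac1{c_{m,i}}p_i(1,1,t),\qquad l_{x_i}(z,t)=\mathcal T_{o,i}^{-1}[\gamma_i^\top(\cdot,t)l_{v_i}(t),t](z)-\tfrac{\lambda_i}{c_{m,i}}p_{i,\zeta}(z,1,t),$$ with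 $p_i$, $\mathcal T_{o,i}$, $\gamma_i$ as in the context, and let $l_{v_i}(t)$ be a bounded gain such that the fundamental matrix $\Psi_i(t,\tau)$ of $\dot e=(S_i-l_{v_i}(t)c_{m,i}\gamma_i^\top(1,t))e$ satisfies $\|\Psi_i(t,\tau)\|\le\kappa_ie^{-\bar\mu_{v_i}(t-\tau)}$ for all $t\ge\tau$ and some $\kappa_i>0$. Assume $\bar\mu_i>0$, $\bar\mu_{v_i}>0$ and $\bar\mu_i\ne\bar\mu_{v_i}$, so that $\alpha_{o,i}=\min(\bar\mu_i,\bar\mu_{v_i})>0$. Then the dynamics of the observer error $e_{o,i}(t)=\operatorname{col}(e_{v_i}(t),e_{x_i}(t))$, with $e_{v_i}=v_i-\hat v_i$ and $e_{x_i}(t)=\{x_i(z,t)-\hat x_i(z,t),\,z\in[0,1]\}$, are uniformly exponentially stable in the norm $\|\cdot\|_{X_{o,i}}=(\|\cdot\|^2_{\mathbb C^{n_{v_i}}}+\|\cdot\|^2_{L_2})^{1/2}$, i.e. $$\|e_{o,i}(t)\|_{X_{o,i}}\le\bar M_ie^{-\alpha_{o,i}(t-t_0)}\|e_{o,i}(t_0)\|_{X_{o,i}},\quad t\ge t_0,$$ for all $e_{o,i}(t_0)\in\mathbb C^{n_{v_i}}\oplus H^2(0,1)$ satisfying the boundary conditions of the observer error dynamics, an $\bar M_i\ge1$ and any $t_0\ge0$.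
   Context: $\mathbb R^+_{t_0}=\{t>t_0\}$, $t_0\ge0$; primes are $z$-derivatives. $G_\alpha(\mathbb R^+_{t_0})$ is the Gevrey class of order $\alpha$: $f\in C^\infty(\mathbb R^+_{t_0})$ for which there exist positive constants $M$ and $R$ such that $\sup_{t\in K}|f^{(j)}(t)|\le\frac{M}{R^j}(j!)^\alpha$ for all $j\in\mathbb N_0$ and for any compact subset $K\subset\mathbb R^+_{t_0}$ (the constants $M,R$ being the same for all $K$). A product such as $C([0,1])\times G_\alpha(\mathbb R^+_{t_0})$ denotes functions of $(z,t)$ with the first regularity in $z$ and the second in $t$; $C_p$ means piecewise continuous. Standing assumptions: $\lambda_i>0$ constant (normalized system on $[0,1]$); $a_i\in C([0,1])\times G_\alpha(\mathbb R^+_{t_0})$ with $1\le\alpha<2$; $q_i,q_i^\ell\in G_\alpha(\mathbb R^+_{t_0})$; $b_i,c_{m,i}\in\mathbb R\setminus\{0\}$; $\tilde g_{k,i}^\top=g_{k,i}^\top P_i$ with $P_i\in\mathbb R^{m_i\times n_{v_i}}$, $g_{1,i}\in(C_p([0,1])\times G_\alpha(\mathbb R^+_{t_0}))^{m_i}$, $g_{k,i}\in(G_\alpha(\mathbb R^+_{t_0}))^{m_i}$, $k=2,3$; $(P_i,S_i)$ observable, $S_i\in\mathbb R^{n_{v_i}\times n_{v_i}}$ diagonalizable, $\sigma(S_i)\subset j\mathbb R$. Observer kernel: $p_i(z,\zeta,t)$ is the strong solution (in $G_\alpha(\mathbb R^+_{t_0})$ w.r.t. $t$), on $\{0<z<\zeta<1\}\times\mathbb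 R^+_{t_0}$, of $p_{i,t}=\lambda_ip_{i,zz}-\lambda_ip_{i,\zeta\zeta}+(a_i(z,t)+\bar\mu_i)p_i$, $p_{i,z}(0,\zeta,t)=q_i(t)p_i(0,\zeta,t)$, $p_i(z,z,t)=q_i(t)-\int_0^z\frac{a_i(\zeta,t)+\bar\mu_i}{2\lambda_i}d\zeta$. The transformation $\mathcal T_{o,i}^{-1}[f,t](z)=f(z)-\int_z^1p_i(z,\zeta,t)f(\zeta)d\zeta$ has inverse $\mathcal T_{o,i}$. $\gamma_i(z,t)\in\mathbb R^{n_{v_i}}$ is the solution of $\gamma_{i,t}^\top=\lambda_i\gamma_{i,zz}^\top-\bar\mu_i\gamma_i^\top-\gamma_i^\top S_i+\bar h_{1,i}^\top$ on $(0,1)\times\mathbb R^+_{t_0}$, $\gamma_{i,z}^\top(0,t)=\tilde g_{2,i}^\top(t)$, $\gamma_{i,z}^\top(1,t)=\tilde g_{3,i}^\top(t)$, with an initial condition whose elements are in $H^2(0,1)$ and satisfy these boundary conditions, where $\bar h_{1,i}^\top(z,t)=\mathcal T_{o,i}[\tilde g_{1,i}^\top(\cdot,t),t](z)+\mathcal T_{o,i}[p_i(\cdot,1,t),t](z)\lambda_i\tilde g_{3,i}^\top(t)$. Boundary conditions of the observer error dynamics: $e_{x_i}'(0,t)=q_i(t)e_{x_i}(0,t)+\tilde g_{2,i}^\top(t)e_{v_i}(t)$, $e_{x_i}'(1,t)=\tilde g_{3,i}^\top(t)e_{v_i}(t)-l_{1,i}(t)c_{m,i}e_{x_i}(1,t)$.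 *)

(* Defs.v *)
From mathcomp Require Export all_boot all_order all_algebra.
From mathcomp Require Export all_classical all_reals all_analysis.
From mathcomp Require Export complex.

Set Implicit Arguments.
Unset Strict Implicit.
Unset Printing Implicit Defensive.

Import Order.TTheory GRing.Theory Num.Theory.
Import numFieldNormedType.Exports.

Local Open Scope classical_set_scope.
Local Open Scope complex_scope.
Local Open Scope ring_scope.

(* Functions of space and time take the space variable(s) first and the time
   variable last.  Everything is a total function; only values with space
   variables in [0, 1] and times in the relevant half-line matter. *)

Section FunctionClasses.
Context {R : realType}.

Definition gevrey_bounded (alpha tb M r : R) (f : R -> R) : Prop :=
  (forall j t, tb < t -> derivable (derive1n j f) t 1) /\
  (forall K : set R, compact K -> K `<=` [set t | tb < t] ->
   forall j t, K t -> `|derive1n j f t| <= M / r ^+ j * (j`!%:R `^ alpha)).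

Definition gevrey (alpha tb : R) (f : R -> R) : Prop :=
  exists M r : R, [/\ 0 < M, 0 < r & gevrey_bounded alpha tb M r f].

(* For functions that also depend on space, the Gevrey constants are uniform
   in the space variable ranging over [D]. *)
Definition gevrey_on (I : Type) (D : set I) (alpha tb : R) (f : I -> R -> R) :
    Prop :=
  exists M r : R, [/\ 0 < M, 0 < r
    & forall i, D i -> gevrey_bounded alpha tb M r (f i)].

Definition continuous01 (f : R -> R) : Prop := {within `[0, 1], continuous f}.

Definition piecewise_continuous01 (f : R -> R) : Prop :=
  [/\ exists s : seq R, forall z, 0 <= z <= 1 -> z \notin s ->
        f y @[y --> within `[0, 1] (nbhs z)] --> f z,
      forall z, 0 <= z < 1 -> cvg (f y @[y --> z^'+])
    & forall z, 0 < z <= 1 -> cvg (f y @[y --> z^'-])].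

(* [C]([0,1]) x G_alpha for a space regularity class [C]. *)
Definition space_gevrey (C : (R -> R) -> Prop) (alpha tb : R)
    (f : R -> R -> R) : Prop :=
  (forall t, tb < t -> C (f^~ t)) /\ gevrey_on `[0, 1] alpha tb f.

(* Membership in L_2(0,1) is needed wherever [normL2] is used: the real-valued
   integral of a non-integrable function is 0. *)
Definition L2 (f : R -> R) : Prop :=
  measurable_fun (`[0, 1] : set R) f /\
  (@lebesgue_measure R).-integrable `[0, 1] (fun z => (f z ^+ 2)%:E).

Definition normL2 (f : R -> R) : R :=
  Num.sqrt (\int[lebesgue_measure]_(z in `[0, 1]) (f z ^+ 2)).

(* f is in H^2(0,1), in its C^1 representative, with f' = f1 and f'' = f2:
   f and f' are absolutely continuous and f'' is in L_2. *)
Definition H2 (f f1 f2 : R -> R) : Prop :=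
  [/\ L2 f2,
      forall z, 0 <= z <= 1 ->
        f1 z = f1 0 + \int[lebesgue_measure]_(y in `[0, z]) f2 y
    & forall z, 0 <= z <= 1 ->
        f z = f 0 + \int[lebesgue_measure]_(y in `[0, z]) f1 y].

Definition L2_derive (f : R -> R -> R) (t : R) (d : R -> R) : Prop :=
  L2 d /\
  normL2 (fun z => h^-1 * (f z (t + h) - f z t) - d z) @[h --> 0^'] --> 0.

(* Classical solution on [t0, oo), in the state space L_2(0,1), of f_t = rhs,
   where rhs involves f_zz = fzz: f is in C([t0, oo); L_2) and in
   C^1((t0, oo); L_2), and f(., t) is in H^2(0,1) for t > t0.
   The evolution equation is thus an identity in L_2, as it has to be for right
   hand sides that are only piecewise continuous in space. *)
Definition evolution (t0 : R) (f fz fzz rhs : R -> R -> R) : Prop :=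
  [/\ L2 (f^~ t0),
      normL2 (fun z => f z s - f z t0) @[s --> t0^'+] --> 0,
      forall t, t0 < t -> H2 (f^~ t) (fz^~ t) (fzz^~ t),
      forall t, t0 < t -> L2_derive f t (rhs^~ t)
    & forall t, t0 < t -> normL2 (fun z => rhs z s - rhs z t) @[s --> t] --> 0].

(* Value at t of a function defined on (t, oo) only. *)
Definition rlim (f : R -> R) (t : R) : R := lim (f s @[s --> t^'+]).
Definition rlim_mx m n (F : R -> 'M[R]_(m, n)) (t : R) : 'M[R]_(m, n) :=
  \matrix_(i, j) rlim (fun s => F s i j) t.

End FunctionClasses.

Section ComplexValued.
Context {R : realType}.

Local Notation rpart := (@complex.Re R).
Local Notation ipart := (@complex.Im R).

Definition toC m n (A : 'M[R]_(m, n)) : 'M[R[i]]_(m, n) :=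
  map_mx (real_complex R) A.

Definition H2C (f f1 f2 : R -> R[i]) : Prop :=
  H2 (rpart \o f) (rpart \o f1) (rpart \o f2) /\
  H2 (ipart \o f) (ipart \o f1) (ipart \o f2).

Definition evolutionC (t0 : R) (f fz fzz rhs : R -> R -> R[i]) : Prop :=
  let re (g : R -> R -> R[i]) z t := rpart (g z t) in
  let im (g : R -> R -> R[i]) z t := ipart (g z t) in
  evolution t0 (re f) (re fz) (re fzz) (re rhs) /\
  evolution t0 (im f) (im fz) (im fzz) (im rhs).

Definition odeC n (t0 : R) (v rhs : R -> 'cV[R[i]]_n) : Prop :=
  forall k,
  [/\ rpart (v s k 0) @[s --> t0^'+] --> rpart (v t0 k 0),
      ipart (v s k 0) @[s --> t0^'+] --> ipart (v t0 k 0)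
    & forall t, t0 < t ->
        is_derive t 1 (fun s => rpart (v s k 0)) (rpart (rhs t k 0)) /\
        is_derive t 1 (fun s => ipart (v s k 0)) (ipart (rhs t k 0))].

(* Norm of C^n + L_2(0,1). *)
Definition normX n (v : 'cV[R[i]]_n) (f : R -> R[i]) : R :=
  Num.sqrt (\sum_k Normc.normc (v k 0) ^+ 2 +
            \int[lebesgue_measure]_(z in `[0, 1]) (Normc.normc (f z) ^+ 2)).

End ComplexValued.

(* Plant x_t = lam x_zz + a x + g1^T P v on (0, 1) with Robin coefficients q, ql,
   input coefficient b, output c x(1, t), and signal model v' = S v;
   ng is the number of entries of g1, g2, g3. *)
Record agent (R : realType) := Agent {
  ag_nv : nat;
  ag_ng : nat;
  ag_lam : R;
  ag_a : R -> R -> R;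
  ag_q : R -> R;
  ag_ql : R -> R;
  ag_b : R;
  ag_c : R;
  ag_S : 'M[R]_ag_nv;
  ag_P : 'M[R]_(ag_ng, ag_nv);
  ag_g1 : R -> R -> 'cV[R]_ag_ng;
  ag_g2 : R -> 'cV[R]_ag_ng;
  ag_g3 : R -> 'cV[R]_ag_ng
}.

Section Agent.
Context {R : realType} (A : agent R).

Definition tg1 (z t : R) : 'rV[R]_(ag_nv A) := (ag_g1 A z t)^T *m ag_P A.
Definition tg2 (t : R) : 'rV[R]_(ag_nv A) := (ag_g2 A t)^T *m ag_P A.
Definition tg3 (t : R) : 'rV[R]_(ag_nv A) := (ag_g3 A t)^T *m ag_P A.

Definition observable : Prop :=
  \rank (\mxcol_(k < ag_nv A) (ag_P A *m ag_S A ^+ k)) = ag_nv A.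

Definition standing (alpha tb : R) : Prop :=
  [/\ 0 < ag_lam A, ag_b A != 0 & ag_c A != 0] /\
  [/\ space_gevrey continuous01 alpha tb (ag_a A),
      gevrey alpha tb (ag_q A),
      gevrey alpha tb (ag_ql A),
      forall k, space_gevrey piecewise_continuous01 alpha tb
                  (fun z t => ag_g1 A z t k 0)
    & forall k, gevrey alpha tb (fun t => ag_g2 A t k 0) /\
                gevrey alpha tb (fun t => ag_g3 A t k 0)] /\
  [/\ observable,
      diagonalizable (toC (ag_S A))
    & forall x : R[i], eigenvalue (toC (ag_S A)) x -> complex.Re x = 0].

(* The kernel p is C^1 on the closed triangle, with p_z = pz and
   p_zeta = pzeta.  As a(., t) is only continuous, p(z, z, t) is only C^1 and
   p_zz, p_zetazeta need not exist separately; for strong solutions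
   p_zz - p_zetazeta is the derivative of p_z - p_zeta in the direction (1, 1),
   i.e. (d_z + d_zeta)(d_z - d_zeta) p, which is the usual difference whenever p
   is C^2 in the open triangle. *)
Definition strong_kernel (alpha tb mu : R) (p pz pzeta : R -> R -> R -> R) :
    Prop :=
  let triangle := [set w : R * R | 0 <= w.1 /\ w.1 <= w.2 /\ w.2 <= 1] in
  let domain := [set w : R * R * R | triangle w.1 /\ tb < w.2] in
  [/\ gevrey_on triangle alpha tb (fun w t => p w.1 w.2 t),
      [/\ {within domain, continuous (fun w => p w.1.1 w.1.2 w.2)},
          {within domain, continuous (fun w => pz w.1.1 w.1.2 w.2)}
        & {within domain, continuous (fun w => pzeta w.1.1 w.1.2 w.2)}],
      forall z zeta t : R, 0 < z -> z < zeta -> zeta < 1 -> tb < t ->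
        [/\ is_derive z 1 (fun y => p y zeta t) (pz z zeta t),
            is_derive zeta 1 (fun y => p z y t) (pzeta z zeta t)
          & exists box : R,
              is_derive (0 : R) 1 (fun s : R => pz (z + s) (zeta + s) t
                                      - pzeta (z + s) (zeta + s) t) box /\
              derive1 (p z zeta) t
                = ag_lam A * box + (ag_a A z t + mu) * p z zeta t],
      forall zeta t : R, 0 < zeta < 1 -> tb < t ->
        pz 0 zeta t = ag_q A t * p 0 zeta t
    & forall z t : R, 0 <= z <= 1 -> tb < t ->
        p z z t = ag_q A t - \int[lebesgue_measure]_(zeta in `[0, z])
                            ((ag_a A zeta t + mu) / (2 * ag_lam A))].

(* [To_inv] is the backstepping transformation, [is_To] says that [To] is its
   inverse; arguments as in T[f, t](z). *)
Definition To_inv (p : R -> R -> R -> R) (f : R -> R) (t z : R) : R :=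
  f z - \int[lebesgue_measure]_(zeta in `[z, 1]) (p z zeta t * f zeta).

Definition is_To (tb : R) (p : R -> R -> R -> R)
    (To : (R -> R) -> R -> R -> R) : Prop :=
  forall t (f : R -> R), tb < t -> L2 f ->
    [/\ L2 (To f t),
        forall z, 0 <= z <= 1 -> To_inv p (To f t) t z = f z
      & forall z, 0 <= z <= 1 -> To (To_inv p f t) t z = f z].

Definition hbar1 (p : R -> R -> R -> R) (To : (R -> R) -> R -> R -> R)
    (z t : R) : 'rV[R]_(ag_nv A) :=
  \row_j (To (fun y => tg1 y t 0 j) t z
          + To (fun y => p y 1 t) t z * ag_lam A * tg3 t 0 j).

Definition gamma_solution (tb mu : R) (p : R -> R -> R -> R)
    (To : (R -> R) -> R -> R -> R)
    (gam gamz gamzz : R -> R -> 'cV[R]_(ag_nv A)) : Prop :=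
  let rhs z t : 'rV[R]_(ag_nv A) :=
    ag_lam A *: (gamzz z t)^T - mu *: (gam z t)^T - (gam z t)^T *m ag_S A
    + hbar1 p To z t in
  [/\ forall j, evolution tb (fun z t => gam z t j 0) (fun z t => gamz z t j 0)
                  (fun z t => gamzz z t j 0) (fun z t => rhs z t 0 j),
      forall t, tb < t -> (gamz 0 t)^T = tg2 t /\ (gamz 1 t)^T = tg3 t,
      forall j, H2 (fun z => gam z tb j 0) (fun z => gamz z tb j 0)
                  (fun z => gamzz z tb j 0)
    & (gamz 0 tb)^T = rlim_mx tg2 tb /\ (gamz 1 tb)^T = rlim_mx tg3 tb].

Definition gain_l1 (p : R -> R -> R -> R) (t : R) : R := - (p 1 1 t / ag_c A).

Definition gain_lx (p pzeta : R -> R -> R -> R) (gam : R -> R -> 'cV[R]_(ag_nv A))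
    (lv : R -> 'cV[R]_(ag_nv A)) (z t : R) : R :=
  To_inv p (fun y => ((gam y t)^T *m lv t) 0 0) t z
  - ag_lam A / ag_c A * pzeta z 1 t.

Definition fundamental_matrix n (tb : R) (F : R -> 'M[R]_n)
    (Psi : R -> R -> 'M[R]_n) : Prop :=
  forall tau, tb < tau ->
    Psi tau tau = 1%:M /\
    forall t, tb < t -> forall i j,
      is_derive t 1 (fun s => Psi s tau i j) ((F t *m Psi t tau) i j).

(* The choice of matrix norm only affects kappa. *)
Definition exp_bounded n (tb mu : R) (Psi : R -> R -> 'M[R]_n) : Prop :=
  exists2 kappa : R, 0 < kappa &
    forall t tau, tb < tau -> tau <= t ->
      mx_norm (Psi t tau) <= kappa * expR (- (mu * (t - tau))).

Definition agent_solution (t0 : R) (u : R -> R[i]) (v : R -> 'cV[R[i]]_(ag_nv A))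
    (x xz xzz : R -> R -> R[i]) : Prop :=
  [/\ odeC t0 v (fun t => toC (ag_S A) *m v t),
      evolutionC t0 x xz xzz (fun z t =>
        (ag_lam A)%:C * xzz z t + (ag_a A z t)%:C * x z t
        + (toC (tg1 z t) *m v t) 0 0),
      forall t, t0 < t ->
        xz 0 t = (ag_q A t)%:C * x 0 t + (toC (tg2 t) *m v t) 0 0
    & forall t, t0 < t ->
        xz 1 t = (ag_ql A t)%:C * x 1 t + (ag_b A)%:C * u t
                 + (toC (tg3 t) *m v t) 0 0].

Definition output (x : R -> R -> R[i]) (t : R) : R[i] := (ag_c A)%:C * x 1 t.

Definition observer_solution (t0 : R) (lv : R -> 'cV[R]_(ag_nv A))
    (lx : R -> R -> R) (l1 : R -> R) (u eta : R -> R[i])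
    (vh : R -> 'cV[R[i]]_(ag_nv A)) (xh xhz xhzz : R -> R -> R[i]) : Prop :=
  let innov t := eta t - output xh t in
  [/\ odeC t0 vh (fun t => toC (ag_S A) *m vh t + innov t *: toC (lv t)),
      evolutionC t0 xh xhz xhzz (fun z t =>
        (ag_lam A)%:C * xhzz z t + (ag_a A z t)%:C * xh z t
        + (toC (tg1 z t) *m vh t) 0 0 + (lx z t)%:C * innov t),
      forall t, t0 < t ->
        xhz 0 t = (ag_q A t)%:C * xh 0 t + (toC (tg2 t) *m vh t) 0 0
    & forall t, t0 < t ->
        xhz 1 t = (ag_ql A t / ag_c A)%:C * eta t + (ag_b A)%:C * u t
                  + (toC (tg3 t) *m vh t) 0 0 + (l1 t)%:C * innov t].

(* (ev, ex) is in C^n + H^2(0,1) and satisfies the boundary conditions of the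
   error dynamics at time t0. *)
Definition admissible_error (t0 : R) (l1 : R -> R) (ev : 'cV[R[i]]_(ag_nv A))
    (ex : R -> R[i]) : Prop :=
  exists ex1 ex2 : R -> R[i],
  [/\ H2C ex ex1 ex2,
      ex1 0 = (rlim (ag_q A) t0)%:C * ex 0 + (toC (rlim_mx tg2 t0) *m ev) 0 0
    & ex1 1 = (toC (rlim_mx tg3 t0) *m ev) 0 0
              - (rlim l1 t0 * ag_c A)%:C * ex 1].

End Agent.

(* Main.v *)
(* Let w = T_o[e_x] and eps = w - gamma^T e_v.  The kernel equations and the
   equation of gamma turn the error system into the cascade
     eps_t = lambda eps_zz - mu eps,  eps_z(0) = eps_z(1) = 0,
     e_v' = (S - l_v c gamma(1)^T) e_v - c l_v eps(1),
   which involves no forcing of eps by e_v.  The energy identity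
   (|eps|^2)' = - 2 lambda |eps_z|^2 - 2 mu |eps|^2 gives the decay of eps and
   controls the time integral of |eps(1)|^2 <= 2 |eps|^2 + 2 |eps_z|^2; variation
   of constants with Psi then gives the decay of e_v.  As mu differs from muv, the
   convolution of the two exponentials decays like exp(- min(mu, muv) t).

   The estimate passes to (e_v, e_x) because T_o^-1 = 1 - V, with V a Volterra
   operator of bounded kernel, is invertible with bounds that do not depend on t,
   and because gamma is bounded in L_2: along the eigenvectors of S, whose
   eigenvalues i omega are imaginary, its components solve damped heat equations in
   which the rotation by omega does not contribute to the energy.  Everything is
   done for t > s > t_0, after which s tends to t_0. *)
Require Import Defs.
From mathcomp Require Import measurable_realfun ring lra.

Set Implicit Arguments.
Unset Strict Implicit.
Unset Printing Implicit Defensive.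

Import Order.TTheory GRing.Theory Num.Theory.
Import numFieldNormedType.Exports.
Local Open Scope classical_set_scope.
Local Open Scope complex_scope.
Local Open Scope ring_scope.

(** Missing regularity shapes the proof. In space, p is only C^1 with one further derivative along
    diagonals. Spatial derivatives are therefore taken in the sense of absolutely continuous
    primitives ([prim]), an integral over [z, 1] is differentiated by exchanging integrals over a
    triangle, and p_z is split into p_z - p_zeta, which is differentiable along diagonals, and
    p_zeta, which is integrated by parts. In time, differentiability of w is not given: it follows
    from the formally differentiated Volterra equation, through the uniform inverse bound and the
    Gevrey bound on the second time derivative of p. The gain l_v is merely bounded, so no integral
    in time is formed: the dissipation appears as the derivative of a weighted energy, and variation
    of constants becomes a mean value comparison with an explicit majorant. That comparison needs
    the derivative of Psi in its second argument. It comes from inverting Psi, once uniqueness of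
    solutions is shown without continuity of the coefficient matrix. *)

Notation ig a b f := (Rintegral (@lebesgue_measure _) (`[a, b]%classic) f).
Notation intg a b f :=
  ((@lebesgue_measure _).-integrable (`[a, b]%classic) (EFin \o f)).
Notation cont2 k := (continuous (fun w : _ * _ => k w.1 w.2)).

(** * Integrals on intervals *)

Section IntervalIntegral.
Context {R : realType}.
Implicit Types (a b c d M : R) (f g F : R -> R).

Lemma intg_sub a b c d f : a <= c -> d <= b -> intg a b f -> intg c d f.
Proof.
move=> ac db; apply: integrableS => //.
by move=> x /=; rewrite !in_itv/= => /andP[cx xd]; apply/andP; split; lra.
Qed.

Lemma intg_meas a b f : intg a b f -> measurable_fun (`[a, b] : set R) f.
Proof. by move=> /integrableP[/measurable_EFinP]. Qed.

Lemma intg_ext a b f g : (forall x, a <= x <= b -> f x = g x) ->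
  intg a b f -> intg a b g.
Proof.
move=> fg; apply: eq_integrable => // x; rewrite inE/= in_itv/= => xab.
by rewrite /= fg.
Qed.

Lemma intg_cont a b f : {within `[a, b], continuous f} -> intg a b f.
Proof.
by move=> cf; apply: continuous_compact_integrable => //; exact: segment_compact.
Qed.

Lemma intg_continuous a b f : continuous f -> intg a b f.
Proof. by move=> cf; apply: intg_cont; exact: continuous_subspaceT. Qed.

Lemma intg_cst a b M : intg a b (fun=> M).
Proof. by apply: intg_continuous => x; exact: cvg_cst. Qed.

Lemma intgD a b f g : intg a b f -> intg a b g -> intg a b (fun x => f x + g x).
Proof. by move=> hf hg; exact: (integrableD _ hf hg). Qed.

Lemma intgB a b f g : intg a b f -> intg a b g -> intg a b (fun x => f x - g x).
Proof. by move=> hf hg; exact: (integrableB _ hf hg). Qed.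

Lemma intgN a b f : intg a b f -> intg a b (fun x => - f x).
Proof. by move=> hf; exact: (integrableN hf). Qed.

Lemma intgZ a b M f : intg a b f -> intg a b (fun x => M * f x).
Proof. by move=> hf; exact: (integrableZl _ M hf). Qed.

Lemma intgZr a b M f : intg a b f -> intg a b (fun x => f x * M).
Proof.
by move=> /(@intgZ _ _ M); apply: intg_ext => x _; rewrite mulrC.
Qed.

Lemma intg_abs a b f : intg a b f -> intg a b (fun x => `|f x|).
Proof. by move=> hf; exact: (integrable_norm hf). Qed.

Lemma intg_le a b f g : measurable_fun (`[a, b] : set R) f ->
  (forall x, a <= x <= b -> `|f x| <= g x) -> intg a b g -> intg a b f.
Proof.
move=> mf fg; apply: le_integrable => //; first exact/measurable_EFinP.
move=> x /=; rewrite in_itv/= => xab; rewrite lee_fin.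
by rewrite (le_trans (fg x xab))// ler_norm.
Qed.

Lemma intgM_bd a b M f g : measurable_fun (`[a, b] : set R) f ->
  (forall x, a <= x <= b -> `|f x| <= M) -> intg a b g ->
  intg a b (fun x => f x * g x).
Proof.
move=> mf fM hg; apply: (@intg_le _ _ _ (fun x => M * `|g x|)).
- by apply: measurable_funM => //; exact: intg_meas.
- by move=> x xab; rewrite normrM ler_wpM2r// fM.
- by apply: intgZ; exact: intg_abs.
Qed.

Lemma ig_ext a b f g : (forall x, a <= x <= b -> f x = g x) ->
  ig a b f = ig a b g.
Proof.
by move=> fg; apply: eq_Rintegral => x; rewrite inE/= in_itv/= => /fg.
Qed.

Lemma igD a b f g : intg a b f -> intg a b g ->
  ig a b (fun x => f x + g x) = ig a b f + ig a b g.
Proof. exact: RintegralD. Qed.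

Lemma igB a b f g : intg a b f -> intg a b g ->
  ig a b (fun x => f x - g x) = ig a b f - ig a b g.
Proof. exact: RintegralB. Qed.

Lemma igZ a b M f : intg a b f -> ig a b (fun x => M * f x) = M * ig a b f.
Proof. exact: RintegralZl. Qed.

Lemma igZr a b M f : intg a b f -> ig a b (fun x => f x * M) = ig a b f * M.
Proof. exact: RintegralZr. Qed.

Lemma igN a b f : intg a b f -> ig a b (fun x => - f x) = - ig a b f.
Proof.
move=> hf; rewrite -mulN1r -igZ//; apply: ig_ext => x _; lra.
Qed.

Lemma ig_cst a b M : a <= b -> ig a b (fun=> M) = M * (b - a).
Proof.
move=> ab; rewrite Rintegral_cst//= lebesgue_measure_itv/= lte_fin.
by case: ltrgtP ab => // -> _; rewrite subrr.
Qed.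

Lemma ig_aa a f : ig a a f = 0.
Proof. by rewrite set_itv1 Rintegral_set1. Qed.

Lemma ig_split a c b f : a <= c -> c <= b -> intg a b f ->
  ig a b f = ig a c f + ig c b f.
Proof.
move=> ac cb hf.
have := @Rintegral_itvB R f (BLeft a) (BRight b) c hf.
rewrite !bnd_simp => /(_ ac cb) h.
rewrite -(@Rintegral_itv_obnd_cbnd R c (BRight b) f); last first.
  by apply: integrableS hf => //; apply: subset_itvr; rewrite bnd_simp.
by rewrite -h addrC subrK.
Qed.

Lemma ig_le a b f g : intg a b f -> intg a b g ->
  (forall x, a <= x <= b -> f x <= g x) -> ig a b f <= ig a b g.
Proof.
by move=> hf hg fg; apply: le_Rintegral => // x /=; rewrite in_itv/= => /fg.
Qed.

Lemma ig_ge0 a b f : (forall x, a <= x <= b -> 0 <= f x) -> 0 <= ig a b f.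
Proof.
by move=> f0; apply: Rintegral_ge0 => x /=; rewrite in_itv/= => /f0.
Qed.

Lemma ig_norm a b f : intg a b f -> `|ig a b f| <= ig a b (fun x => `|f x|).
Proof. by move=> hf; exact: le_normr_Rintegral. Qed.

Lemma ig_bd a b M f : a <= b -> intg a b f ->
  (forall x, a <= x <= b -> `|f x| <= M) -> `|ig a b f| <= M * (b - a).
Proof.
move=> ab hf fM; rewrite (le_trans (ig_norm hf))// -ig_cst//.
by apply: ig_le => //; [exact: intg_abs|exact: intg_cst].
Qed.

Lemma intg_sum a b (I : Type) (s : seq I) (F : I -> R -> R) :
  (forall i, intg a b (F i)) -> intg a b (fun x => \sum_(i <- s) F i x).
Proof.
move=> hF; elim: s => [|i s IH].
  by apply: (intg_ext _ (intg_cst a b 0)) => x _; rewrite big_nil.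
by apply: (intg_ext _ (intgD (hF i) IH)) => x _; rewrite big_cons.
Qed.

Lemma ig_continuous a b f : a <= b -> intg a b f ->
  {within `[a, b], continuous (fun x => ig a x f)}.
Proof. by move=> ab hf; exact: parameterized_integral_continuous. Qed.

Lemma FTC2 F f a b : a <= b -> {within `[a, b], continuous f} ->
  {within `[a, b], continuous F} ->
  (forall x : R, a < x < b -> is_derive x 1 F (f x)) -> ig a b f = F b - F a.
Proof.
rewrite le_eqVlt => /predU1P[-> _ _ _|ab cf cF dF]; first by rewrite ig_aa subrr.
rewrite /Rintegral (continuous_FTC2 ab cf (F := F))//.
  split.
  - by move=> x; rewrite in_itv/= => /dF[].
  - by have /(continuous_within_itvP _ ab)[_ ? _] := cF.
  - by have /(continuous_within_itvP _ ab)[_ _ ?] := cF.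
by move=> x; rewrite in_itv/= derive1E => /dF h; exact: derive_val.
Qed.

Lemma FTC2_continuous F f a b : a <= b -> continuous f ->
  (forall x : R, is_derive x 1 F (f x)) -> ig a b f = F b - F a.
Proof.
move=> ab cf dF; apply: FTC2 => //; apply: continuous_subspaceT => // x.
by apply: differentiable_continuous; apply/derivable1_diffP; case: (dF x).
Qed.

(** The product sigma-algebra is generated by rectangles, so the open preimage of an interval is
    written as the countable union of the boxes with rational end points that it contains. *)
Lemma measurable_continuous2 (k : R -> R -> R) : cont2 k ->
  measurable_fun setT (fun w : R * R => k w.1 w.2).
Proof.
move=> ck; apply: (measurability _ (RGenOpens.measurableE R)).
move=> _ [_ [a [b ->] <-]]; rewrite setTI.
set U := _ @^-1` _.
have oU : open U by apply: open_comp => //; exact: interval_open.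
pose B (q : rat * rat * (rat * rat)) : set (R * R) :=
  `]ratr q.1.1, ratr q.1.2[ `*` `]ratr q.2.1, ratr q.2.2[.
have -> : U = \bigcup_(q1 : rat) \bigcup_(q2 : rat) \bigcup_(q3 : rat)
    \bigcup_(q4 : rat) (if `[< B (q1, q2, (q3, q4)) `<=` U >]
                       then B (q1, q2, (q3, q4)) else set0).
  apply/seteqP; split => [[x y] Uxy|w].
    have /nbhs_ballP[e e0 eU] : nbhs (x, y) U by exact: open_nbhs_nbhs.
    have [xl xr] : x - e < x /\ x < x + e by move: e0 => /= ?; split; lra.
    have [yl yr] : y - e < y /\ y < y + e by move: e0 => /= ?; split; lra.
    have [q1 /[!in_itv]/= /andP[? ?]] := rat_in_itvoo xl.
    have [q2 /[!in_itv]/= /andP[? ?]] := rat_in_itvoo xr.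
    have [q3 /[!in_itv]/= /andP[? ?]] := rat_in_itvoo yl.
    have [q4 /[!in_itv]/= /andP[? ?]] := rat_in_itvoo yr.
    exists q1 => //; exists q2 => //; exists q3 => //; exists q4 => //.
    case: asboolP => [_|[]].
      by split; rewrite /= in_itv/=; apply/andP; split.
    move=> [x' y'] [/=]; rewrite !in_itv/= => /andP[? ?] /andP[? ?].
    by apply: eU; split; rewrite /ball/= ltr_norml; apply/andP; split; lra.
  move=> [q1 _ [q2 _ [q3 _ [q4 _]]]].
  by case: asboolP => // sub /sub.
do 4 (apply: bigcupT_measurable_rat => ?).
by case: asboolP => // _; apply: measurableX.
Qed.

Lemma integral_igE a b f : intg a b f ->
  (\int[lebesgue_measure]_(x in `[a, b]) (f x)%:E = (ig a b f)%:E)%E.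
Proof.
by move=> hf; rewrite /Rintegral fineK//; exact: integrable_fin_num.
Qed.

(** * Exchange of integrals over a triangle *)

Section Fubini.
Variables (k : R -> R -> R) (f : R -> R) (M a b : R).
Hypotheses (ck : cont2 k) (kM : forall y z, `|k y z| <= M) (hf : intg a b f).

Let f_ : R -> R := f \_ `[a, b].
Local Notation RR := (measurableTypeR R * measurableTypeR R)%type.
(** The triangle a <= y <= z <= b is encoded by an integrand [F] on the whole plane: [D] gives a <=
    y <= b and y <= z, while the zero extension [f_] gives z <= b. *)
Let D : set RR := [set w | a <= w.1 <= b /\ w.1 <= w.2].
Let F (w : RR) : R := k w.1 w.2 * f_ w.2 * \1_D w.

Let mD : measurable D.
Proof.
have -> : D = (fst @^-1` `[a, b]) `&` ((fun w : RR => (w.2 : R) - w.1) @^-1` `[0, +oo[).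
  by apply/seteqP; split=> -[x y]; rewrite /D/= !in_itv/= ?andbT subr_ge0.
apply: measurableI; rewrite -[X in measurable X]setTI.
  exact: measurable_fst.
have m : measurable_fun setT (fun w : RR => (w.2 : R) - w.1).
  apply: (@measurable_funB _ RR R setT (fun w => w.2 : R) (fun w => w.1 : R)).
    exact: measurable_snd.
  exact: measurable_fst.
exact: m.
Qed.

Let mf_ : measurable_fun setT f_.
Proof. by apply/(measurable_restrictT f _) => //; exact: intg_meas hf. Qed.

Let intf_ : (@lebesgue_measure R).-integrable setT (EFin \o f_).
Proof.
have := hf; rewrite integrable_mkcond//; apply: eq_integrable => // x _ /=.
by rewrite restrict_EFin.
Qed.

Let mF : measurable_fun setT F.
Proof.
apply: measurable_funM; last exact: measurable_indic.
apply: measurable_funM; first exact: measurable_continuous2.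
exact: measurableT_comp.
Qed.

Let kx_cont x : continuous (k x).
Proof.
move=> y; apply: (@continuous_comp _ _ _ (fun y => (x, y)) (fun w : R * R => k w.1 w.2)).
  exact: (cvg_pair (cvg_cst _) cvg_id).
exact: ck.
Qed.

Let ky_cont y : continuous (k^~ y).
Proof.
move=> x; apply: (@continuous_comp _ _ _ (fun x => (x, y)) (fun w : R * R => k w.1 w.2)).
  exact: (cvg_pair cvg_id (cvg_cst _)).
exact: ck.
Qed.

Let intkf x : intg a b (fun z => k x z * f z).
Proof.
by apply: (@intgM_bd _ _ M) => //; apply: intg_meas; exact: intg_continuous.
Qed.

Let intF : ((@lebesgue_measure R) \x (@lebesgue_measure R))%E.-integrable
  setT (EFin \o F).
Proof.
apply/integrable12ltyP; first exact/measurable_EFinP.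
have M0 : 0 <= M by exact: le_trans (kM 0 0).
pose C := ig a b (fun z => M * `|f z|).
have C0 : 0 <= C by apply: ig_ge0 => x _; apply: mulr_ge0.
have HC : (\int[lebesgue_measure]_y (M * `|f_ y|)%:E = C%:E)%E.
  rewrite -integral_igE; last by apply: intgZ; exact: intg_abs.
  rewrite [RHS]integral_mkcond; apply: eq_integral => y _.
  rewrite /f_ /patch; case: ifP => // _; by rewrite normr0 mulr0.
(* The section of [F] at x has an absolute integral of at most [C] for x in [a, b] and vanishes for
   other x. *)
apply: (@le_lt_trans _ _ (\int[lebesgue_measure]_(x in `[a, b]) (C%:E))%E); last first.
  by rewrite (integral_igE (intg_cst a b C)) ltry.
rewrite [leRHS]integral_mkcond; apply: ge0_le_integral => //.
- by move=> x _; exact: integral_ge0.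
- apply: (@measurable_fun_fubini_tonelli_F _ _ _ _ _ _ (fun w => `|(F w)%:E|%E)) => //.
  by apply: measurableT_comp => //; exact/measurable_EFinP.
- apply/(measurable_restrictT (fun=> C%:E)) => //; exact: measurable_cst.
- move=> x _; rewrite /patch mem_setE in_itv/=; case: ifPn => [xab|nx].
    rewrite -HC; apply: ge0_le_integral => //.
    + apply/measurable_EFinP; apply: measurableT_comp => //.
      exact: (measurableT_comp mF (measurable_pair1 x)).
    + apply/measurable_EFinP; apply: measurable_funM => //; exact: measurableT_comp.
    move=> y _; rewrite /F/= lee_fin !normrM indicE.
    case: (_ \in D); rewrite ?normr1 ?normr0 ?mulr1 ?mulr0; last exact: mulr_ge0.
    exact: ler_wpM2r.
  rewrite integral0_eq// => y _; rewrite /F/= indicE memNset ?mulr0 ?normr0//.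
  by case=> xab' _; rewrite xab' in nx.
Qed.

Let FyE x : (\int[lebesgue_measure]_y (F (x, y))%:E =
  ((fun x => ig x b (fun z => k x z * f z)) \_ `[a, b] x)%:E)%E.
Proof.
rewrite /patch mem_setE in_itv/=; case: ifPn => xab.
  have /andP[ax xb] := xab.
  rewrite -integral_igE; last exact: intg_sub (intkf x).
  rewrite [RHS]integral_mkcond; apply: eq_integral => y _.
  rewrite /F/= /f_ /patch indicE.
  have -> : ((x, y) \in D) = (x <= y).
    by apply/idP/idP; rewrite inE /D/=; [case|].
  have -> : (y \in `[x, b]%classic) = (x <= y <= b) by rewrite mem_setE in_itv.
  have -> : (y \in `[a, b]%classic) = (a <= y <= b) by rewrite mem_setE in_itv.
  case: (leP x y) => xy /=; last by rewrite mulr0.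
  by rewrite (le_trans ax xy)/= mulr1; case: ifP => //; rewrite mulr0.
rewrite integral0_eq// => y _; rewrite /F/= indicE memNset ?mulr0//.
by case=> xab' _; rewrite xab' in xab.
Qed.

Let FxE y : (\int[lebesgue_measure]_x (F (x, y))%:E =
  ((fun y => ig a y (k^~ y) * f y) \_ `[a, b] y)%:E)%E.
Proof.
rewrite /patch mem_setE in_itv/=; case: ifPn => yab.
  have /andP[ay yb] := yab.
  rewrite -igZr; last exact: intg_continuous.
  rewrite -integral_igE; last by apply: intgZr; exact: intg_continuous.
  rewrite [RHS]integral_mkcond; apply: eq_integral => x _.
  rewrite /F/= /f_ /patch indicE (_ : y \in `[a, b]%classic); last by rewrite mem_setE in_itv.
  have -> : (x \in `[a, y]%classic) = (a <= x <= y) by rewrite mem_setE in_itv.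
  have -> : ((x, y) \in D) = (a <= x <= y).
    apply/idP/idP; rewrite inE /D/=; first by case=> /andP[-> _].
    by move=> /andP[ax xy]; rewrite ax xy (le_trans xy yb).
  by case: ifP => //= _; rewrite ?mulr1 ?mulr0.
rewrite integral0_eq// => x _; rewrite /F/= /f_ /patch memNset ?mulr0 ?mul0r//=.
by rewrite in_itv/=; exact/negP.
Qed.

Lemma fubini_triangle :
  ig a b (fun z => ig a z (k^~ z) * f z)
  = ig a b (fun y => ig y b (fun z => k y z * f z)).
Proof.
rewrite [LHS]Rintegral_mkcond [RHS]Rintegral_mkcond /Rintegral; congr fine.
have := Fubini intF => /=.
under eq_integral do rewrite FyE.
by under [X in _ = X -> _]eq_integral do rewrite FxE.
Qed.

(** Fubini's theorem also yields integrability of the inner integral, for [f] merely integrable. *)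
Lemma intg_volterra : intg a b (fun y => ig y b (fun z => k y z * f z)).
Proof.
rewrite integrable_mkcond//; have := integrable_fubini_F intF.
rewrite /fubini_F/=; congr (is_true (integrable _ _ _)); apply/funext => x.
by rewrite FyE restrict_EFin.
Qed.

End Fubini.

End IntervalIntegral.

(** * Absolutely continuous functions on [0, 1] *)

Section Primitives.
Context {R : realType}.
Implicit Types (a b c d M x y z s : R) (f g w : R -> R) (k : R -> R -> R).

(** Composition with this retraction of the line onto [0, 1] turns continuity within [0, 1] into
    continuity and boundedness everywhere. *)
Definition clamp x : R := if x < 0 then 0 else if 1 < x then 1 else x.

Lemma clamp01 x : 0 <= clamp x <= 1.
Proof. by rewrite /clamp; case: ltP => ?; [|case: ltP => ?]; apply/andP; split; lra. Qed.

Lemma clampE x : 0 <= x <= 1 -> clamp x = x.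
Proof. by move=> /andP[? ?]; rewrite /clamp; case: ltP => ?; [|case: ltP => ?]; lra. Qed.

Lemma clamp_lip x y : `|clamp x - clamp y| <= `|x - y|.
Proof.
have h1 := ler_norm (x - y); have h2 := ler_norm (y - x); rewrite distrC in h2.
have h3 := normr_ge0 (x - y); move: `|x - y| h1 h2 h3 => d h1 h2 h3.
rewrite ler_norml /clamp.
by case: (ltP x 0) => ?; case: (ltP y 0) => ?; try case: (ltP 1 x) => ?;
  try case: (ltP 1 y) => ?; apply/andP; split; lra.
Qed.

Lemma lipschitz_continuous f : (forall x y, `|f x - f y| <= `|x - y|) -> continuous f.
Proof.
move=> H x; apply/cvgrPdist_lt => e e0; near=> y.
apply: le_lt_trans (H _ _) _; near: y.
by apply: (@cvgr_dist_lt _ _ _ _ _ id) => //; exact: cvg_id.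
Unshelve. all: by end_near. Qed.

Lemma continuous_clamp : continuous clamp.
Proof. by apply: lipschitz_continuous; exact: clamp_lip. Qed.

Lemma within01P f : {within `[0, 1], continuous f} -> continuous (f \o clamp).
Proof.
move=> cf x; have c01 := clamp01 x.
have /= h : f y @[y --> within `[0, 1] (nbhs (clamp x))] --> f (clamp x).
  by have /subspace_continuousP := cf; apply; rewrite /= in_itv.
apply/cvgrPdist_lt => e e0; have /cvgrPdist_lt/(_ e e0) H0 := h.
have H : \forall t \near clamp x, `[0, 1]%classic t -> `|f (clamp x) - f t| < e by exact: H0.
have H1 : \forall y \near x, `[0, 1]%classic (clamp y) ->
  `|f (clamp x) - f (clamp y)| < e by exact: (continuous_clamp H).
near=> y; have : `[0, 1]%classic (clamp y) by rewrite /= in_itv/=; exact: clamp01.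
by near: y.
Unshelve. all: by end_near. Qed.

Lemma bounded_continuous_clamp f : continuous f -> exists2 M, 0 <= M & forall x, `|f (clamp x)| <= M.
Proof.
move=> cf; have c : {within `[0:R, 1], continuous (fun x => `|f x|)}.
  by apply: continuous_subspaceT => x; apply: continuous_comp; [exact: cf|exact: norm_continuous].
have [m m01 mM] := EVT_max (@ler01 R) c.
by exists `|f m| => // x; apply: mM; rewrite in_itv/=; exact: clamp01.
Qed.

Lemma within01_bounded f : {within `[0, 1], continuous f} ->
  exists2 M, 0 <= M & forall x, 0 <= x <= 1 -> `|f x| <= M.
Proof.
move=> /within01P /bounded_continuous_clamp[M M0 H]; exists M => // x x01.
by have := H x; rewrite /= !clampE.
Qed.

(** This is absolute continuity of [f] on [0, 1] with weak derivative [g], in a form that suits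
    second derivatives known only in L_2. *)
Definition prim f g := intg 0 1 g /\ forall z, 0 <= z <= 1 -> f z = f 0 + ig 0 z g.

Lemma prim_diff f g a b : prim f g -> 0 <= a -> a <= b -> b <= 1 ->
  f b - f a = ig a b g.
Proof.
move=> [ig_ fE] a0 ab b1; rewrite (fE b); last by apply/andP; split; lra.
rewrite (fE a); last by apply/andP; split; lra.
rewrite (@ig_split _ 0 a b)//; last by apply: intg_sub ig_.
by lra.
Qed.

Lemma prim_cont f g : prim f g -> {within `[0, 1], continuous f}.
Proof.
move=> [ig_ fE].
apply: (@subspace_eq_continuous _ _ _ (fun z => f 0 + ig 0 z g)).
  by move=> x; rewrite inE/= in_itv/= => /fE.
have := @ig_continuous _ 0 1 g ler01 ig_.
by move=> h x; apply: cvgD; [exact: cvg_cst|exact: h].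
Qed.

Lemma primD f g f' g' : prim f f' -> prim g g' ->
  prim (fun z => f z + g z) (fun z => f' z + g' z).
Proof.
move=> [if' fE] [ig' gE]; split; first exact: intgD.
move=> z z01; rewrite igD.
- by rewrite fE// gE//; lra.
- by apply: intg_sub if' => //; lra.
- by apply: intg_sub ig' => //; lra.
Qed.

Lemma primZ M f f' : prim f f' -> prim (fun z => M * f z) (fun z => M * f' z).
Proof.
move=> [if' fE]; split; first exact: intgZ.
move=> z z01; rewrite igZ; last by apply: intg_sub if' => //; lra.
by rewrite fE//; lra.
Qed.

Lemma primN f f' : prim f f' -> prim (fun z => - f z) (fun z => - f' z).
Proof.
move=> [if' fE]; split; first exact: intgN.
move=> z z01; rewrite igN; last by apply: intg_sub if' => //; lra.
by rewrite fE//; lra.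
Qed.

Lemma primB f g f' g' : prim f f' -> prim g g' ->
  prim (fun z => f z - g z) (fun z => f' z - g' z).
Proof. by move=> pf /primN; exact: primD. Qed.

Lemma prim_cst M : prim (fun=> M) (fun=> 0).
Proof.
split; first exact: intg_cst.
by move=> z /andP[z0 _]; rewrite ig_cst// mul0r addr0.
Qed.

Lemma prim_ext f f' g g' : (forall x, 0 <= x <= 1 -> f x = g x) ->
  (forall x, 0 <= x <= 1 -> f' x = g' x) -> prim f f' -> prim g g'.
Proof.
move=> fg fg' [if' fE]; split; first exact: intg_ext if'.
move=> z z01; rewrite -(fg z)// -(fg 0) ?lexx ?ler01// fE//.
congr (_ + _); apply: ig_ext => x ?; apply: fg'; lra.
Qed.

Lemma prim_from1 f g : intg 0 1 g -> (forall z, 0 <= z <= 1 -> f z = f 1 - ig z 1 g) ->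
  prim f g.
Proof.
move=> ig_ fE; split => // z z01; rewrite (fE z)// (fE 0); last by rewrite lexx ler01.
by rewrite (@ig_split _ 0 z 1 g) //; lra.
Qed.

(** As [g'] is only integrable, there is no pointwise product rule. Instead [f] is replaced by the
    integral of [f'], and the two integrals are exchanged over the triangle. *)
Lemma ibp_gen f f' g g' a b : a <= b -> continuous f' -> intg a b g' ->
  (exists M, forall x, `|f' x| <= M) ->
  (forall x, a <= x <= b -> f x = f a + ig a x f') ->
  (forall x, a <= x <= b -> g x = g a + ig a x g') ->
  ig a b (fun x => f x * g' x) = f b * g b - f a * g a - ig a b (fun x => f' x * g x).
Proof.
move=> ab cf' hg' [M f'M] fE gE.
have cg : {within `[a, b], continuous g}.
  apply: (@subspace_eq_continuous _ _ _ (fun z => g a + ig a z g')).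
    by move=> x; rewrite inE/= in_itv/= => /gE.
  have := @ig_continuous _ a b g' ab hg'.
  by move=> h x; apply: cvgD; [exact: cvg_cst|exact: h].
have cFf : {within `[a, b], continuous (fun z => ig a z f')}.
  by apply: ig_continuous => //; exact: intg_continuous.
have mf' : measurable_fun (`[a, b] : set R) f'.
  by apply: intg_meas; exact: intg_continuous.
pose k := fun y z : R => f' y.
have ck : cont2 k.
  move=> w; apply: (@continuous_comp _ _ _ fst f'); [exact: cvg_fst|exact: cf'].
have F := @fubini_triangle R k g' M a b ck (fun y _ => f'M y) hg'.
rewrite (@ig_ext _ _ _ _ (fun x => f a * g' x + ig a x f' * g' x)); last first.
  by move=> x xab; rewrite fE//; lra.
have i1 : intg a b (fun x => ig a x f' * g' x).
  have M0 : 0 <= M by exact: le_trans (f'M 0).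
  apply: (@intgM_bd _ _ _ (M * (b - a))) => //.
    by apply: intg_meas; exact: intg_cont.
  move=> x /andP[ax xb]; rewrite (@le_trans _ _ (M * (x - a)))//.
    by apply: ig_bd => //; exact: intg_continuous.
  by apply: ler_wpM2l => //; lra.
rewrite igD//; last exact: intgZ.
rewrite igZ// F.
rewrite (@ig_ext _ a b (fun y => ig y b (fun z => k y z * g' z))
  (fun y => g b * f' y - f' y * g y)); last first.
  move=> y /andP[ay yb]; rewrite /k igZ; last by apply: intg_sub hg'.
  rewrite (gE b) ?(gE y) ?ay ?lexx ?andbT//.
  by rewrite (@ig_split _ a y b g')//; lra.
have i2 : intg a b f' by exact: intg_continuous.
have i3 : intg a b (fun y => f' y * g y).
  by apply: (@intgM_bd _ _ _ M) => //; exact: intg_cont.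
rewrite igB//; last exact: intgZ.
rewrite igZ//.
have -> : ig a b g' = g b - g a by rewrite (gE b) ?ab ?lexx//; lra.
have -> : ig a b f' = f b - f a by rewrite (fE b) ?ab ?lexx//; lra.
by lra.
Qed.

Lemma ibp f f' g g' a b : 0 <= a -> a <= b -> b <= 1 ->
  prim f f' -> {within `[0, 1], continuous f'} -> prim g g' ->
  ig a b (fun x => f x * g' x) = f b * g b - f a * g a - ig a b (fun x => f' x * g x).
Proof.
move=> a0 ab b1 pf cf' pg.
have [M _ HM] := bounded_continuous_clamp (within01P cf').
rewrite (@ibp_gen f (f' \o clamp) g g')//.
- congr (_ - _); apply: ig_ext => x ?; rewrite /= clampE//; lra.
- exact: within01P.
- by case: pg => + _; apply: intg_sub.
- by exists M => x; have := HM x; rewrite /= (@clampE (clamp x))//; exact: clamp01.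
- move=> x ?; have h := @prim_diff _ _ a x pf; rewrite (@ig_ext _ _ _ _ f').
    by rewrite -h//; lra.
  by move=> y ?; rewrite /= clampE//; lra.
- by move=> x ?; rewrite -(@prim_diff _ _ a x pg)//; lra.
Qed.

Lemma primM f f' g g' : prim f f' -> {within `[0, 1], continuous f'} -> prim g g' ->
  prim (fun x => f x * g x) (fun x => f' x * g x + f x * g' x).
Proof.
move=> pf cf' pg.
have i1 : intg 0 1 (fun x => f' x * g x).
  have [M _ HM] := within01_bounded cf'.
  apply: (@intgM_bd _ _ _ M) => //; first by apply: intg_meas; exact: intg_cont.
  by apply: intg_cont; exact: prim_cont pg.
have i2 : intg 0 1 (fun x => f x * g' x).
  have [M _ HM] := within01_bounded (prim_cont pf).
  apply: (@intgM_bd _ _ _ M) => //; last by case: pg.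
  by apply: intg_meas; apply: intg_cont; exact: prim_cont pf.
split; first exact: intgD.
move=> z z01; rewrite igD.
- by rewrite (@ibp f f' g g' 0 z)//; lra.
- by apply: intg_sub i1 => //; lra.
- by apply: intg_sub i2 => //; lra.
Qed.

Lemma FTC1 g a x : a < x -> continuous g -> is_derive x 1 (fun z => ig a z g) (g x).
Proof.
move=> ax cg; have xu : x < x + 1 by lra.
have [D1 D2] := @continuous_FTC1_closed R g a x (x + 1) xu (intg_continuous _ _ cg) ax (cg x).
by apply: DeriveDef; [exact: D1|rewrite -derive1E; exact: D2].
Qed.

Lemma prim_derive f g x : prim f g -> continuous g -> 0 < x < 1 -> is_derive x 1 f (g x).
Proof.
move=> [hg fE] cg /andP[x0 x1].
have h : is_derive x 1 (fun z => f 0 + ig 0 z g) (0 + g x).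
  by apply: is_deriveD; exact: FTC1.
rewrite -[g x]add0r; apply: near_eq_is_derive h; near=> y.
have y01 : 0 <= y <= 1.
  apply/andP; split; apply: ltW; near: y; [exact: lt_nbhsr|exact: lt_nbhsl].
by rewrite -(fE y y01).
Unshelve. all: by end_near. Qed.

Lemma ig_reflect f a b : a <= b -> continuous f ->
  ig a b (fun s => f (a + b - s)) = ig a b f.
Proof.
rewrite le_eqVlt => /predU1P[->|ab] cf; first by rewrite !ig_aa.
(* Starting the primitive at a - 1 makes it differentiable at the end point a as well. *)
pose G x := ig (a - 1) x f.
have dG x : a - 1 < x -> is_derive x 1 G (f x) by move=> ?; exact: FTC1.
have dF s : a - 1 < a + b - s -> is_derive s 1 (fun s => - G (a + b - s)) (f (a + b - s)).
  move=> h; have i1 : is_derive s 1 (fun s => a + b - s) (- 1).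
    by rewrite -[- 1]add0r; apply: is_deriveD.
  have := is_deriveN (@is_derive1_comp _ G (fun s => a + b - s) s _ _ (dG _ h) i1).
  by rewrite mulrN mulr1 opprK.
have -> : ig a b (fun s => f (a + b - s)) = - G (a + b - b) - - G (a + b - a).
  apply: (@FTC2 _ (fun s => - G (a + b - s)) (fun s => f (a + b - s))).
  - exact: ltW.
  - apply: continuous_subspaceT => x.
    apply: (@continuous_comp _ _ _ (fun s => a + b - s) f); last exact: cf.
    by apply: cvgB; [exact: cvg_cst|exact: cvg_id].
  - apply: continuous_in_subspaceT => x; rewrite inE/= in_itv/= => xab.
    have h : a - 1 < a + b - x by lra.
    by apply: differentiable_continuous; apply/derivable1_diffP; case: (dF _ h).
  - by move=> x xab; apply: dF; lra.
have -> : a + b - b = a by lra.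
have -> : a + b - a = b by lra.
have i1 : intg (a - 1) b f by exact: intg_continuous.
have /(_ _ _ i1) := @ig_split _ (a - 1) a b f; rewrite -/(G b) -/(G a) => ->; lra.
Qed.

End Primitives.

(** * Volterra operators *)

Section Volterra.
Context {R : realType}.
Implicit Types (a b c d M x y z s : R) (f g w : R -> R) (k p q : R -> R -> R).

(** Continuity and boundedness are asked on the whole plane, not only for z <= s, so that a kernel
    can be evaluated along any continuous path. *)
Definition ker k := cont2 k /\ exists M, forall y z, `|k y z| <= M.

Definition volterra k f z : R := ig z 1 (fun s => k z s * f s).

Lemma cont2_comp k (u v : R -> R) : cont2 k -> continuous u -> continuous v ->
  continuous (fun x => k (u x) (v x)).
Proof.
move=> ck cu cv x.
apply: (@continuous_comp _ _ _ (fun x => (u x, v x)) (fun w : R * R => k w.1 w.2)).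
  exact: (cvg_pair (cu x) (cv x)).
exact: ck.
Qed.

Lemma cont2_comp2 k (u v : R -> R -> R) : cont2 k -> cont2 u -> cont2 v ->
  cont2 (fun x y => k (u x y) (v x y)).
Proof.
move=> ck cu cv x.
exact: (@continuous_comp _ _ _ (fun x : R * R => (u x.1 x.2, v x.1 x.2))
  (fun w : R * R => k w.1 w.2) x (cvg_pair (cu x) (cv x)) (ck _)).
Qed.

Lemma cont2_comp1 f (u : R -> R -> R) : continuous f -> cont2 u ->
  cont2 (fun x y => f (u x y)).
Proof.
move=> cf cu x.
exact: (@continuous_comp _ _ _ (fun x : R * R => u x.1 x.2) f x (cu x) (cf _)).
Qed.

Lemma cont2_fst : cont2 (fun x y : R => x).
Proof. by move=> x; exact: cvg_fst. Qed.

Lemma ker_row k y : ker k -> continuous (k y).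
Proof.
by move=> [ck _]; apply: (@cont2_comp k (fun=> y) id) => // x; [exact: cvg_cst|exact: cvg_id].
Qed.

Lemma ker_col k y : ker k -> continuous (k^~ y).
Proof.
by move=> [ck _]; apply: (@cont2_comp k id (fun=> y)) => // x; [exact: cvg_id|exact: cvg_cst].
Qed.

Lemma ker_diag k : ker k -> continuous (fun y => k y y).
Proof. by move=> [ck _]; apply: (@cont2_comp k id id) => // x; exact: cvg_id. Qed.

Lemma kerD p q : ker p -> ker q -> ker (fun x y => p x y + q x y).
Proof.
move=> [cp [M pM]] [cq [N qN]]; split.
  by move=> x; exact: cvgD (cp x) (cq x).
by exists (M + N) => y z; rewrite (le_trans (ler_normD _ _))// lerD.
Qed.

Lemma kerM p q : ker p -> ker q -> ker (fun x y => p x y * q x y).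
Proof.
move=> [cp [M pM]] [cq [N qN]]; split.
  by move=> x; exact: cvgM (cp x) (cq x).
by exists (M * N) => y z; rewrite normrM ler_pM.
Qed.

Lemma ker_cst M : ker (fun _ _ => M).
Proof. by split; [move=> x; exact: cvg_cst|exists `|M|]. Qed.

Lemma kerN p : ker p -> ker (fun x y => - p x y).
Proof.
move=> hp; have -> : (fun x y => - p x y) = (fun x y => (-1) * p x y).
  by apply/funext => x; apply/funext => y; rewrite mulN1r.
by apply: kerM => //; exact: ker_cst.
Qed.

Lemma kerB p q : ker p -> ker q -> ker (fun x y => p x y - q x y).
Proof. by move=> hp /kerN; exact: kerD. Qed.

Lemma ker_fst f : continuous f -> ker (fun x _ => f (clamp x)).
Proof.
move=> cf; split.
  apply: (@cont2_comp1 (fun x => f (clamp x)) (fun x y => x)); last exact: cont2_fst.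
  move=> x.
  by apply: continuous_comp; [exact: continuous_clamp|exact: cf].
by have [M _ HM] := bounded_continuous_clamp cf; exists M.
Qed.

Lemma intg_ker k x a b f : ker k -> intg a b f -> intg a b (fun z => k x z * f z).
Proof.
move=> hk hf; have [_ [M kM]] := hk; apply: (@intgM_bd _ _ _ M) => //.
by apply: intg_meas; apply: intg_continuous; exact: ker_row.
Qed.

Lemma intg_volterra1 k a f : ker k -> intg a 1 f -> intg a 1 (volterra k f).
Proof. by move=> [ck [M kM]] hf; exact: intg_volterra ck kM hf. Qed.

Lemma volterra_ext k k' f f' z : 0 <= z <= 1 ->
  (forall x y, 0 <= x -> x <= y -> y <= 1 -> k x y = k' x y) ->
  (forall x, 0 <= x <= 1 -> f x = f' x) -> volterra k f z = volterra k' f' z.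
Proof.
move=> /andP[z0 z1] kk ff; apply: ig_ext => s /andP[zs s1].
by rewrite kk// ff//; apply/andP; split => //; lra.
Qed.

Lemma volterraD k f g z : ker k -> intg 0 1 f -> intg 0 1 g -> 0 <= z ->
  volterra k (fun x => f x + g x) z = volterra k f z + volterra k g z.
Proof.
move=> hk hf hg z0; rewrite -igD.
- by apply: ig_ext => x _; rewrite mulrDr.
- by apply: intg_ker => //; exact: intg_sub hf.
- by apply: intg_ker => //; exact: intg_sub hg.
Qed.

Lemma volterraZ k M f z : ker k -> intg 0 1 f -> 0 <= z ->
  volterra k (fun x => M * f x) z = M * volterra k f z.
Proof.
move=> hk hf z0; rewrite -igZ; last by apply: intg_ker => //; exact: intg_sub hf.
by apply: ig_ext => x _; rewrite mulrCA.
Qed.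

Lemma volterra_kD k k' f z : ker k -> ker k' -> intg 0 1 f -> 0 <= z ->
  volterra (fun x y => k x y + k' x y) f z = volterra k f z + volterra k' f z.
Proof.
move=> hk hk' hf z0; rewrite -igD.
- by apply: ig_ext => x _; rewrite mulrDl.
- by apply: intg_ker => //; exact: intg_sub hf.
- by apply: intg_ker => //; exact: intg_sub hf.
Qed.

Lemma volterra_kN k f z : ker k -> intg 0 1 f -> 0 <= z ->
  volterra (fun x y => - k x y) f z = - volterra k f z.
Proof.
move=> hk hf z0; rewrite -igN; last by apply: intg_ker => //; exact: intg_sub hf.
by apply: ig_ext => x _; rewrite mulNr.
Qed.

Lemma volterra_kZ k g f z : ker k -> intg 0 1 f -> 0 <= z ->
  volterra (fun x y => g x * k x y) f z = g z * volterra k f z.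
Proof.
move=> hk hf z0; rewrite -igZ; last by apply: intg_ker => //; exact: intg_sub hf.
by apply: ig_ext => x _; rewrite mulrA.
Qed.

Lemma volterra1 k f : volterra k f 1 = 0.
Proof. by rewrite /volterra ig_aa. Qed.

(** The domain of integration moves with z. With max z s in place of s in the kernel the domain
    becomes [0, 1], where dominated convergence applies; the surplus over [0, z] is k z z times the
    integral of [f]. *)
Lemma volterra_cont k f : ker k -> intg 0 1 f -> {within `[0, 1], continuous (volterra k f)}.
Proof.
move=> hk hf.
pose m (z s : R) := Num.max z s.
have cm : cont2 m.
  move=> w; apply: (@continuous2_cvg _ _ _ _ _ _ _ _ (fun z s : R => Num.max z s)).
  - exact: max_continuous.
  - exact: cvg_fst.
  - exact: cvg_snd.
have E z : 0 <= z <= 1 ->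
    volterra k f z = ig 0 1 (fun s => k z (m z s) * f s) - k z z * ig 0 z f.
  move=> /andP[z0 z1].
  have i0 : intg 0 1 (fun s => k z (m z s) * f s).
    have [_ [M kM]] := hk; apply: (@intgM_bd _ _ _ M) => //.
    apply: intg_meas; apply: intg_continuous.
    apply: (@cont2_comp k (fun=> z) (m z)); first by case: hk.
    - by move=> x; exact: cvg_cst.
    - by apply: (@cont2_comp m (fun=> z) id) => // x; [exact: cvg_cst|exact: cvg_id].
  rewrite (@ig_split _ 0 z 1 (fun s => k z (m z s) * f s))//.
  rewrite (@ig_ext _ 0 z _ (fun s => k z z * f s)); last first.
    by move=> s /andP[_ sz]; rewrite /m max_l.
  rewrite igZ; last by apply: intg_sub hf.
  rewrite addrAC subrr add0r; apply: ig_ext => s /andP[zs _].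
  by rewrite /m max_r.
have c1 : {in `](-1), 2[%classic, continuous (fun z => ig 0 1 (fun s => k z (m z s) * f s))}.
  have [_ [M kM]] := hk.
  apply: (@continuity_under_integral R _ _ (@lebesgue_measure R)
    (fun z s => k z (m z s) * f s) (`[0, 1]%classic) (measurable_itv _) (-1) 2 _ _
    (fun s => M * `|f s|)).
  - move=> z _; apply: (@intgM_bd _ _ _ M) => //.
    apply: intg_meas; apply: intg_continuous.
    apply: (@cont2_comp k (fun=> z) (m z)); first by case: hk.
    + by move=> x; exact: cvg_cst.
    + by apply: (@cont2_comp m (fun=> z) id) => // x; [exact: cvg_cst|exact: cvg_id].
  - apply: aeW => s _ z _; apply: (@cvgM _ _ _ _ (fun z => k z (m z s)) (fun=> f s)).
      apply: (@cont2_comp k id (m^~ s)); first by case: hk.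
      * by move=> x; exact: cvg_id.
      * by apply: (@cont2_comp m id (fun=> s)) => // x; [exact: cvg_id|exact: cvg_cst].
    exact: cvg_cst.
  - by apply: intgZ; exact: intg_abs.
  - by move=> z _; apply: aeW => s _; rewrite normrM ler_wpM2r.
apply: (@subspace_eq_continuous _ _ _
    (fun z => ig 0 1 (fun s => k z (m z s) * f s) - k z z * ig 0 z f)).
  by move=> x; rewrite inE/= in_itv/= => /E.
have c1' : {within `[0, 1], continuous (fun z => ig 0 1 (fun s => k z (m z s) * f s))}.
  apply: continuous_in_subspaceT => z; rewrite inE/= in_itv/= => /andP[z0 z1].
  by apply: c1; rewrite inE/= in_itv/=; apply/andP; split; lra.
have c2 : {within `[0, 1], continuous (fun z => k z z)}.
  by apply: continuous_subspaceT; exact: ker_diag.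
have c3 := @ig_continuous _ 0 1 f ler01 hf.
move=> x; apply: cvgB; first exact: c1'.
by apply: cvgM; [exact: c2|exact: c3].
Qed.

(** Leibniz rule in integrated form: exchanging the integrals over the triangle reduces it to the
    fundamental theorem for [p] along each column. *)
Lemma volterra_prim p pz f : ker p -> ker pz -> intg 0 1 f ->
  (forall z s, 0 <= z -> z <= s -> s <= 1 -> p s s - p z s = ig z s (pz^~ s)) ->
  prim (volterra p f) (fun y => volterra pz f y - p y y * f y).
Proof.
move=> hp hpz hf line.
have i1 : intg 0 1 (volterra pz f) by exact: intg_volterra1.
have i2 : intg 0 1 (fun y => p y y * f y).
  have [_ [M pM]] := hp; apply: (@intgM_bd _ _ _ M) => //.
  by apply: intg_meas; apply: intg_continuous; exact: ker_diag.
apply: prim_from1; first exact: intgB.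
move=> z /andP[z0 z1]; rewrite volterra1 sub0r.
rewrite igB; [|exact: intg_sub i1|exact: intg_sub i2].
have [cpz [M pzM]] := hpz.
have i3 : intg z 1 f by exact: intg_sub hf.
rewrite -[ig z 1 (volterra pz f)](fubini_triangle cpz pzM i3).
rewrite opprB -igB.
- apply: ig_ext => s /andP[zs s1]; rewrite -line//; lra.
- exact: intg_sub i2.
- apply: (@intg_ext _ _ _ (fun s => p s s * f s - p z s * f s)).
    by move=> s /andP[zs s1]; rewrite -line//; lra.
  by apply: intgB; [exact: intg_sub i2|exact: intg_ker].
Qed.

Lemma volterra_prim_diag k box w w1 : ker k -> ker box ->
  prim w w1 -> {within `[0, 1], continuous w1} ->
  (forall a b s, 0 <= a -> a <= b -> b <= s -> s <= 1 ->
    k b (b + 1 - s) - k a (a + 1 - s) = ig a b (fun y => box y (y + 1 - s))) ->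
  prim (volterra k w) (fun y => volterra box w y + volterra k w1 y - k y 1 * w 1).
Proof.
move=> hk hbox pw cw1 line.
have cw := prim_cont pw.
pose u := w \o clamp; pose u1 := w1 \o clamp.
have cu : continuous u by exact: within01P.
have cu1 : continuous u1 by exact: within01P.
have i0 : intg 0 1 w by exact: intg_cont.
have i1 : intg 0 1 (fun y => k y 1 * w 1).
  by apply: intgZr; apply: intg_continuous; exact: ker_col.
have i2 : intg 0 1 (fun y => volterra box w y + volterra k w1 y).
  by apply: intgD; apply: intg_volterra1 => //; exact: intg_cont.
apply: prim_from1; first exact: intgB.
move=> z /andP[z0 z1]; rewrite volterra1 sub0r.
pose sg (y s : R) : R := y + 1 - s.
have csg : cont2 sg.
  move=> x; apply: cvgB; last exact: cvg_snd.
  by apply: cvgD; [exact: cvg_fst|exact: cvg_cst].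
have ker_sg h : ker h -> ker (fun y s => h y (sg y s)).
  move=> [ch [M hM]]; split; last by exists M.
  by apply: (@cont2_comp2 h (fun x y => x) sg) => //; exact: cont2_fst.
have ker_u h : continuous (h \o clamp) -> ker (fun y s => (h \o clamp) (sg y s)).
  move=> ch; split; first exact: (@cont2_comp1 (h \o clamp) sg).
  have [M _ HM] := bounded_continuous_clamp ch; exists M => y s.
  by have := HM (sg y s); rewrite /= (@clampE _ (clamp _))//; exact: clamp01.
have kuu : ker (fun y s => u (sg y s)) by exact: ker_u.
have kuu1 : ker (fun y s => u1 (sg y s)) by exact: ker_u.
pose dg y s := box y (sg y s) * u (sg y s) + k y (sg y s) * u1 (sg y s).
have kdg : ker dg by apply: kerD; apply: kerM => //; exact: ker_sg.
(* Product rule along the diagonal from (z, z + 1 - s) to (s, 1), in integrated form. *)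
have L s : z <= s <= 1 -> k s 1 * w 1 - k z (sg z s) * u (sg z s) = ig z s (dg^~ s).
  move=> /andP[zs s1].
  have bu1 : exists M, forall x, `|box x (sg x s)| <= M.
    by have [_ [M HM]] := hbox; exists M.
  have c1 : continuous (fun x => box x (sg x s)) by exact: ker_col (ker_sg _ hbox).
  have c2 : continuous (fun x => u1 (sg x s)) by exact: ker_col kuu1.
  have c3 : continuous (fun x => u (sg x s)) by exact: ker_col kuu.
  have c4 : continuous (fun x => k x (sg x s)) by exact: ker_col (ker_sg _ hk).
  have H := @ibp_gen R (fun x => k x (sg x s)) (fun x => box x (sg x s))
    (fun x => u (sg x s)) (fun x => u1 (sg x s)) z s zs c1 (intg_continuous _ _ c2) bu1.
  have -> : ig z s (dg^~ s) = ig z s (fun x => box x (sg x s) * u (sg x s)) +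
      ig z s (fun x => k x (sg x s) * u1 (sg x s)).
    by rewrite -igD//; apply: intg_continuous => x; apply: cvgM;
      [exact: c1|exact: c3|exact: c4|exact: c2].
  rewrite H.
  - have -> : sg s s = 1 by rewrite /sg; lra.
    have -> : u 1 = w 1 by rewrite /u/= clampE// lexx ler01.
    by rewrite addrCA subrr addr0.
  - by move=> x /andP[zx xs]; rewrite -line// addrC subrK.
  - move=> x /andP[zx xs].
    have -> : ig z x (fun y => u1 (sg y s)) = u (sg x s) - u (sg z s); last first.
      by rewrite addrCA subrr addr0.
    apply: (@FTC2 _ (fun y => u (sg y s))) => //.
    + by apply: continuous_subspaceT; exact: c2.
    + by apply: continuous_subspaceT; exact: c3.
    move=> y /andP[zy yx].
    have sg01 : 0 < sg y s < 1 by rewrite /sg; apply/andP; split; lra.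
    have du : is_derive (sg y s) 1 u (u1 (sg y s)).
      apply: prim_derive => //; apply: prim_ext pw.
      * by move=> v v01; rewrite /u/= clampE.
      * by move=> v v01; rewrite /u1/= clampE.
    have dsg : is_derive y 1 (fun y => sg y s) 1.
      have -> : (fun y => sg y s) = (fun y => y + (1 - s)).
        by apply/funext => v; rewrite /sg addrA.
      by rewrite -[X in is_derive _ _ _ X]addr0; apply: is_deriveD.
    have := @is_derive1_comp _ u (fun y => sg y s) y _ _ du dsg.
    by rewrite mulr1.
have sgE y : z <= y <= 1 -> forall h : R -> R, continuous h -> ig y 1 (fun s => h (sg y s)) = ig y 1 h.
  by move=> /andP[_ y1] h ch; rewrite -[RHS]ig_reflect.
have K1 : volterra k w z = ig z 1 (fun s => k z (sg z s) * u (sg z s)).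
  have ch : continuous (fun s => k z s * u s).
    by move=> x; apply: cvgM; [exact: ker_row|exact: cu].
  rewrite (sgE z _ _ ch) ?lexx ?z1//; apply: ig_ext => s ?.
  by rewrite /u/= clampE//; lra.
rewrite K1.
(* The factor 1 is the function [f] of [fubini_triangle]. *)
rewrite (@ig_ext _ _ _ _ (fun s => k s 1 * w 1 - ig z s (dg^~ s) * 1)); last first.
  by move=> s zs; rewrite -L//; lra.
have [cdg [M dgM]] := kdg.
have i5 : intg z 1 (fun s : R => ig z s (dg^~ s) * 1).
  apply: (@intg_ext _ _ _ (fun s => k s 1 * w 1 - k z (sg z s) * u (sg z s))).
    by move=> s zs; rewrite L//; lra.
  apply: intg_continuous => x; apply: cvgB.
    by apply: cvgM; [exact: ker_col|exact: cvg_cst].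
  by apply: cvgM; [exact: (@ker_row (fun y s => k y (sg y s)) z (ker_sg _ hk))|exact: (@ker_row (fun y s => u (sg y s)) z kuu)].
rewrite igB//; last by exact: intg_sub i1.
rewrite (fubini_triangle cdg dgM (intg_cst z 1 1)).
rewrite igB; [|exact: intg_sub i2|exact: intg_sub i1].
rewrite opprB; congr (_ - _); apply: ig_ext => y /andP[zy y1].
have c1 : continuous (fun s => box y s * u s).
  by move=> x; apply: cvgM; [exact: ker_row|exact: cu].
have c2 : continuous (fun s => k y s * u1 s).
  by move=> x; apply: cvgM; [exact: ker_row|exact: cu1].
transitivity (ig y 1 (fun s => box y s * u s + k y s * u1 s)).
  rewrite -(sgE y _ (fun s => box y s * u s + k y s * u1 s)).
  - by apply: ig_ext => s _; rewrite mulr1.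
  - by rewrite zy y1.
  - by move=> x; apply: cvgD; [exact: c1|exact: c2].
rewrite igD; [|exact: intg_continuous|exact: intg_continuous].
by congr (_ + _); apply: ig_ext => s ?; rewrite /u/u1/= clampE//; lra.
Qed.

End Volterra.

(** * Fundamental theorem along segments of the closed triangle *)

Section Lines.
Context {R : realType}.
Implicit Types (a b z s r : R).

Definition triangle z s : Prop := 0 <= z /\ z <= s /\ s <= 1.

(* Contracting the triangle towards (1/3, 2/3) moves the segment into the
   interior, where the directional derivative is available. *)
Lemma line_integral (f g : R -> R -> R) (A1 A2 d1 d2 s0 s1 : R) : ker f -> ker g ->
  (forall z s, 0 < z -> z < s -> s < 1 ->
    is_derive (0 : R) 1 (fun h : R => f (z + h * d1) (s + h * d2)) (g z s)) ->
  s0 <= s1 ->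
  (forall u, s0 <= u <= s1 -> triangle (A1 + u * d1) (A2 + u * d2)) ->
  f (A1 + s1 * d1) (A2 + s1 * d2) - f (A1 + s0 * d1) (A2 + s0 * d2) =
  ig s0 s1 (fun u => g (A1 + u * d1) (A2 + u * d2)).
Proof.
move=> [cf [N fN]] [cg [M gM]] df s01 T.
pose c1 r u := (1 - r) * (A1 + u * d1) + r * 3^-1.
pose c2 r u := (1 - r) * (A2 + u * d2) + r * (2 * 3^-1).
have cc (A d : R) k : cont2 (fun r u : R => (1 - r) * (A + u * d) + r * k).
  move=> x; apply: cvgD; apply: cvgM.
  - by apply: cvgB; [exact: cvg_cst|exact: cvg_fst].
  - by apply: cvgD; [exact: cvg_cst|apply: cvgM; [exact: cvg_snd|exact: cvg_cst]].
  - exact: cvg_fst.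
  - exact: cvg_cst.
have cc1 : cont2 c1 := cc A1 d1 _.
have cc2 : cont2 c2 := cc A2 d2 _.
pose F r := f (c1 r s1) (c2 r s1) - f (c1 r s0) (c2 r s0).
pose G r := ig s0 s1 (fun u => (1 - r) * g (c1 r u) (c2 r u)).
have cfc : cont2 (fun r u => f (c1 r u) (c2 r u)) by exact: cont2_comp2.
have cgc : cont2 (fun r u => g (c1 r u) (c2 r u)) by exact: cont2_comp2.
have colc (h : R -> R -> R) v : cont2 h -> continuous (h^~ v).
  by move=> ch; apply: (@cont2_comp _ h id (fun=> v)) => // x; [exact: cvg_id|exact: cvg_cst].
have rowc (h : R -> R -> R) v : cont2 h -> continuous (h v).
  by move=> ch; apply: (@cont2_comp _ h (fun=> v) id) => // x; [exact: cvg_cst|exact: cvg_id].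
have cF : continuous F.
  move=> r; apply: cvgB.
    exact: (colc (fun r u => f (c1 r u) (c2 r u))).
  exact: (colc (fun r u => f (c1 r u) (c2 r u))).
have cgr r : continuous (fun u => g (c1 r u) (c2 r u)).
  exact: (rowc (fun r u => g (c1 r u) (c2 r u))).
have cG : {for 0, continuous G}.
  have H : {in `](-1), 1[%classic, continuous G}.
    apply: (@continuity_under_integral R _ _ (@lebesgue_measure R)
      (fun r u => (1 - r) * g (c1 r u) (c2 r u)) (`[s0, s1]%classic) (measurable_itv _) (-1) 1 _ _
      (fun=> 2 * M)).
    - by move=> r _; apply: intgZ; apply: intg_continuous.
    - apply: aeW => u _ r _; apply: cvgM.
        by apply: cvgB; [exact: cvg_cst|exact: cvg_id].
      exact: (colc (fun r u => g (c1 r u) (c2 r u))).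
    - exact: intg_cst.
    - move=> r; rewrite /= in_itv/= => /andP[r1 r2]; apply: aeW => u _.
      rewrite normrM ler_pM// ler_norml; apply/andP; split; lra.
  by apply: H; rewrite inE/= in_itv/=; apply/andP; split; lra.
have E r : 0 < r < 1 -> F r = G r.
  move=> /andP[r0 r1]; rewrite /F /G; symmetry.
  have dphi (u : R) : s0 <= u <= s1 ->
      is_derive u 1 (fun u => f (c1 r u) (c2 r u)) ((1 - r) * g (c1 r u) (c2 r u)).
    move=> /T [t0 [t1 t2]].
    have p0 : 0 < c1 r u.
      by rewrite /c1; apply: ltr_wpDl; [apply: mulr_ge0; lra|lra].
    have p1 : c1 r u < c2 r u.
      rewrite /c1 /c2; apply: ler_ltD; last lra.
      by apply: ler_wpM2l; lra.
    have p2 : c2 r u < 1.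
      rewrite /c2; have : (1 - r) * (A2 + u * d2) <= (1 - r) * 1.
        by apply: ler_wpM2l; lra.
      lra.
    have D := df _ _ p0 p1 p2.
    (* On the contracted segment, going from parameter u to x is a displacement by (1 - r) (x - u)
       times (d1, d2); the chain rule with [v] thus reduces to the directional derivative at
       displacement 0. *)
    pose v (x : R) := (1 - r) * (x - u).
    have dv : is_derive u 1 v (1 - r).
      have dw : is_derive u 1 (fun x : R => x - u) 1.
        by rewrite -[X in is_derive _ _ _ X]subr0; apply: is_deriveB.
      by have := is_deriveZ (1 - r) dw; rewrite /GRing.scale/= mulr1.
    have v0 : v u = 0 by rewrite /v subrr mulr0.
    rewrite -v0 in D.
    have := @is_derive1_comp _ _ v u _ _ D dv.
    rewrite mulrC => H.
    have -> // : (fun u => f (c1 r u) (c2 r u)) =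
      ((fun h => f (c1 r u + h * d1) (c2 r u + h * d2)) \o v).
    apply/funext => x; rewrite /= /v; congr (f _ _).
      by rewrite /c1; ring.
    by rewrite /c2; ring.
  apply: (@FTC2 _ (fun u => f (c1 r u) (c2 r u)) (fun u => (1 - r) * g (c1 r u) (c2 r u))) => //.
  - apply: continuous_subspaceT => u; apply: cvgM; [exact: cvg_cst|exact: cgr].
  - apply: continuous_subspaceT.
    exact: (rowc (fun r u => f (c1 r u) (c2 r u))).
  - by move=> u u01; apply: dphi; lra.
have F0 : F 0 = f (A1 + s1 * d1) (A2 + s1 * d2) - f (A1 + s0 * d1) (A2 + s0 * d2).
  by rewrite /F /c1 /c2 subr0 !mul1r !mul0r !addr0.
have G0 : G 0 = ig s0 s1 (fun u => g (A1 + u * d1) (A2 + u * d2)).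
  by apply: ig_ext => u _; rewrite /c1 /c2 subr0 !mul1r !mul0r !addr0.
rewrite -F0 -G0.
have hF : F r @[r --> 0^'+] --> F 0 by apply: cvg_at_right_filter; exact: cF.
have hG : G r @[r --> 0^'+] --> G 0 by apply: cvg_at_right_filter; exact: cG.
have hE : \forall r \near 0^'+, G r = F r.
  near=> r; rewrite E//; apply/andP; split; near: r.
    exact: nbhs_right_gt.
  by apply: nbhs_right_lt.
have hF' : F r @[r --> 0^'+] --> G 0.
  apply: cvg_trans hG; apply: near_eq_cvg; exact: hE.
exact: (cvg_unique _ hF hF').
Unshelve. all: by end_near. Qed.

End Lines.

(** * Backstepping commutator *)

Section Backstepping.
Context {R : realType}.
Variables (p pz pt ps : R -> R -> R) (a : R -> R) (lam mu : R).
Hypotheses (kp : ker p) (kpz : ker pz) (kps : ker ps) (kpt : ker pt).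
Hypotheses (ca : continuous a) (lam0 : lam != 0).
(** By the kernel equation this is p_zz - p_zetazeta. *)
Let pa y z := lam^-1 * (pt y z - (a (clamp y) + mu) * p y z).
Hypothesis pzE : forall b c s, 0 <= b -> b <= c -> c <= s -> s <= 1 ->
  p c s - p b s = ig b c (pz^~ s).
Hypothesis psE : forall z b c, 0 <= z -> z <= b -> b <= c -> c <= 1 ->
  p z c - p z b = ig b c (ps z).
Hypothesis diagE : forall b c s, 0 <= b -> b <= c -> c <= s -> s <= 1 ->
  (pz c (c + 1 - s) - ps c (c + 1 - s)) - (pz b (b + 1 - s) - ps b (b + 1 - s))
  = ig b c (fun y => pa y (y + 1 - s)).
Hypothesis pd : prim (fun z => p z z) (fun z => - ((a z + mu) / (2 * lam))).
Variables (f f1 f2 w : R -> R).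
Hypotheses (hf : prim f f1) (hf1 : prim f1 f2) (hw : intg 0 1 w).
Hypothesis wE : forall z, 0 <= z <= 1 -> w z - volterra p w z = f z.

(* Weak first and second z-derivatives of w = (1 - V_p)^-1 f; [bs_w2] never uses
   p_zz, only the derivative of p_z - p_zeta along the diagonal direction. *)
Definition bs_w1 z := f1 z + volterra pz w z - p z z * w z.
Definition bs_q2 z := lam^-1 * ((a (clamp z) + mu) * w z + volterra pt w z
    - (a (clamp z) + mu) * volterra p w z)
  - p z z * bs_w1 z + ps z 1 * w 1 - volterra ps bs_w1 z.
Definition bs_w2 z := f2 z + bs_q2 z.

Lemma backstepping_prim : prim w bs_w1.
Proof.
apply: (@prim_ext _ (fun z => f z + volterra p w z)
   (fun z => f1 z + (volterra pz w z - p z z * w z))).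
- by move=> z z01; rewrite -wE//; lra.
- by move=> z z01; rewrite /bs_w1 addrA.
apply: primD => //; apply: volterra_prim => // z s z0 zs s1.
exact: pzE.
Qed.

Let cw : {within `[0, 1], continuous w}.
Proof. exact: prim_cont backstepping_prim. Qed.

Lemma backstepping_cont1 : {within `[0, 1], continuous bs_w1}.
Proof.
move=> x; apply: cvgB; first apply: cvgD.
- exact: (prim_cont hf1).
- exact: (volterra_cont kpz hw).
- apply: cvgM; last exact: cw.
  exact: (continuous_subspaceT (ker_diag kp)).
Qed.

Let hw1 : intg 0 1 bs_w1.
Proof. by apply: intg_cont; exact: backstepping_cont1. Qed.

Lemma volterra_ibp g g' z : 0 <= z <= 1 -> prim g g' ->
  volterra ps g z = p z 1 * g 1 - p z z * g z - volterra p g' z.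
Proof.
move=> /andP[z0 z1] pg; have [_ [M psM]] := kps.
rewrite /volterra (@ibp_gen _ (p z) (ps z) g g' z 1) //; try lra.
- exact: ker_row.
- by case: pg => + _; apply: intg_sub.
- by exists M.
- by move=> x /andP[zx x1]; rewrite -psE//; lra.
- by move=> x /andP[zx x1]; rewrite -(prim_diff pg)//; lra.
Qed.

Lemma backstepping_q2_cont : {within `[0, 1], continuous bs_q2}.
Proof.
have cac : continuous (fun z => a (clamp z) + mu).
  move=> x; apply: cvgD; last exact: cvg_cst.
  by apply: continuous_comp; [exact: continuous_clamp|exact: ca].
have cac' : {within `[0, 1], continuous (fun z => a (clamp z) + mu)}.
  exact: continuous_subspaceT.
have c1 : {within `[0, 1], continuous (fun z => ps z 1 * w 1)}.
  by apply: continuous_subspaceT => x; apply: cvgM; [exact: ker_col|exact: cvg_cst].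
have c2 : {within `[0, 1], continuous (fun z => p z z)}.
  by apply: continuous_subspaceT; exact: ker_diag.
move=> x; apply: cvgB; first apply: cvgD; first apply: cvgB; first apply: cvgM.
- exact: cvg_cst.
- apply: cvgB; first apply: cvgD; first apply: cvgM.
  + exact: cac'.
  + exact: cw.
  + exact: (volterra_cont kpt hw).
  + by apply: cvgM; [exact: cac'|exact: (volterra_cont kp hw)].
- by apply: cvgM; [exact: c2|exact: backstepping_cont1].
- exact: c1.
- exact: (volterra_cont kps hw1).
Qed.

(** The term of [bs_w1] with kernel p_z is split by p_z = (p_z - p_zeta) + p_zeta.
    [volterra_prim_diag] covers the first part, and integration by parts turns the second into
    boundary terms and a Volterra integral of [bs_w1] with kernel p, covered by [volterra_prim]. *)
Lemma backstepping_prim2 : prim bs_w1 bs_w2.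
Proof.
pose k y z := pz y z - ps y z.
have kk : ker k by exact: kerB.
have kac : ker (fun y _ : R => a (clamp y) + mu).
  by apply: kerD; [exact: ker_fst|exact: ker_cst].
have kpa : ker pa.
  by apply: kerM; [exact: ker_cst|apply: kerB => //; exact: kerM].
have P1 : prim (volterra k w) (fun y => volterra pa w y + volterra k bs_w1 y - k y 1 * w 1).
  apply: volterra_prim_diag => //; [exact: backstepping_prim|exact: backstepping_cont1].
have P2 : prim (fun z => p z 1 * w 1) (fun z => pz z 1 * w 1).
  apply: (@prim_ext _ (fun z => w 1 * p z 1) (fun z => w 1 * pz z 1));
    [by move=> *; rewrite mulrC|by move=> *; rewrite mulrC|].
  apply: primZ; split; first by apply: intg_continuous; exact: ker_col.
  by move=> z /andP[z0 z1]; rewrite -pzE//; lra.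
have P3 : prim (volterra p bs_w1) (fun y => volterra pz bs_w1 y - p y y * bs_w1 y).
  by apply: volterra_prim => // z s z0 zs s1; exact: pzE.
have P4 : prim (fun z => p z z * w z)
    (fun z => - ((a z + mu) / (2 * lam)) * w z + p z z * bs_w1 z).
  apply: primM => //; last exact: backstepping_prim.
  apply: continuous_subspaceT => x; apply: cvgN; apply: cvgM; last exact: cvg_cst.
  by apply: cvgD; [exact: ca|exact: cvg_cst].
(* The diagonal term p z z * w z counts twice, once from [bs_w1] and once from the integration by
   parts; this makes up for the 2 in the denominator of the derivative of p z z. *)
have P := primD hf1 (primB (primB (primD P1 P2) P3) (primD P4 P4)).
apply: prim_ext P => z z01; have /andP[z0 z1] := z01.
- rewrite /bs_w1.
  have -> : volterra pz w z = volterra k w z + volterra ps w z.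
    rewrite -volterra_kD//; apply: volterra_ext => // x y _ _ _.
    by rewrite /k subrK.
  by rewrite (volterra_ibp z01 backstepping_prim); ring.
- have E1 : volterra pa w z = lam^-1 * (volterra pt w z - (a z + mu) * volterra p w z).
    rewrite /pa (@volterra_kZ _ (fun x y => pt x y - (a (clamp x) + mu) * p x y) (fun=> lam^-1))//.
      rewrite (@volterra_kD _ pt (fun x y => - ((a (clamp x) + mu) * p x y)))//.
        rewrite volterra_kN//; last exact: kerM.
        by rewrite (@volterra_kZ _ p (fun x => a (clamp x) + mu))// clampE.
      by apply: kerN; exact: kerM.
    by apply: kerB => //; exact: kerM.
  have E2 : volterra k bs_w1 z = volterra pz bs_w1 z - volterra ps bs_w1 z.
    rewrite /k (@volterra_kD _ pz (fun x y => - ps x y))//; last exact: kerN.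
    by rewrite volterra_kN.
  rewrite E1 E2 /bs_w2 /bs_q2 clampE// /k.
  by field.
Qed.

(** Substituting f2 = bs_w2 - bs_q2 and integrating the p_zeta integral of [bs_w1] by parts reveals
    1 - V applied to the damped operator with constant coefficients. The term with [pt] accounts for
    the time dependence of the kernel; of the two terms at the end point 1, one is cancelled later
    by the gain l_x and the other by hbar. *)
Lemma backstepping_commutator z : intg 0 1 bs_w2 -> 0 <= z <= 1 ->
  lam * f2 z + a z * f z + volterra pt w z =
  (lam * bs_w2 z - mu * w z) - volterra p (fun x => lam * bs_w2 x - mu * w x) z
  - lam * ps z 1 * w 1 + lam * p z 1 * bs_w1 1.
Proof.
move=> hw2 z01; have /andP[z0 z1] := z01.
have -> : volterra p (fun x => lam * bs_w2 x - mu * w x) z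
    = lam * volterra p bs_w2 z - mu * volterra p w z.
  transitivity (volterra p (fun x => lam * bs_w2 x + (- mu) * w x) z).
    by apply: volterra_ext => // x _; rewrite mulNr.
  rewrite volterraD//; [|exact: intgZ|exact: intgZ].
  by rewrite !volterraZ// mulNr.
rewrite -wE// {1 2}/bs_w2 /bs_q2 clampE//.
rewrite (volterra_ibp z01 backstepping_prim2).
by field.
Qed.

End Backstepping.

(** * The space L_2(0,1) *)

Section L2Space.
Context {R : realType}.
Implicit Types (a b c d M x y z s t h : R) (f g : R -> R).

Definition ip f g : R := ig 0 1 (fun z => f z * g z).

Lemma L2_intgM f g : L2 f -> L2 g -> intg 0 1 (fun z => f z * g z).
Proof.
move=> [mf if2] [mg ig2].
apply: (@intg_le _ _ _ _ (fun z => f z ^+ 2 + g z ^+ 2)).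
- exact: measurable_funM.
- move=> x _; rewrite normrM -(real_normK (num_real (f x))) -(real_normK (num_real (g x))).
  have := sqr_ge0 (`|f x| - `|g x|); have := normr_ge0 (f x); have := normr_ge0 (g x).
  by nra.
- exact: intgD.
Qed.

Lemma L2_meas f : L2 f -> measurable_fun (`[0, 1] : set R) f.
Proof. by case. Qed.

Lemma L2_bounded M f : measurable_fun (`[0, 1] : set R) f ->
  (forall x, 0 <= x <= 1 -> `|f x| <= M) -> L2 f.
Proof.
move=> mf fM; split => //.
apply: (@intg_ext _ _ _ (fun z => f z * f z)); first by move=> x _; rewrite expr2.
apply: (@intgM_bd _ _ _ M) => //.
by apply: (@intg_le _ _ _ _ (fun=> M)) => //; exact: intg_cst.
Qed.

Lemma L2_cont f : {within `[0, 1], continuous f} -> L2 f.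
Proof.
move=> cf; have [M _ HM] := within01_bounded cf.
by apply: (L2_bounded (M := M)) => //; apply: intg_meas; exact: intg_cont.
Qed.

Lemma L2_cst M : L2 (fun _ : R => M).
Proof. by apply: L2_cont; apply: continuous_subspaceT => x; exact: cvg_cst. Qed.

Lemma L2_intg f : L2 f -> intg 0 1 f.
Proof.
by move=> /(L2_intgM (L2_cst 1)); apply: intg_ext => x _; rewrite mul1r.
Qed.

Lemma L2_ext f g : (forall x, 0 <= x <= 1 -> f x = g x) -> L2 f -> L2 g.
Proof.
move=> fg [mf f2]; split.
  by apply: eq_measurable_fun mf => x; rewrite inE/= in_itv/= => /fg.
by apply: intg_ext f2 => x x01; rewrite fg.
Qed.

Lemma L2D f g : L2 f -> L2 g -> L2 (fun z => f z + g z).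
Proof.
move=> hf hg; split; first by apply: measurable_funD; exact: L2_meas.
apply: (@intg_ext _ _ _ (fun z => f z ^+ 2 + (2 * (f z * g z) + g z ^+ 2))).
  by move=> x _; ring.
by apply: intgD; [case: hf|apply: intgD; [apply: intgZ; exact: L2_intgM|case: hg]].
Qed.

Lemma L2Z M f : L2 f -> L2 (fun z => M * f z).
Proof.
move=> hf; split; first by apply: measurable_funM => //; exact: L2_meas.
apply: (@intg_ext _ _ _ (fun z => M ^+ 2 * f z ^+ 2)); first by move=> x _; ring.
by apply: intgZ; case: hf.
Qed.

Lemma L2N f : L2 f -> L2 (fun z => - f z).
Proof. by move=> /(L2Z (-1)); apply: L2_ext => x _; rewrite mulN1r. Qed.

Lemma L2B f g : L2 f -> L2 g -> L2 (fun z => f z - g z).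
Proof. by move=> hf /L2N; exact: L2D. Qed.

Lemma L2_sum (I : Type) (s : seq I) (F : I -> R -> R) :
  (forall i, L2 (F i)) -> L2 (fun z => \sum_(i <- s) F i z).
Proof.
move=> hF; elim: s => [|i s IH].
  by apply: (L2_ext _ (L2_cst 0)) => x _; rewrite big_nil.
by apply: (L2_ext _ (L2D (hF i) IH)) => x _; rewrite big_cons.
Qed.

Lemma ipC f g : ip f g = ip g f.
Proof. by apply: ig_ext => x _; rewrite mulrC. Qed.

Lemma ipDr f g g' : L2 f -> L2 g -> L2 g' -> ip f (fun z => g z + g' z) = ip f g + ip f g'.
Proof.
move=> hf hg hg'; rewrite -igD; try exact: L2_intgM.
by apply: ig_ext => x _; rewrite mulrDr.
Qed.

Lemma ipZr M f g : L2 f -> L2 g -> ip f (fun z => M * g z) = M * ip f g.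
Proof.
move=> hf hg; rewrite -igZ; last exact: L2_intgM.
by apply: ig_ext => x _; rewrite mulrCA.
Qed.

Lemma ipBr f g g' : L2 f -> L2 g -> L2 g' -> ip f (fun z => g z - g' z) = ip f g - ip f g'.
Proof.
move=> hf hg hg'; rewrite -igB; try exact: L2_intgM.
by apply: ig_ext => x _; rewrite mulrBr.
Qed.

Lemma ip_ext f f' g g' : (forall x, 0 <= x <= 1 -> f x = f' x) ->
  (forall x, 0 <= x <= 1 -> g x = g' x) -> ip f g = ip f' g'.
Proof. by move=> ff gg; apply: ig_ext => x x01; rewrite ff// gg. Qed.

Lemma ip_ge0 f : 0 <= ip f f.
Proof. by apply: ig_ge0 => x _; rewrite -expr2 sqr_ge0. Qed.

Lemma normL2_sqr f : normL2 f ^+ 2 = ip f f.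
Proof.
rewrite /normL2 sqr_sqrtr; last by apply: ig_ge0 => x _; exact: sqr_ge0.
by apply: ig_ext => x _; rewrite expr2.
Qed.

Lemma normL2_ge0 f : 0 <= normL2 f.
Proof. exact: sqrtr_ge0. Qed.

Lemma normL2_ext f g : (forall x, 0 <= x <= 1 -> f x = g x) -> normL2 f = normL2 g.
Proof. by move=> fg; rewrite /normL2; congr Num.sqrt; apply: ig_ext => x x01; rewrite fg. Qed.

Lemma ip_sqD f g M : L2 f -> L2 g ->
  ip (fun z => f z + M * g z) (fun z => f z + M * g z)
  = ip f f + 2 * M * ip f g + M ^+ 2 * ip g g.
Proof.
move=> hf hg; have hMg := L2Z M hg.
rewrite ipDr//; last exact: L2D.
rewrite ipZr//; last exact: L2D.
rewrite (ipC _ f) (ipC _ g) !ipDr// !ipZr// (ipC g f); ring.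
Qed.

Lemma CauchySchwarz f g : L2 f -> L2 g -> `|ip f g| <= normL2 f * normL2 g.
Proof.
move=> hf hg; have A0 := normL2_ge0 f; have B0 := normL2_ge0 g.
rewrite -(@ler_pXn2r _ 2)// ?nnegrE ?mulr_ge0// exprMn !normL2_sqr.
rewrite real_normK ?num_real//.
have gg := ip_ge0 g; have ff := ip_ge0 f.
have Q M : 0 <= ip f f + 2 * M * ip f g + M ^+ 2 * ip g g.
  by rewrite -ip_sqD//; exact: ip_ge0.
move: gg; rewrite le_eqVlt => /predU1P[g0|g0].
  rewrite -g0 mulr0.
  (* For [g] of norm zero the polynomial is affine in M; this M would give it the value -1. *)
  have := Q (- (ip f f + 1) / 2 / ip f g); rewrite -g0 mulr0 addr0.
  have [->|fg0] := eqVneq (ip f g) 0; first by rewrite expr0n.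
  have -> : 2 * (- (ip f f + 1) / 2 / ip f g) * ip f g = - (ip f f + 1) by field.
  by lra.
have := Q (- ip f g / ip g g).
have gn : ip g g != 0 by rewrite gt_eqF.
have -> : ip f f + 2 * (- ip f g / ip g g) * ip f g + (- ip f g / ip g g) ^+ 2 * ip g g
   = (ip f f * ip g g - ip f g ^+ 2) / ip g g by field.
by rewrite pmulr_lge0 ?invr_gt0// subr_ge0.
Qed.

Lemma normL2D f g : L2 f -> L2 g -> normL2 (fun z => f z + g z) <= normL2 f + normL2 g.
Proof.
move=> hf hg; have A0 := normL2_ge0 f; have B0 := normL2_ge0 g.
rewrite -(@ler_pXn2r _ 2)// ?nnegrE ?normL2_ge0 ?addr_ge0//.
rewrite normL2_sqr.
have -> : ip (fun z => f z + g z) (fun z => f z + g z) =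
    ip (fun z => f z + 1 * g z) (fun z => f z + 1 * g z).
  by apply: ip_ext => x _; rewrite mul1r.
rewrite ip_sqD// -!normL2_sqr.
have := le_trans (ler_norm _) (CauchySchwarz hf hg); nra.
Qed.

Lemma normL2Z M f : L2 f -> normL2 (fun z => M * f z) = `|M| * normL2 f.
Proof.
move=> hf; rewrite /normL2 -sqrtr_sqr -sqrtrM ?sqr_ge0//; congr Num.sqrt.
rewrite -igZ; last by case: hf.
by apply: ig_ext => x _; ring.
Qed.

Lemma normL2N f : L2 f -> normL2 (fun z => - f z) = normL2 f.
Proof.
move=> hf; rewrite -[RHS]mul1r -normrN1 -normL2Z//.
by apply: normL2_ext => x _; rewrite mulN1r.
Qed.

Lemma normL2B f g : L2 f -> L2 g -> normL2 (fun z => f z - g z) <= normL2 f + normL2 g.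
Proof. by move=> hf hg; rewrite -(normL2N hg); apply: normL2D => //; exact: L2N. Qed.

Lemma normL2_le f g : L2 f -> L2 g -> (forall x, 0 <= x <= 1 -> `|f x| <= `|g x|) ->
  normL2 f <= normL2 g.
Proof.
move=> [_ hf] [_ hg] fg; rewrite /normL2 ler_sqrt; last by apply: ig_ge0 => x _; exact: sqr_ge0.
apply: ig_le => // x x01; rewrite -(real_normK (num_real (f x))) -(real_normK (num_real (g x))).
by rewrite ler_pXn2r ?nnegrE// fg.
Qed.

Lemma normL2_cst M : normL2 (fun _ : R => M) = `|M|.
Proof. by rewrite /normL2 ig_cst// subr0 mulr1 sqrtr_sqr. Qed.

Lemma normL2_bd M f : 0 <= M -> L2 f -> (forall x, 0 <= x <= 1 -> `|f x| <= M) ->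
  normL2 f <= M.
Proof.
move=> M0 hf fM; rewrite -[leRHS](ger0_norm M0) -(normL2_cst M); apply: normL2_le => //.
  exact: L2_cst.
by move=> x x01; rewrite (le_trans (fM x x01))// ler_norm.
Qed.

Lemma ig_norm_normL2 f : L2 f -> ig 0 1 (fun z => `|f z|) <= normL2 f.
Proof.
move=> hf.
have hf' : L2 (fun z => `|f z|).
  split; first by apply: measurableT_comp => //; exact: L2_meas.
  by case: hf => _; apply: intg_ext => x _; rewrite real_normK// num_real.
have := le_trans (ler_norm _) (CauchySchwarz (L2_cst 1) hf').
rewrite normL2_cst normr1 mul1r.
have -> : normL2 (fun z => `|f z|) = normL2 f.
  by rewrite /normL2; congr Num.sqrt; apply: ig_ext => x _; rewrite real_normK// num_real.
by apply: le_trans; rewrite le_eqVlt (_ : _ == _)//; apply/eqP; apply: ig_ext => x _; rewrite mul1r.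
Qed.

Lemma ig_sub_norm_normL2 f a b : 0 <= a -> a <= b -> b <= 1 -> L2 f ->
  ig a b (fun z => `|f z|) <= normL2 f.
Proof.
move=> a0 ab b1 hf; apply: le_trans (ig_norm_normL2 hf).
have i := intg_abs (L2_intg hf).
rewrite (@ig_split _ 0 a 1)//; last lra.
rewrite (@ig_split _ a b 1)//; last by apply: intg_sub i.
have : 0 <= ig 0 a (fun z => `|f z|) by apply: ig_ge0.
have : 0 <= ig b 1 (fun z => `|f z|) by apply: ig_ge0.
lra.
Qed.

Lemma volterra_bound k M f z : ker k -> (forall x y, `|k x y| <= M) -> L2 f ->
  0 <= z <= 1 -> `|volterra k f z| <= M * normL2 f.
Proof.
move=> hk kM hf /andP[z0 z1]; have M0 : 0 <= M by exact: le_trans (kM 0 0).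
have i0 : intg z 1 f by apply: intg_sub (L2_intg hf).
apply: (le_trans (ig_norm (intg_ker z hk i0))).
apply: (@le_trans _ _ (ig z 1 (fun x => M * `|f x|))).
  apply: ig_le.
  - by apply: intg_abs; exact: intg_ker.
  - by apply: intgZ; exact: intg_abs.
  - by move=> x _; rewrite normrM ler_wpM2r.
rewrite igZ; last exact: intg_abs.
by apply: ler_wpM2l => //; apply: ig_sub_norm_normL2.
Qed.

(** f x is compared with f y for every y, and the resulting inequality is averaged over y in
    [0, 1]. *)
Lemma prim_trace f f1 x : prim f f1 -> L2 f1 -> 0 <= x <= 1 ->
  f x ^+ 2 <= 2 * ip f f + 2 * ip f1 f1.
Proof.
move=> pf hf1 x01; have /andP[x0 x1] := x01.
have hf : L2 f by apply: L2_cont; exact: prim_cont pf.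
have B y : 0 <= y <= 1 -> f x ^+ 2 <= 2 * (f y * f y) + 2 * ip f1 f1.
  move=> /andP[y0 y1].
  have D : `|f x - f y| <= normL2 f1.
    have [xy|yx] := leP x y.
      rewrite distrC (prim_diff pf)//.
      apply: (le_trans (ig_norm _)); last exact: ig_sub_norm_normL2.
      by apply: intg_sub (L2_intg hf1).
    rewrite (prim_diff pf)//; last exact: ltW.
    apply: (le_trans (ig_norm _)); last by apply: ig_sub_norm_normL2 => //; exact: ltW.
    by apply: intg_sub (L2_intg hf1).
  rewrite -normL2_sqr.
  have : `|f x - f y| ^+ 2 <= normL2 f1 ^+ 2 by rewrite ler_pXn2r ?nnegrE ?normL2_ge0.
  rewrite real_normK ?num_real//.
  have := sqr_ge0 (f x - 2 * f y).
  nra.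
have : ig 0 1 (fun=> f x ^+ 2) <= ig 0 1 (fun y => 2 * (f y * f y) + 2 * ip f1 f1).
  apply: ig_le => //; first exact: intg_cst.
  by apply: intgD; [apply: intgZ; exact: L2_intgM|exact: intg_cst].
rewrite ig_cst// subr0 mulr1 igD; [|by apply: intgZ; exact: L2_intgM|exact: intg_cst].
by rewrite ig_cst// subr0 mulr1 igZ//; exact: L2_intgM.
Qed.

(** The integral of the squared deviation of [f] from its mean is nonnegative. *)
Lemma ig_sqr_le a b f : a <= b -> intg a b f -> intg a b (fun x => f x ^+ 2) ->
  ig a b f ^+ 2 <= (b - a) * ig a b (fun x => f x ^+ 2).
Proof.
rewrite le_eqVlt => /predU1P[->|ab] hf hf2; first by rewrite !ig_aa expr0n mulr0.
pose m := ig a b f / (b - a).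
have : 0 <= ig a b (fun x => (f x ^+ 2 - 2 * m * f x) + m ^+ 2).
  apply: ig_ge0 => x _; have -> : f x ^+ 2 - 2 * m * f x + m ^+ 2 = (f x - m) ^+ 2 by ring.
  exact: sqr_ge0.
rewrite igD; [|by apply: intgB => //; exact: intgZ|exact: intg_cst].
rewrite igB//; last exact: intgZ.
rewrite igZ// ig_cst ?(ltW ab)//.
have ba : b - a != 0 by rewrite subr_eq0 gt_eqF.
have -> : ig a b (fun x => f x ^+ 2) - 2 * m * ig a b f + m ^+ 2 * (b - a) =
  ((b - a) * ig a b (fun x => f x ^+ 2) - ig a b f ^+ 2) / (b - a) by rewrite /m; field.
by rewrite pmulr_lge0 ?invr_gt0 ?subr_gt0// subr_ge0.
Qed.

(** The factor 4 comes from absorbing half of the weighted square norm of f into the left hand side;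
    the exponential is the maximum on [0, 1] of the weight, with beta = 4 M^2 + 1. *)
Definition volterra_const M : R := Num.sqrt (4 * expR (4 * M ^+ 2 + 1)).

(* Weighting by exp(beta z) with beta > 4 M^2 makes the Volterra operator a
   contraction of factor 1/2. *)
Lemma volterra_inverse_bound k M f g : ker k -> (forall x y, `|k x y| <= M) -> L2 f ->
  (forall z, 0 <= z <= 1 -> g z = f z - volterra k f z) ->
  L2 g /\ normL2 f <= volterra_const M * normL2 g.
Proof.
move=> hk kM hf gE; have M0 : 0 <= M by exact: le_trans (kM 0 0).
have hV : L2 (volterra k f) by apply: L2_cont; apply: volterra_cont => //; exact: L2_intg.
have hg : L2 g by apply: (L2_ext _ (L2B hf hV)) => x x01; rewrite gE.
split=> //.
pose B := 4 * M ^+ 2 + 1.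
have B0 : 0 < B by rewrite /B; have := sqr_ge0 M; lra.
pose e z := expR (B * z).
have ce : continuous e.
  move=> x; apply: continuous_comp; last exact: continuous_expR.
  by apply: cvgM; [exact: cvg_cst|exact: cvg_id].
have e1 z : 0 <= z -> 1 <= e z.
  by move=> z0; rewrite -expR0 ler_expR mulr_ge0// ltW.
have eB z : z <= 1 -> e z <= expR B by move=> z1; rewrite ler_expR ger_pMr.
have e0 z : 0 < e z := expR_gt0 _.
have ie (h : R -> R) : intg 0 1 h -> intg 0 1 (fun z => e z * h z).
  move=> ih; apply: (@intgM_bd _ _ _ (expR B)) => //.
    by apply: intg_meas; exact: intg_continuous.
  by move=> x /andP[x0 x1]; rewrite ger0_norm ?eB// ltW.
have [_ if2] := hf; have [_ ig2] := hg.
have iV2 : intg 0 1 (fun z => volterra k f z ^+ 2) by case: hV.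
pose S z := ig z 1 (fun x => f x ^+ 2).
have kone : ker (fun _ _ : R => 1 : R) by exact: ker_cst.
have iS : intg 0 1 S.
  apply: (@intg_ext _ _ _ (volterra (fun _ _ => 1) (fun x => f x ^+ 2))).
    by move=> x _; apply: ig_ext => y _; rewrite mul1r.
  exact: intg_volterra1.
have VS z : 0 <= z <= 1 -> volterra k f z ^+ 2 <= M ^+ 2 * S z.
  move=> /andP[z0 z1].
  have if1 : intg z 1 f by apply: intg_sub (L2_intg hf).
  have if2z : intg z 1 (fun x => f x ^+ 2) by apply: intg_sub if2.
  have hpt x : (k z x * f x) ^+ 2 <= M ^+ 2 * f x ^+ 2.
    rewrite exprMn ler_wpM2r ?sqr_ge0//.
    by rewrite -(real_normK (num_real (k z x))) ler_pXn2r ?nnegrE.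
  have i1 : intg z 1 (fun x => (k z x * f x) ^+ 2).
    apply: (@intg_le _ _ _ _ (fun x => M ^+ 2 * f x ^+ 2)).
    - by apply: measurable_funX; apply: intg_meas; exact: intg_ker.
    - by move=> x _; rewrite ger0_norm ?sqr_ge0.
    - exact: intgZ.
  apply: (le_trans (ig_sqr_le z1 (intg_ker z hk if1) i1)).
  apply: (@le_trans _ _ (1 * ig z 1 (fun x => (k z x * f x) ^+ 2))).
    apply: ler_wpM2r; last lra.
    by apply: ig_ge0 => x _; exact: sqr_ge0.
  rewrite mul1r -igZ//; apply: ig_le => //; exact: intgZ.
(* Exchanging the integrals puts the primitive (e z - 1) / B of the weight in front of f^2. *)
have F : ig 0 1 (fun z => e z * S z) <= B^-1 * ig 0 1 (fun z => e z * f z ^+ 2).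
  have kece : ker (fun y _ : R => e (clamp y)) by exact: ker_fst.
  have [ck [N kN]] := kece.
  have -> : ig 0 1 (fun z => e z * S z)
      = ig 0 1 (fun y => ig y 1 (fun z => e (clamp y) * f z ^+ 2)).
    apply: ig_ext => y /andP[y0 y1]; rewrite igZ; last by apply: intg_sub if2.
    by rewrite clampE ?y0.
  rewrite -(@fubini_triangle _ _ _ N _ _ ck kN if2) -igZ; last exact: ie.
  apply: ig_le.
  - have ck2 : {within `[0, 1], continuous (fun x : R => ig 0 x (fun y => e (clamp y)))}.
      apply: ig_continuous => //; apply: intg_continuous => x.
      by apply: continuous_comp; [exact: continuous_clamp|exact: ce].
    have [N' _ HN] := within01_bounded ck2.
    by apply: (@intgM_bd _ _ _ N') => //; apply: intg_meas; exact: intg_cont.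
  - by apply: intgZ; exact: ie.
  move=> z /andP[z0 z1]; rewrite mulrA ler_wpM2r ?sqr_ge0//.
  have -> : ig 0 z (fun y => e (clamp y)) = ig 0 z e.
    by apply: ig_ext => y ?; rewrite clampE//; lra.
  have dE (x : R) : is_derive x 1 (fun y => B^-1 * e y) (e x).
    have D : is_derive x 1 (fun y : R => B * y) B.
      have Di := @is_derive_id R R x 1.
      by have := is_deriveZ B Di; rewrite /GRing.scale/= mulr1.
    have := is_deriveZ B^-1 (is_derive1_comp (is_derive_expR (B * x)) D).
    by rewrite /GRing.scale/= mulrCA mulVf ?mulr1// gt_eqF.
  rewrite (FTC2_continuous z0 ce dE).
  by rewrite gerBl mulr_ge0 ?invr_ge0 ?(ltW B0)// ltW.
have key : ig 0 1 (fun z => e z * f z ^+ 2) <= 4 * ig 0 1 (fun z => e z * g z ^+ 2).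
  have : ig 0 1 (fun z => e z * f z ^+ 2) <=
      2 * ig 0 1 (fun z => e z * g z ^+ 2) + 2 * M ^+ 2 * ig 0 1 (fun z => e z * S z).
    rewrite -!igZ; [|exact: ie|exact: ie].
    rewrite -igD; [|by apply: intgZ; exact: ie|by apply: intgZ; exact: ie].
    apply: ig_le; [exact: ie| |].
      by apply: intgD; apply: intgZ; exact: ie.
    move=> z z01; have := VS z z01; have := gE z z01.
    have := sqr_ge0 (g z - volterra k f z) => h1 h2 h3.
    have h4 : f z ^+ 2 <= 2 * g z ^+ 2 + 2 * (M ^+ 2 * S z) by rewrite h2 in h1 *; nra.
    have := ler_wpM2l (ltW (e0 z)) h4; lra.
  have I0 : 0 <= ig 0 1 (fun z => e z * f z ^+ 2).
    by apply: ig_ge0 => x _; rewrite mulr_ge0 ?sqr_ge0 ?ltW.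
  have : 2 * M ^+ 2 * ig 0 1 (fun z => e z * S z) <= 2^-1 * ig 0 1 (fun z => e z * f z ^+ 2).
    apply: (@le_trans _ _ (2 * M ^+ 2 * (B^-1 * ig 0 1 (fun z => e z * f z ^+ 2)))).
      by apply: ler_wpM2l => //; have := sqr_ge0 M; lra.
    rewrite mulrA; apply: ler_wpM2r => //.
    by rewrite ler_pdivrMr// /B; lra.
  lra.
rewrite /volterra_const -/B.
rewrite -(@ler_pXn2r _ 2)// ?nnegrE ?mulr_ge0 ?normL2_ge0 ?sqrtr_ge0//.
rewrite exprMn !normL2_sqr sqr_sqrtr; last by rewrite mulr_ge0// expR_ge0.
have E1 : ip f f <= ig 0 1 (fun z => e z * f z ^+ 2).
  apply: ig_le; [exact: L2_intgM|exact: ie|move=> z /andP[z0 z1]].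
  by rewrite -expr2 -[leLHS]mul1r ler_wpM2r ?sqr_ge0 ?e1.
have E2 : ig 0 1 (fun z => e z * g z ^+ 2) <= expR B * ip g g.
  rewrite -igZ; last exact: L2_intgM.
  apply: ig_le; [exact: ie|by apply: intgZ; exact: L2_intgM|move=> z /andP[z0 z1]].
  by rewrite -expr2 ler_wpM2r ?sqr_ge0 ?eB.
by rewrite -mulrA; lra.
Qed.

End L2Space.

(** * Time derivatives in L_2 *)

Section L2Derivative.
Context {R : realType}.
Implicit Types (a b c M x y z s t h l : R) (f g d : R -> R -> R).

Lemma cvg_dist_le (T : Type) (F : set_system T) {FF : Filter F} (g u : T -> R) l :
  (\forall h \near F, `|g h - l| <= u h) -> u h @[h --> F] --> 0 -> g h @[h --> F] --> l.
Proof.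
move=> gu /cvgr0_norm_lt u0; apply/cvgrPdist_lt => e e0; near=> h.
have h1 : `|u h| < e by near: h; exact: u0.
have h2 : `|g h - l| <= u h by near: h.
by rewrite distrC (le_lt_trans h2)// (le_lt_trans (ler_norm _)).
Unshelve. all: by end_near. Qed.

Lemma cvg_to_eq (T : Type) (F : set_system T) (g : T -> R) l l' :
  g h @[h --> F] --> l -> l = l' -> g h @[h --> F] --> l'.
Proof. by move=> + <-. Qed.

Lemma cvg_norm0 : `|h| @[h --> (0 : R)^'] --> (0 : R).
Proof.
have H : `|h| @[h --> (0 : R)] --> (0 : R) by rewrite -[X in _ --> X](normr0 R); exact: norm_continuous.
by move=> A /H hA; exact: (@nbhs_dnbhs _ (0 : R)).
Qed.

Lemma shift_cvg t : (t + h) @[h --> (0 : R)^'] --> t.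
Proof.
have H : (t + h) @[h --> (0 : R)] --> t.
  by rewrite -[X in _ --> X]addr0; apply: cvgD; [exact: cvg_cst|exact: cvg_id].
by move=> A /H hA; exact: (@nbhs_dnbhs _ (0 : R)).
Qed.

Lemma near_shift (P : R -> Prop) t : (\forall s \near t, P s) -> \forall h \near (0 : R)^', P (t + h).
Proof. by move=> H; exact: (shift_cvg H). Qed.

Lemma is_deriveP (F : R -> R) t l :
  (h^-1 * (F (t + h) - F t)) @[h --> (0 : R)^'] --> l -> is_derive t 1 F l.
Proof.
move=> H.
have H' : h^-1 *: (F (h *: 1 + t) - F t) @[h --> (0 : R)^'] --> l.
  have -> // : (fun h => h^-1 *: (F (h *: 1 + t) - F t)) = (fun h => h^-1 * (F (t + h) - F t)).
  by apply/funext => h; rewrite /GRing.scale/= mulr1 (addrC h).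
apply: DeriveDef; first by apply/cvg_ex; exists l.
exact: (cvg_lim _ H').
Qed.

Lemma is_derive_cvg (F : R -> R) t l : is_derive t 1 F l ->
  (h^-1 * (F (t + h) - F t)) @[h --> (0 : R)^'] --> l.
Proof.
move=> [dF <-]; have := dF => /cvg_ex[l' H'].
have -> : 'D_1 F t = l' by apply: cvg_lim.
apply: cvg_trans H'; apply: near_eq_cvg; near=> h.
by rewrite /GRing.scale/= mulr1 (addrC h).
Unshelve. all: by end_near. Qed.

Lemma is_derive_cont (F : R -> R) t l : is_derive t 1 F l -> {for t, continuous F}.
Proof. by move=> [dF _]; apply: differentiable_continuous; exact/derivable1_diffP. Qed.

Lemma L2_derive_L2r f t (d : R -> R) h : L2 d -> L2 (f^~ (t + h)) -> L2 (f^~ t) ->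
  L2 (fun z => h^-1 * (f z (t + h) - f z t) - d z).
Proof. by move=> ? ? ?; apply: L2B => //; apply: L2Z; exact: L2B. Qed.

(** Write the difference quotient of [f] as d + r with r -> 0 in L_2. That of the energy is then 2
    <f, d> plus 2 <f, r> + h |r + d|^2, which tends to 0. *)
Lemma L2_derive_energy f t (d : R -> R) : (\forall s \near t, L2 (f^~ s)) -> L2_derive f t d ->
  is_derive t 1 (fun s => ip (f^~ s) (f^~ s)) (2 * ip (f^~ t) d).
Proof.
move=> Lf [Ld cd]; apply: is_deriveP.
have Lt : L2 (f^~ t) by exact: nbhs_singleton Lf.
pose q h := normL2 (fun z => h^-1 * (f z (t + h) - f z t) - d z).
have cq : q h @[h --> (0 : R)^'] --> 0 by exact: cd.
pose u h := 2 * normL2 (f^~ t) * q h + `|h| * (q h + normL2 d) ^+ 2.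
apply: (@cvg_dist_le _ _ _ _ u).
  have := near_shift Lf => Lf'; near=> h.
  have h0 : h != 0 by near: h; exact: nbhs_dnbhs_neq.
  have Lth : L2 (f^~ (t + h)) by near: h.
  pose r z := h^-1 * (f z (t + h) - f z t) - d z.
  have Lr : L2 r by exact: L2_derive_L2r.
  have Lrd : L2 (fun z => r z + d z) by exact: L2D.
  have -> : ip (f^~ (t + h)) (f^~ (t + h)) =
      ip (fun z => f z t + h * (r z + d z)) (fun z => f z t + h * (r z + d z)).
    by apply: ip_ext => z _; rewrite /r; field.
  rewrite ip_sqD// ipDr//.
  have -> : h^-1 * (ip (f^~ t) (f^~ t) + 2 * h * (ip (f^~ t) r + ip (f^~ t) d)
      + h ^+ 2 * ip (fun z => r z + d z) (fun z => r z + d z) - ip (f^~ t) (f^~ t))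
      - 2 * ip (f^~ t) d
      = 2 * ip (f^~ t) r + h * ip (fun z => r z + d z) (fun z => r z + d z).
    by field.
  apply: (le_trans (ler_normD _ _)); apply: lerD.
    rewrite normrM ger0_norm// -mulrA; apply: ler_wpM2l => //.
    exact: CauchySchwarz.
  rewrite normrM; apply: ler_wpM2l => //; rewrite -normL2_sqr ger0_norm ?sqr_ge0//.
  by rewrite ler_pXn2r ?nnegrE ?addr_ge0 ?normL2_ge0//; exact: normL2D.
apply: (cvg_to_eq (l := 2 * normL2 (f^~ t) * 0 + 0 * ((0 + normL2 d) * (0 + normL2 d)))); last by ring.
apply: cvgD; first by apply: cvgM; [exact: cvg_cst|exact: cq].
apply: cvgM; first exact: cvg_norm0.
by apply: cvgM; apply: cvgD => //; exact: cvg_cst.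
Unshelve. all: by end_near. Qed.

Lemma L2_derive_ext f g t (d e : R -> R) :
  (\forall s \near t, forall z, 0 <= z <= 1 -> f z s = g z s) ->
  (forall z, 0 <= z <= 1 -> d z = e z) -> L2_derive f t d -> L2_derive g t e.
Proof.
move=> fg de [Ld cd]; split; first exact: (L2_ext de).
apply: cvg_trans cd; apply: near_eq_cvg.
have := near_shift fg => fg'; near=> h.
apply: normL2_ext => z z01; rewrite de// (nbhs_singleton fg)//; congr (_ * (_ - _) - _).
have H : forall z, 0 <= z <= 1 -> f z (t + h) = g z (t + h) by near: h.
exact: H.
Unshelve. all: by end_near. Qed.

Lemma L2_deriveD f g t (d e : R -> R) :
  (\forall s \near t, L2 (f^~ s)) -> (\forall s \near t, L2 (g^~ s)) ->
  L2_derive f t d -> L2_derive g t e ->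
  L2_derive (fun z s => f z s + g z s) t (fun z => d z + e z).
Proof.
move=> Lf Lg [Ld cd] [Le ce]; split; first exact: L2D.
have Lft := nbhs_singleton Lf; have Lgt := nbhs_singleton Lg.
apply: (cvg_dist_le _ (u := fun h => normL2 (fun z => h^-1 * (f z (t + h) - f z t) - d z)
   + normL2 (fun z => h^-1 * (g z (t + h) - g z t) - e z))).
  have := near_shift Lf => Lf'; have := near_shift Lg => Lg'; near=> h.
  rewrite subr0 ger0_norm ?normL2_ge0//.
  have L1 : L2 (f^~ (t + h)) by near: h.
  have L1' : L2 (g^~ (t + h)) by near: h.
  have r1 := L2_derive_L2r Ld L1 Lft; have r2 := L2_derive_L2r Le L1' Lgt.
  apply: le_trans (normL2D r1 r2); rewrite le_eqVlt; apply/orP; left; apply/eqP.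
  by apply: normL2_ext => z _; ring.
by rewrite -[X in _ --> X]addr0; apply: cvgD.
Unshelve. all: by end_near. Qed.

Lemma L2_derive_scal f t (d : R -> R) (e : R -> R) e' :
  (\forall s \near t, L2 (f^~ s)) -> L2_derive f t d -> is_derive t 1 e e' ->
  L2_derive (fun z s => e s * f z s) t (fun z => e t * d z + e' * f z t).
Proof.
move=> Lf [Ld cd] de; have Lft := nbhs_singleton Lf.
have ce := is_derive_cont de; have := is_derive_cvg de => de'.
have ct : e (t + h) @[h --> (0 : R)^'] --> e t.
  by move=> A /ce hA; exact: (shift_cvg hA).
split; first by apply: L2D; exact: L2Z.
apply: (cvg_dist_le _ (u := fun h => `|e (t + h)| *
    normL2 (fun z => h^-1 * (f z (t + h) - f z t) - d z) +
    (`|e (t + h) - e t| * normL2 d +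
     `|h^-1 * (e (t + h) - e t) - e'| * normL2 (f^~ t)))).
  have := near_shift Lf => Lf'; near=> h.
  rewrite subr0 ger0_norm ?normL2_ge0//.
  have L1 : L2 (f^~ (t + h)) by near: h.
  have r1 := L2_derive_L2r Ld L1 Lft.
  rewrite -!normL2Z//.
  have l1 := L2Z (e (t + h)) r1.
  have l2 := L2Z (e (t + h) - e t) Ld.
  have l3 := L2Z (h^-1 * (e (t + h) - e t) - e') Lft.
  apply: le_trans (lerD (lexx _) (normL2D l2 l3)).
  apply: le_trans (normL2D l1 (L2D l2 l3)).
  rewrite le_eqVlt; apply/orP; left; apply/eqP.
  by apply: normL2_ext => z _; ring.
apply: (cvg_to_eq (l := `|e t| * 0 + (`|e t - e t| * normL2 d + `|e' - e'| * normL2 (f^~ t)))); last first.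
  by rewrite !subrr normr0; ring.
apply: cvgD; first by apply: cvgM => //; exact: (cvg_norm ct).
apply: cvgD; apply: cvgM; try exact: cvg_cst.
  by apply: cvg_norm; apply: cvgB => //; exact: cvg_cst.
by apply: cvg_norm; apply: cvgB => //; exact: cvg_cst.
Unshelve. all: by end_near. Qed.

(* Differentiating w(t) - V_K(t) w(t) = f(t) in L2: the Volterra inverse bound
   controls the error of the difference quotient of w. *)
Lemma L2_derive_volterra (K : R -> R -> R -> R) (kt : R -> R -> R) (f w : R -> R -> R)
    (t M C : R) (fd W : R -> R) :
  (forall s, ker (K s)) -> (forall s x y, `|K s x y| <= M) -> ker kt ->
  (\forall h \near (0 : R)^', forall x y,
     `|h^-1 * (K (t + h) x y - K t x y) - kt x y| <= C * `|h|) ->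
  (\forall s \near t, L2 (f^~ s)) -> (\forall s \near t, L2 (w^~ s)) ->
  (\forall s \near t, forall z, 0 <= z <= 1 -> w z s - volterra (K s) (w^~ s) z = f z s) ->
  L2_derive f t fd -> L2 W ->
  (forall z, 0 <= z <= 1 -> W z - volterra (K t) W z = fd z + volterra kt (w^~ t) z) ->
  L2_derive w t W.
Proof.
move=> kK KM kkt dK Lf Lw wE [Lfd cfd] LW WE; split=> //.
have Lwt := nbhs_singleton Lw; have Lft := nbhs_singleton Lf; have wEt := nbhs_singleton wE.
have [_ [N ktN]] := kkt.
pose q h := normL2 (fun z => h^-1 * (f z (t + h) - f z t) - fd z).
have cq : q h @[h --> (0 : R)^'] --> 0 by exact: cfd.
pose u h := volterra_const M * (q h + (C * `|h| * normL2 (w^~ t) + `|h| * (N + C * `|h|) * normL2 W)).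
apply: (cvg_dist_le _ (u := u)).
  have := near_shift Lf => Lf'; have := near_shift Lw => Lw'; have := near_shift wE => wE'.
  near=> h; rewrite subr0 ger0_norm ?normL2_ge0//.
  have h0 : h != 0 by near: h; exact: nbhs_dnbhs_neq.
  have L1 : L2 (f^~ (t + h)) by near: h.
  have L1' : L2 (w^~ (t + h)) by near: h.
  have wEh : forall z, 0 <= z <= 1 -> w z (t + h) - volterra (K (t + h)) (w^~ (t + h)) z = f z (t + h).
    by near: h.
  have dKh : forall x y, `|h^-1 * (K (t + h) x y - K t x y) - kt x y| <= C * `|h| by near: h.
  pose r z := h^-1 * (w z (t + h) - w z t) - W z.
  have Lr : L2 r by exact: L2_derive_L2r.
  pose D x y := h^-1 * (K (t + h) x y - K t x y) - kt x y.
  pose E x y := K (t + h) x y - K t x y.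
  have kE : ker E by exact: kerB.
  have kD : ker D by apply: kerB => //; apply: kerM => //; exact: ker_cst.
  have EN x y : `|E x y| <= `|h| * (N + C * `|h|).
    have -> : E x y = h * (D x y + kt x y) by rewrite /E /D; field.
    rewrite normrM; apply: ler_wpM2l => //; rewrite addrC.
    by apply: (le_trans (ler_normD _ _)); apply: lerD; [exact: ktN|exact: dKh].
  (* The error [r] solves the Volterra equation at time t + h with right hand side [g]: the error
     for f, the error [D] of the kernel quotient acting on w, and the increment [E] of the kernel
     acting on W. *)
  pose g z := (h^-1 * (f z (t + h) - f z t) - fd z) + (volterra D (w^~ t) z + volterra E W z).
  have gE z : 0 <= z <= 1 -> g z = r z - volterra (K (t + h)) r z.
    move=> z01; have /andP[z0 z1] := z01.
    have i1 := L2_intg L1'; have i2 := L2_intg Lwt; have i3 := L2_intg LW.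
    have -> : volterra (K (t + h)) r z = h^-1 * (volterra (K (t + h)) (w^~ (t + h)) z
        - volterra (K (t + h)) (w^~ t) z) - volterra (K (t + h)) W z.
      transitivity (volterra (K (t + h)) (fun x => h^-1 * (w x (t + h) + (-1) * w x t) + (-1) * W x) z).
        by apply: volterra_ext => // x _; rewrite /r; ring.
      have i4 : intg 0 1 (fun x => -1 * w x t) by exact: intgZ.
      have i5 : intg 0 1 (fun x => w x (t + h) + -1 * w x t) by exact: intgD.
      rewrite volterraD ?volterraZ ?volterraD ?volterraZ//; try exact: intgZ.
      by ring.
    have VE v : intg 0 1 v -> volterra E v z = volterra (K (t + h)) v z - volterra (K t) v z.
      move=> iv; rewrite /E (@volterra_kD _ (K (t + h)) (fun x y => - K t x y))//; last exact: kerN.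
      by rewrite volterra_kN.
    have VD : volterra D (w^~ t) z = h^-1 * volterra E (w^~ t) z - volterra kt (w^~ t) z.
      rewrite /D (@volterra_kD _ (fun x y => h^-1 * E x y) (fun x y => - kt x y))//.
      - by rewrite volterra_kN// (@volterra_kZ _ E (fun=> h^-1)).
      - by apply: kerM => //; exact: ker_cst.
      - exact: kerN.
    rewrite /g VD !VE// -wEh// -wEt// /r.
    have := WE z z01; move: (volterra kt (w^~ t) z) => A WEz.
    have -> : A = W z - volterra (K t) W z - fd z by rewrite WEz; ring.
    by ring.
  have [Lg ng] := volterra_inverse_bound (kK (t + h)) (KM (t + h)) Lr gE.
  apply: (le_trans ng); apply: ler_wpM2l; first exact: sqrtr_ge0.
  have Lfr := L2_derive_L2r Lfd L1 Lft.
  have LV1 : L2 (volterra D (w^~ t)) by apply: L2_cont; apply: volterra_cont => //; exact: L2_intg.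
  have LV2 : L2 (volterra E W) by apply: L2_cont; apply: volterra_cont => //; exact: L2_intg.
  apply: (le_trans (normL2D Lfr (L2D LV1 LV2))); apply: lerD => //.
  apply: (le_trans (normL2D LV1 LV2)); apply: lerD.
  - apply: normL2_bd => //; first by rewrite mulr_ge0 ?normL2_ge0// (le_trans _ (dKh 0 0)).
    by move=> x x01; exact: volterra_bound.
  - apply: normL2_bd => //; first by rewrite mulr_ge0 ?normL2_ge0// (le_trans _ (EN 0 0)).
    by move=> x x01; exact: volterra_bound.
apply: (cvg_to_eq (l := volterra_const M *
    (0 + (C * 0 * normL2 (w^~ t) + 0 * (N + C * 0) * normL2 W)))); last by ring.
have cC : C * `|h| @[h --> (0 : R)^'] --> C * 0.
  by apply: cvgM; [exact: cvg_cst|exact: cvg_norm0].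
apply: cvgM; first exact: cvg_cst.
apply: cvgD; first exact: cq.
apply: cvgD; apply: cvgM => //; try exact: cvg_cst.
by apply: cvgM; [exact: cvg_norm0|apply: cvgD => //; exact: cvg_cst].
Unshelve. all: by end_near. Qed.

End L2Derivative.

(** * Linear ordinary differential equations *)

Section LinearODE.
Context {R : realType}.
Implicit Types (s t tau h M : R).

Definition derive_mx n m t (X : R -> 'M[R]_(n, m)) (D : 'M[R]_(n, m)) : Prop :=
  forall i j, is_derive t 1 (fun s => X s i j) (D i j).

Lemma mx_norm_entry n m (A : 'M[R]_(n, m)) i j : `|A i j| <= mx_norm A.
Proof.
rewrite mx_normrE.
exact: (@le_bigmax _ _ _ 0 (fun ij : 'I_n * 'I_m => `|A ij.1 ij.2|) (i, j)).
Qed.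

Lemma mulmx_bound n m k (A : 'M[R]_(n, m)) (B : 'M[R]_(m, k)) M N i j :
  (forall i j, `|A i j| <= M) -> (forall i j, `|B i j| <= N) ->
  `|(A *m B) i j| <= m%:R * (M * N).
Proof.
move=> AM BN; rewrite mxE (le_trans (ler_norm_sum _ _ _))//.
rewrite (@le_trans _ _ (\sum_(l < m) M * N))//; last by rewrite sumr_const card_ord mulr_natl.
by apply: ler_sum => l _; rewrite normrM ler_pM.
Qed.

Lemma cvg_sum_ord (T : Type) (F : set_system T) {FF : Filter F} n (f : 'I_n -> T -> R) (l : 'I_n -> R) :
  (forall i, f i x @[x --> F] --> l i) -> (\sum_(i < n) f i x) @[x --> F] --> \sum_(i < n) l i.
Proof.
elim: n f l => [|n IH] f l fl.
  rewrite big_ord0; under eq_cvg do rewrite big_ord0; exact: cvg_cst.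
rewrite big_ord_recr /=; under eq_cvg do rewrite big_ord_recr /=.
by apply: cvgD => //; apply: IH.
Qed.

Lemma cvg_mulmx (T : Type) (F : set_system T) {FF : Filter F} n m k
   (A : T -> 'M[R]_(n, m)) (B : T -> 'M[R]_(m, k)) (A0 : 'M[R]_(n, m)) (B0 : 'M[R]_(m, k)) :
  (forall i j, A x i j @[x --> F] --> A0 i j) -> (forall i j, B x i j @[x --> F] --> B0 i j) ->
  forall i j, (A x *m B x) i j @[x --> F] --> (A0 *m B0) i j.
Proof.
move=> AA BB i j; rewrite mxE; under eq_cvg do rewrite mxE.
by apply: cvg_sum_ord => l; apply: cvgM.
Qed.

Lemma derive_mx_cvg n m t (X : R -> 'M[R]_(n, m)) D : derive_mx t X D ->
  forall i j, (h^-1 *: (X (t + h) - X t)) i j @[h --> (0 : R)^'] --> D i j.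
Proof.
move=> dX i j; under eq_cvg do rewrite !mxE.
exact: (is_derive_cvg (dX i j)).
Qed.

Lemma derive_mx_cont n m t (X : R -> 'M[R]_(n, m)) D : derive_mx t X D ->
  forall i j, X (t + h) i j @[h --> (0 : R)^'] --> X t i j.
Proof.
by move=> dX i j A /(is_derive_cont (dX i j)) hA; exact: (shift_cvg hA).
Qed.

Lemma derive_mxMl n m k t (A : 'M[R]_(n, m)) (X : R -> 'M[R]_(m, k)) D :
  derive_mx t X D -> derive_mx t (fun s => A *m X s) (A *m D).
Proof.
move=> dX i j; apply: is_deriveP.
have cA i' j' : A i' j' @[_ --> (0 : R)^'] --> A i' j' by exact: cvg_cst.
have H := @cvg_mulmx _ _ _ _ _ _ _ _ _ _ cA (@derive_mx_cvg _ _ _ _ _ dX) i j.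
apply: cvg_trans (H _); apply: near_eq_cvg; near=> h.
by rewrite -scalemxAr mulmxBr !mxE.
Unshelve. all: by end_near. Qed.

Lemma derive_mxMr n m k t (A : 'M[R]_(m, k)) (X : R -> 'M[R]_(n, m)) D :
  derive_mx t X D -> derive_mx t (fun s => X s *m A) (D *m A).
Proof.
move=> dX i j; apply: is_deriveP.
have cA i' j' : A i' j' @[_ --> (0 : R)^'] --> A i' j' by exact: cvg_cst.
have H := @cvg_mulmx _ _ _ _ _ _ _ _ _ _ (@derive_mx_cvg _ _ _ _ _ dX) cA i j.
apply: cvg_trans (H _); apply: near_eq_cvg; near=> h.
by rewrite -scalemxAl mulmxBl !mxE.
Unshelve. all: by end_near. Qed.

Lemma derive_mxB n m t (X Y : R -> 'M[R]_(n, m)) D E :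
  derive_mx t X D -> derive_mx t Y E -> derive_mx t (fun s => X s - Y s) (D - E).
Proof.
move=> dX dY i j; rewrite mxE [(- E) i j]mxE.
have -> : (fun s => (X s - Y s) i j) = (fun s => X s i j - Y s i j).
  by apply/funext => s; rewrite !mxE.
by apply: is_deriveB; [exact: dX|exact: dY].
Qed.

(** For every row vector v the closeness gives |v| <= |v X| + |v| / 2 in the maximum norm. This
    shows that the kernel is trivial and, applied to the rows of the inverse, bounds its entries.
    With n.+1 the radius is positive for n = 0 too. *)
Lemma near_identity n (X : 'M[R]_n) :
  (forall i j, `|X i j - 1%:M i j| <= (2 * n.+1%:R)^-1) ->
  X \in unitmx /\ forall i j, `|invmx X i j| <= 2.
Proof.
case: n X => [|n] X HX.
  by split; [rewrite unitmxE det_mx00 unitr1|case].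
have n0 : 0 < n.+2%:R :> R by rewrite ltr0n.
have key (v : 'rV[R]_n.+1) c : (forall j, `|(v *m X) 0 j| <= c) -> forall j, `|v 0 j| <= 2 * c.
  move=> vX; pose m := mx_norm v.
  have vm j : `|v 0 j| <= m by exact: mx_norm_entry.
  have vE j : `|v 0 j| <= c + 2^-1 * m.
    have -> : v 0 j = (v *m X) 0 j - (v *m (X - 1%:M)) 0 j.
      by rewrite mulmxBr mulmx1 !mxE; ring.
    apply: (le_trans (ler_normB _ _)); apply: lerD => //.
    have HX' i' j' : `|(X - 1%:M) i' j'| <= (2 * n.+2%:R)^-1.
      by move: (HX i' j'); rewrite !mxE.
    have vm' (i' : 'I_1) j' : `|v i' j'| <= m by rewrite ord1.
    apply: (le_trans (mulmx_bound 0 j vm' HX')).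
    have m0 : 0 <= m by exact: le_trans (vm 0).
    rewrite mulrCA [leRHS]mulrC; apply: ler_wpM2l => //.
    rewrite invfM mulrCA ger_pMr ?invr_gt0// ler_pdivrMr// mul1r ler_nat.
    exact: leqnSn.
  have m0 : m <= c + 2^-1 * m.
    rewrite {1}/m mx_normrE; apply/bigmax_leP; split.
      by apply: le_trans (vE 0).
    by move=> [i j] _ /=; rewrite ord1.
  by move=> j; apply: (le_trans (vm j)); lra.
have uX : X \in unitmx.
  rewrite unitmxE unitfE; apply/det0P => -[v v0 vX].
  move/eqP: v0; apply; apply/rowP => j; rewrite mxE.
  have := key v 0; rewrite vX mulr0 => H; apply/eqP; rewrite -normr_le0.
  by apply: H => k; rewrite mxE normr0.
split=> // i j.
have -> : invmx X i j = (row i (invmx X)) 0 j by rewrite mxE.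
rewrite -[leRHS]mulr1; apply: key => k.
rewrite -row_mul mulVmx// !mxE.
by case: eqP; rewrite ?normr1 ?normr0.
Qed.

(* Variation of constants at one time, without continuity of the coefficients. *)
Lemma derive_inverse_mul n m t M (X : R -> 'M[R]_n) (Y : R -> 'M[R]_(n, m)) F b :
  (\forall s \near t, X s \in unitmx) ->
  (\forall s \near t, forall i j, `|invmx (X s) i j| <= M) ->
  derive_mx t X (F *m X t) -> derive_mx t Y (F *m Y t + b) ->
  derive_mx t (fun s => invmx (X s) *m Y s) (invmx (X t) *m b).
Proof.
move=> uX bX dX dY i j; apply: is_deriveP.
have uXt := nbhs_singleton uX; have bXt := nbhs_singleton bX.
have uX' := near_shift uX; have bX' := near_shift bX.
pose Z0 := invmx (X t) *m Y t.
(* Continuity of the inverse, from X(t+h)^-1 - X(t)^-1 = X(t+h)^-1 (X(t) - X(t+h)) X(t)^-1 and the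
   bound M. *)
have ci i' j' : invmx (X (t + h)) i' j' @[h --> (0 : R)^'] --> invmx (X t) i' j'.
  pose D h : R := mx_norm (X t - X (t + h)).
  have cD : D h @[h --> (0 : R)^'] --> 0.
    have H : (\sum_(ij : 'I_n * 'I_n) `|X t ij.1 ij.2 - X (t + h) ij.1 ij.2|) @[h --> (0 : R)^'] --> 0.
      apply: (cvg_to_eq (l := \sum_(k < #|{: 'I_n * 'I_n}|) (0 : R))); last by rewrite big1.
      under eq_cvg do rewrite (reindex _ (onW_bij _ (@enum_val_bij {: 'I_n * 'I_n}))) /=.
      apply: cvg_sum_ord => k.
      apply: (cvg_to_eq (l := `|X t (enum_val k).1 (enum_val k).2 - X t (enum_val k).1 (enum_val k).2|)); last by rewrite subrr normr0.
      by apply: cvg_norm; apply: cvgB; [exact: cvg_cst|exact: (derive_mx_cont dX)].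
    apply: cvg_dist_le H; near=> h.
    rewrite subr0 ger0_norm; last exact: (normr_ge0 (X t - X (t + h))).
    rewrite /D mx_normrE; apply/bigmax_leP; split.
      by apply: sumr_ge0.
    move=> k _; rewrite (bigD1 k)//= !mxE lerDl; exact: sumr_ge0.
  apply: (cvg_dist_le _ (u := fun h => n%:R * (n%:R * (M * D h) * M))).
    near=> h.
    have u1 : X (t + h) \in unitmx by near: h.
    have b1 : forall i j, `|invmx (X (t + h)) i j| <= M by near: h.
    have -> : invmx (X (t + h)) i' j' - invmx (X t) i' j' =
        (invmx (X (t + h)) *m (X t - X (t + h)) *m invmx (X t)) i' j'.
      by rewrite mulmxBr mulVmx// mulmxBl mul1mx mulmxK ?mul1mx// !mxE.
    apply: mulmx_bound => // i1 j1; apply: mulmx_bound => // i2 j2.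
    exact: mx_norm_entry.
  apply: (cvg_to_eq (l := n%:R * (n%:R * (M * 0) * M))); last by rewrite !(mulr0, mul0r).
  apply: cvgM; first exact: cvg_cst.
  apply: cvgM; last exact: cvg_cst.
  apply: cvgM; first exact: cvg_cst.
  by apply: cvgM => //; exact: cvg_cst.
have dXZ := derive_mxMr Z0 dX.
have dW := derive_mxB dY dXZ.
have W0 : F *m Y t + b - F *m X t *m Z0 = b.
  by rewrite -mulmxA /Z0 mulKVmx// addrAC subrr add0r.
rewrite W0 in dW.
have H := @cvg_mulmx _ _ _ _ _ _ _ _ _ _ ci (@derive_mx_cvg _ _ _ _ _ dW) i j.
apply: cvg_trans (H _); apply: near_eq_cvg; near=> h.
have u1 : X (t + h) \in unitmx by near: h.
have -> : Y t - X t *m Z0 = 0 by rewrite /Z0 mulKVmx// subrr.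
rewrite subr0 -scalemxAr mulmxBr mulKmx// mxE; congr (_ * _).
by rewrite /Z0 !mxE.
Unshelve. all: by end_near. Qed.

Section Fundamental.
Variables (n : nat) (tb : R) (F : R -> 'M[R]_n) (Psi : R -> R -> 'M[R]_n).
Hypothesis fund : fundamental_matrix tb F Psi.

Let dPsi tau t : tb < tau -> tb < t -> derive_mx t (Psi^~ tau) (F t *m Psi t tau).
Proof. by move=> tau0 t0; have [_ H] := fund tau0; exact: H. Qed.

Lemma near_gt (a t : R) : a < t -> \forall s \near t, a < s.
Proof. by move=> h; exact: lt_nbhsr. Qed.

(** [F] comes without continuity or a bound, which rules out a Gronwall argument. Near tau, however,
    Psi s tau is close to the identity, hence invertible with a bounded inverse, and invmx (Psi s
    tau) *m Y s has derivative zero. *)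
Lemma solution_zero_near m (Y : R -> 'M[R]_(n, m)) tau : tb < tau ->
  (forall t, tb < t -> derive_mx t Y (F t *m Y t)) -> Y tau = 0 ->
  \forall s \near tau, Y s = 0.
Proof.
move=> tau0 dY Y0.
have X1 : Psi tau tau = 1%:M by have [] := fund tau0.
pose P s := forall i j, `|Psi s tau i j - 1%:M i j| <= (2 * n.+1%:R)^-1.
have nP : \forall s \near tau, tb < s /\ P s.
  near=> s; split; first by near: s; exact: near_gt.
  have : forall ij : 'I_n * 'I_n, `|Psi s tau ij.1 ij.2 - 1%:M ij.1 ij.2| <= (2 * n.+1%:R)^-1.
    near: s; apply: filter_forall => -[i j] /=.
    have c := is_derive_cont (dPsi tau0 tau0 i j).
    have e0 : 0 < (2 * n.+1%:R)^-1 :> R by rewrite invr_gt0 mulr_gt0.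
    have /cvgrPdist_le/(_ _ e0) := c; rewrite X1; apply: filterS => s.
    by rewrite distrC.
  by move=> H i j; exact: (H (i, j)).
have /nbhs_ballP[e /= e0 eP] := nP.
have good s : `|tau - s| < e -> \forall r \near s, tb < r /\ P r.
  move=> se.
  have : \forall r \near s, `|tau - r| < e.
    have c : (fun r => `|tau - r|) r @[r --> s] --> `|tau - s|.
      by apply: cvg_norm; apply: cvgB; [exact: cvg_cst|exact: cvg_id].
    exact: (cvgr_lt _ c).
  by apply: filterS => r re; exact: eP.
pose Z s := invmx (Psi s tau) *m Y s.
have dZ s : `|tau - s| < e -> derive_mx s Z 0.
  move=> se; have G := good s se.
  have [s0 _] := nbhs_singleton G.
  rewrite -[X in derive_mx _ _ X](mulmx0 _ (invmx (Psi s tau))).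
  apply: (@derive_inverse_mul _ _ _ 2 _ _ (F s)).
  - by apply: filterS G => r [_ /near_identity[]].
  - by apply: filterS G => r [_ /near_identity[]].
  - exact: dPsi.
  - by rewrite addr0; exact: dY.
have Z0 s : `|tau - s| < e -> Z s = 0.
  move=> se.
  have Zt : Z tau = 0 by rewrite /Z Y0 mulmx0.
  apply/matrixP => i j.
  have seg a b : a <= b -> (forall x, a <= x <= b -> `|tau - x| < e) -> Z b i j = Z a i j.
    move=> ab H.
    have [||c _ /eqP] := @MVT_segment R (fun s => Z s i j) (fun=> 0) a b ab.
    - move=> x; rewrite in_itv/= => /andP[ax xb].
      by have := dZ x _ i j; rewrite mxE; apply; apply: H; apply/andP; split; exact: ltW.
    - apply: continuous_in_subspaceT => x; rewrite inE/= in_itv/= => xab.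
      exact: (is_derive_cont (dZ x (H x xab) i j)).
    by rewrite mul0r subr_eq0 => /eqP.
  have [ts|st] := leP tau s.
    rewrite (seg tau s ts) ?Zt// => x /andP[tx xs].
    by move: se; rewrite !ltr_norml => /andP[? ?]; apply/andP; split; lra.
  rewrite -(seg s tau (ltW st)) ?Zt// => x /andP[tx xs].
  by move: se; rewrite !ltr_norml => /andP[? ?]; apply/andP; split; lra.
apply/nbhs_ballP; exists e => //= s se.
have [_ Ps] := eP s se.
have [uX _] := near_identity Ps.
by rewrite -[Y s](mulKVmx uX) -/(Z s) Z0// mulmx0.
Unshelve. all: by end_near. Qed.

(** The zero set of Y in (tb, oo) is open by the local result, closed by continuity, and contains
    tau; the half-line is connected. *)
Lemma solution_unique m (Y : R -> 'M[R]_(n, m)) tau t : tb < tau -> tb < t ->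
  (forall t, tb < t -> derive_mx t Y (F t *m Y t)) -> Y tau = 0 -> Y t = 0.
Proof.
move=> tau0 t0 dY Y0.
pose A : set R := [set s | tb < s].
pose B : set R := [set s | tb < s /\ Y s = 0].
have cA : connected A.
  by apply/connected_intervalP => x y /= tx ty z /andP[xz zy]; exact: lt_le_trans xz.
have oB : open B.
  rewrite openE => s [s0 Ys]; rewrite /interior.
  have H1 := solution_zero_near s0 dY Ys; have H2 := near_gt s0.
  by near=> r; split; near: r.
have BA : B = A.
  apply: cA.
  - by exists tau.
  - by exists B => //; apply/seteqP; split=> s; [move=> [? ?]|move=> [_]].
  - exists (closure B); first exact: closed_closure.
    apply/seteqP; split=> s; first by move=> Bs; split; [case: Bs|exact: subset_closure].
    move=> [s0 cBs]; split => //; apply/matrixP => i j; rewrite mxE.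
    apply: contrapT => /eqP Yn.
    have c := is_derive_cont (dY s s0 i j).
    have N : \forall r \near s, Y r i j != 0.
      have Yn' : 0 < `|Y s i j| by rewrite normr_gt0.
      have /cvgrPdist_lt/(_ _ Yn') := c; apply: filterS => r.
      by apply: contraTneq => ->; rewrite subr0 ltxx.
    have [r [[_ Yr] /eqP]] := cBs _ N.
    by rewrite Yr mxE.
have : A t by [].
by rewrite -BA => -[].
Unshelve. all: by end_near. Qed.

Lemma fundamental_cocycle s t tau : tb < s -> tb < t -> tb < tau ->
  Psi t s *m Psi s tau = Psi t tau.
Proof.
move=> s0 t0 tau0.
pose Y r := Psi r s *m Psi s tau - Psi r tau.
have dY r : tb < r -> derive_mx r Y (F r *m Y r).
  move=> r0; rewrite /Y mulmxBr mulmxA; apply: derive_mxB; last exact: dPsi.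
  by apply: derive_mxMr; exact: dPsi.
have Ys : Y s = 0 by rewrite /Y; have [-> _] := fund s0; rewrite mul1mx subrr.
by apply/eqP; rewrite -subr_eq0 -/(Y t) (solution_unique s0 t0 dY Ys).
Qed.

(** [fundamental_matrix] only differentiates in the first argument. The derivative in the second one
    comes from Psi t r = Psi t T *m invmx (Psi r T), where r is again a first argument. *)
Lemma duhamel_derive muv m (Y : R -> 'M[R]_(n, m)) b t s : exp_bounded tb muv Psi -> 0 < muv ->
  tb < s -> s <= t -> derive_mx s Y (F s *m Y s + b) ->
  derive_mx s (fun r => Psi t r *m Y r) (Psi t s *m b).
Proof.
move=> [kap kap0 eb] muv0 s0 st dY.
(* With T strictly beyond t, a full neighbourhood of s stays below T, even for s = t; there
   [exp_bounded] bounds the inverse Psi T r of Psi r T. *)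
pose T := t + 1.
have T0 : tb < T by rewrite /T; lra.
have t0 : tb < t by lra.
have inv r : tb < r -> Psi r T \in unitmx /\ invmx (Psi r T) = Psi T r.
  move=> r0.
  have E : Psi r T *m Psi T r = 1%:M by rewrite fundamental_cocycle//; have [] := fund r0.
  have [u1 _] := mulmx1_unit E.
  by split => //; rewrite -[LHS]mulmx1 -E mulKmx.
have nr : \forall r \near s, tb < r /\ r < T.
  near=> r; split; first by near: r; exact: near_gt.
  by near: r; apply: lt_nbhsl; rewrite /T; lra.
have D := @derive_inverse_mul n m s kap (Psi^~ T) Y (F s) b.
have {}D : derive_mx s (fun r => invmx (Psi r T) *m Y r) (invmx (Psi s T) *m b).
  apply: D => //; last exact: dPsi.
  - by apply: filterS nr => r [r0 _]; case: (inv r r0).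
  - apply: filterS nr => r [r0 rT] i j; have [_ ->] := inv r r0.
    apply: (le_trans (mx_norm_entry _ _ _)); apply: (le_trans (eb _ _ r0 (ltW rT))).
    rewrite ger_pMr//; rewrite -expR0 ler_expR oppr_le0; apply: mulr_ge0; lra.
have := derive_mxMl (Psi t T) D.
have [_ ->] := inv s s0; rewrite mulmxA fundamental_cocycle//.
move=> H i j; apply: near_eq_is_derive (H i j); near=> r.
have r0 : tb < r by near: r; exact: near_gt.
by have [_ ->] := inv r r0; rewrite mulmxA fundamental_cocycle.
Unshelve. all: by end_near. Qed.

End Fundamental.
End LinearODE.

(** * Extension of kernels to the plane and consequences of the Gevrey bounds *)

Section TriangleExtension.
Context {R : realType}.
Implicit Types (x y z s t h M : R) (k : R -> R -> R).

Lemma within_comp (T U V : topologicalType) (D : set U) (f : U -> V) (g : T -> U) :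
  {within D, continuous f} -> (forall x : T, D (g x)) -> continuous g -> continuous (f \o g).
Proof.
move=> /subspace_continuousP cf Dg cg x A hA.
have H : \forall y \near x, D (g y) -> A (f (g y)) by exact: (cg x _ (cf (g x) (Dg x) A hA)).
change (\forall y \near x, A (f (g y))).
by near=> y; have := Dg y; near: y.
Unshelve. all: by end_near. Qed.

(* [k] precomposed with a continuous retraction of the plane onto the triangle. *)
Definition ext k z s : R := k (Num.min (clamp z) (clamp s)) (clamp s).

Lemma ext_triangle z s : triangle (Num.min (clamp z) (clamp s)) (clamp s).
Proof.
have /andP[? ?] := clamp01 z; have /andP[? ?] := clamp01 s.
by rewrite /triangle; case: (leP (clamp z) (clamp s)) => ?; split => //.
Qed.

Lemma extE k z s : triangle z s -> ext k z s = k z s.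
Proof.
move=> [z0 [zs s1]]; rewrite /ext !clampE; try (apply/andP; split; lra).
by rewrite min_l.
Qed.

Lemma cont2_ext (k : R -> R -> R) :
  {within [set w : R * R | triangle w.1 w.2], continuous (fun w => k w.1 w.2)} ->
  cont2 (ext k).
Proof.
move=> ck; have cc : continuous (@clamp R) by exact: continuous_clamp.
have cmin : cont2 (fun z s : R => Num.min z s).
  move=> w; apply: (@continuous2_cvg _ _ _ _ _ _ _ _ (fun z s : R => Num.min z s)).
  - exact: min_continuous.
  - exact: cvg_fst.
  - exact: cvg_snd.
pose g (w : R * R) := (Num.min (clamp w.1) (clamp w.2), clamp w.2).
have cg : continuous g.
  move=> w; have c2 : clamp v.2 @[v --> w] --> clamp w.2.
    exact: (@continuous_comp _ _ _ snd (@clamp R) w cvg_snd (cc _)).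
  have c1 : clamp v.1 @[v --> w] --> clamp w.1.
    exact: (@continuous_comp _ _ _ fst (@clamp R) w cvg_fst (cc _)).
  have c3 : Num.min (clamp v.1) (clamp v.2) @[v --> w] --> Num.min (clamp w.1) (clamp w.2).
    exact: (@continuous_comp _ _ _ (fun v : R * R => (clamp v.1, clamp v.2))
      (fun v : R * R => Num.min v.1 v.2) w (cvg_pair c1 c2) (cmin _)).
  exact: (cvg_pair c3 c2).
have Dg w : [set w : R * R | triangle w.1 w.2] (g w) by exact: ext_triangle.
have H := within_comp ck Dg cg.
by move=> w; have := H w.
Qed.

(** The extension factors through the compact unit square, hence is bounded. *)
Lemma ker_ext k : cont2 (ext k) -> ker (ext k).
Proof.
move=> ck; split=> //.
pose Q : set (R * R) := `[0, 1] `*` `[0, 1].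
have cQ : compact Q by apply: compact_setX; exact: segment_compact.
have Q0 : Q !=set0 by exists (0, 0); split; rewrite /= in_itv/= lexx ler01.
have cn : {within Q, continuous (fun w : R * R => `|ext k w.1 w.2|)}.
  by apply: continuous_subspaceT => w; apply: cvg_norm; exact: ck.
have [c _ Hc] := compact_EVT_max Q0 cQ cn.
exists `|ext k c.1 c.2| => x y.
have -> : ext k x y = ext k (clamp x) (clamp y).
  by rewrite /ext !(clampE (clamp01 _)).
by apply: (Hc (clamp x, clamp y)); rewrite inE; split; rewrite /= in_itv/=; exact: clamp01.
Qed.

Lemma is_derive_shift (F : R -> R) z l : is_derive z 1 F l ->
  is_derive (0 : R) 1 (fun h => F (z + h)) l.
Proof.
move=> /is_derive_cvg H; apply: is_deriveP; apply: cvg_trans H; apply: near_eq_cvg.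
by near=> h; rewrite add0r addr0.
Unshelve. all: by end_near. Qed.

Lemma near0_interior z s d1 d2 : 0 < z -> z < s -> s < 1 ->
  \forall h \near (0 : R), triangle (z + h * d1) (s + h * d2).
Proof.
move=> z0 zs s1.
have c a d : (a + h * d) @[h --> (0 : R)] --> a.
  apply: (cvg_to_eq (l := a + 0 * d)); last by rewrite mul0r addr0.
  by apply: cvgD; [exact: cvg_cst|apply: cvgM; [exact: cvg_id|exact: cvg_cst]].
have c2 : (s + h * d2) - (z + h * d1) @[h --> (0 : R)] --> s - z by apply: cvgB; exact: c.
have sz : 0 < s - z by rewrite subr_gt0.
near=> h.
have h1 : 0 < z + h * d1 by near: h; exact: (cvgr_gt _ (c z d1)).
have h2 : s + h * d2 < 1 by near: h; exact: (cvgr_lt _ (c s d2)).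
have h3 : 0 < (s + h * d2) - (z + h * d1) by near: h; exact: (cvgr_gt _ c2).
by split; [exact: ltW|split; [|exact: ltW]]; lra.
Unshelve. all: by end_near. Qed.

Lemma cont2_uniform_limit k : (forall e, 0 < e -> exists k', cont2 k' /\
  forall x y, `|k x y - k' x y| <= e) -> cont2 k.
Proof.
move=> H w; apply/cvgrPdist_lt => e e0.
have e4 : 0 < e / 4 by rewrite divr_gt0.
have [k' [ck' kk']] := H _ e4.
have /cvgrPdist_lt/(_ _ e4) := ck' w; apply: filterS => v hv.
have h1 := kk' w.1 w.2; have h2 := kk' v.1 v.2.
have -> : k w.1 w.2 - k v.1 v.2 = (k w.1 w.2 - k' w.1 w.2) +
  (k' w.1 w.2 - k' v.1 v.2) - (k v.1 v.2 - k' v.1 v.2) by ring.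
apply: (le_lt_trans (ler_normB _ _)); have := ler_normD (k w.1 w.2 - k' w.1 w.2) (k' w.1 w.2 - k' v.1 v.2).
lra.
Qed.

(** Singletons are compact and the constants do not depend on the compact set, so the Gevrey bounds
    hold on the whole half-line. *)
Lemma gevrey_bounds alpha tb M r f : gevrey_bounded alpha tb M r f ->
  forall t, tb < t -> [/\ `|f t| <= M, is_derive t 1 f (derive1 f t),
    `|derive1 f t| <= M / r,
    is_derive t 1 (derive1 f) (derive1 (derive1 f) t)
  & `|derive1 (derive1 f) t| <= M / r ^+ 2 * (2`!%:R `^ alpha)].
Proof.
move=> [df bf] t tt.
have B j := bf [set t] (@compact_set1 _ t) (fun s => ltac:(by move=> /= ->)) j t erefl.
split.
- by have := B 0; rewrite /= expr0 divr1 fact0 powR1 mulr1.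
- by have := df 0 t tt; rewrite /= derive1E => h; exact: DeriveDef.
- by have := B 1; rewrite /= expr1 (_ : (1`!)%:R = 1 :> R)// powR1 mulr1.
- by have := df 1 t tt; rewrite /= [derive1 (derive1 f) t]derive1E => h; exact: DeriveDef.
- exact: B 2.
Qed.

(** The mean value theorem is used twice: for [f] it gives a point c between t and t + h, and then
    for [f1] a point between t and c. *)
Lemma quotient_bound (f f1 : R -> R) tb N t h : tb < t -> tb < t + h -> h != 0 ->
  (forall s, tb < s -> is_derive s 1 f (f1 s)) ->
  (forall s, tb < s -> is_derive s 1 f1 (derive1 f1 s)) ->
  (forall s, tb < s -> `|derive1 f1 s| <= N) ->
  `|h^-1 * (f (t + h) - f t) - f1 t| <= N * `|h|.
Proof.
move=> t0 th0 h0 df df1 f1N.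
have mv (g g1 : R -> R) a b : (forall s, tb < s -> is_derive s 1 g (g1 s)) -> tb < a -> tb < b ->
    exists2 c, (Num.min a b <= c <= Num.max a b) & g b - g a = g1 c * (b - a).
  move=> dg a0 b0.
  wlog ab : a b a0 b0 / a <= b.
    move=> H; have [ab|] := boolP (a <= b); first exact: H.
    rewrite -ltNge => /ltW ba.
    have [c cab E] := H b a b0 a0 ba; exists c; first by rewrite minC maxC.
    by rewrite -opprB E; ring.
  have [||c cab E] := @MVT_segment R g g1 a b ab.
  - by move=> x; rewrite in_itv/= => /andP[ax _]; apply: dg; exact: lt_trans ax.
  - apply: continuous_in_subspaceT => x; rewrite inE/= in_itv/= => /andP[ax _].
    by apply: (is_derive_cont (dg x _)); exact: lt_le_trans ax.
  by exists c => //; rewrite min_l// max_r//; move: cab; rewrite in_itv.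
have [c cE E1] := mv f f1 t (t + h) df t0 th0.
have ctb : tb < c.
  by case/andP: cE => + _; apply: lt_le_trans; rewrite lt_min t0.
have [d dE E2] := mv f1 (derive1 f1) t c df1 t0 ctb.
have dtb : tb < d.
  by case/andP: dE => + _; apply: lt_le_trans; rewrite lt_min t0.
rewrite E1 addrAC subrr add0r.
have -> : h^-1 * (f1 c * h) - f1 t = f1 c - f1 t by field.
rewrite E2 normrM; apply: ler_pM => //; first exact: f1N.
move: cE; case: (leP t (t + h)) => th /andP[h1 h2].
  by rewrite !ger0_norm; lra.
by rewrite !ler0_norm; lra.
Qed.

End TriangleExtension.

(** * The observer kernel *)

Section ObserverKernel.
Context {R : realType} (A : agent R) (alpha tb mu : R) (p pz ps : R -> R -> R -> R).
Variable To : (R -> R) -> R -> R -> R.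
Hypotheses (std : standing A alpha tb) (SK : strong_kernel A alpha tb mu p pz ps).
Hypothesis HTo : is_To tb p To.
Implicit Types (t z s : R) (f : R -> R).

Definition kernel_at (k : R -> R -> R -> R) t : R -> R -> R := ext (fun z s => k z s t).
Definition kernel_dt : R -> R -> R -> R := fun z s => derive1 (p z s).

Local Notation P := (kernel_at p).
Local Notation Pz := (kernel_at pz).
Local Notation Ps := (kernel_at ps).
Local Notation Pt := (kernel_at kernel_dt).
Local Notation lam := (ag_lam A).

Lemma kernel_atE k t z s : triangle z s -> kernel_at k t z s = k z s t.
Proof. exact: extE. Qed.

Lemma kernel_gevrey : exists M r, [/\ 0 < M, 0 < r &
  forall z s, triangle z s -> gevrey_bounded alpha tb M r (p z s)].
Proof.
have [[M [r [M0 r0 H]]] _ _ _ _] := SK; exists M, r; split => // z s T.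
exact: (H (z, s) T).
Qed.

(** The Gevrey constants are uniform over the triangle. Hence the second time derivative controls
    the error of the difference quotient uniformly in space, at the rate that [L2_derive_volterra]
    asks for. *)
Lemma kernel_bounds : exists M N, [/\ 0 <= M, 0 <= N,
  forall t, tb < t -> forall x y, `|P t x y| <= M /\ `|Pt t x y| <= N &
  forall t h, tb < t -> tb < t + h -> h != 0 -> forall x y,
    `|h^-1 * (P (t + h) x y - P t x y) - Pt t x y| <= N * `|h|].
Proof.
have [M [r [M0 r0 H]]] := kernel_gevrey.
pose N1 := M / r; pose N2 := M / r ^+ 2 * (2`!%:R `^ alpha).
have N10 : 0 <= N1 by rewrite /N1 divr_ge0// ltW.
have N20 : 0 <= N2 by rewrite /N2 mulr_ge0 ?powR_ge0// divr_ge0 ?exprn_ge0// ltW.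
have G z s t := fun T tt => @gevrey_bounds R alpha tb M r (p z s) (H z s T) t tt.
exists M, (N1 + N2); split; [exact: ltW|exact: addr_ge0| |].
- move=> t tt x y; have [h1 _ h2 _ _] := G _ _ t (ext_triangle x y) tt.
  by split => //; rewrite (le_trans h2)// lerDl.
- move=> t h t0 th0 h0 x y.
  have T := ext_triangle x y.
  rewrite (@le_trans _ _ (N2 * `|h|))//; last by apply: ler_wpM2r => //; rewrite lerDr.
  have GT s := G _ _ s T.
  have d1 s : tb < s -> is_derive s 1 (p (Num.min (clamp x) (clamp y)) (clamp y))
      (derive1 (p (Num.min (clamp x) (clamp y)) (clamp y)) s) by case/GT.
  have d2 s : tb < s -> is_derive s 1 (derive1 (p (Num.min (clamp x) (clamp y)) (clamp y)))
      (derive1 (derive1 (p (Num.min (clamp x) (clamp y)) (clamp y))) s) by case/GT.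
  have d3 s : tb < s -> `|derive1 (derive1 (p (Num.min (clamp x) (clamp y)) (clamp y))) s| <= N2 by case/GT.
  exact: (quotient_bound t0 th0 h0 d1 d2 d3).
Qed.

Lemma kernel_at_cont2 (k : R -> R -> R -> R) t : tb < t ->
  {within [set w : R * R * R | (0 <= w.1.1 /\ w.1.1 <= w.1.2 /\ w.1.2 <= 1) /\ tb < w.2],
    continuous (fun w => k w.1.1 w.1.2 w.2)} -> cont2 (kernel_at k t).
Proof.
move=> tt /subspace_continuousP ck; apply: cont2_ext.
apply/subspace_continuousP => w Tw B hB.
pose D : set (R * R * R) := [set w : R * R * R | (0 <= w.1.1 /\ w.1.1 <= w.1.2 /\ w.1.2 <= 1) /\ tb < w.2].
have H : \forall v \near (w, t), D v -> B (k v.1.1 v.1.2 v.2).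
  exact: (ck (w, t) (conj Tw tt) B hB).
have c : (v, t) @[v --> w] --> (w, t) by exact: (cvg_pair cvg_id (cvg_cst _)).
have H1 : \forall v \near w, D (v, t) -> B (k v.1 v.2 t) by exact: (c _ H).
change (\forall v \near w, triangle v.1 v.2 -> B (k v.1 v.2 t)).
near=> v; move=> Tv; have : D (v, t) by [].
by near: v.
Unshelve. all: by end_near. Qed.

Lemma ker_P t : tb < t -> ker (P t).
Proof.
move=> tt; have [_ [c _ _] _ _ _] := SK.
by apply: ker_ext; exact: kernel_at_cont2.
Qed.

Lemma ker_Pz t : tb < t -> ker (Pz t).
Proof.
move=> tt; have [_ [_ c _] _ _ _] := SK.
by apply: ker_ext; exact: kernel_at_cont2.
Qed.

Lemma ker_Ps t : tb < t -> ker (Ps t).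
Proof.
move=> tt; have [_ [_ _ c] _ _ _] := SK.
by apply: ker_ext; exact: kernel_at_cont2.
Qed.

(** Continuity of p_t in space is not part of [strong_kernel]; it holds because p_t is a uniform
    limit of difference quotients of p. *)
Lemma ker_Pt t : tb < t -> ker (Pt t).
Proof.
move=> tt; apply: ker_ext; apply: cont2_uniform_limit => e e0.
have [M [N [M0 N0 _ H]]] := kernel_bounds.
pose h := e / (N + 1).
have h0 : 0 < h by rewrite divr_gt0// ltr_wpDl.
have th : tb < t + h by rewrite (lt_trans tt)// ltrDl.
exists (fun x y => h^-1 * (P (t + h) x y - P t x y)); split.
  have [+ _] : ker (fun x y => h^-1 * (P (t + h) x y - P t x y)).
    by apply: kerM; [exact: ker_cst|apply: kerB; exact: ker_P].
  by [].
move=> x y; rewrite distrC; apply: (le_trans (H t h tt th _ x y)); first by rewrite gt_eqF.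
rewrite gtr0_norm// /h mulrA ler_pdivrMr ?ltr_wpDl// mulrC ler_wpM2l ?lerDl//.
exact: ltW.
Qed.

Definition coef_a t : R -> R := (ag_a A)^~ t \o @clamp R.

Lemma coef_a_cont t : tb < t -> continuous (coef_a t).
Proof.
move=> tt; apply: within01P.
by have [_ [[[H _] _ _ _ _] _]] := std; exact: H.
Qed.

Lemma kernel_line_z t : tb < t -> forall b c s, 0 <= b -> b <= c -> c <= s -> s <= 1 ->
  P t c s - P t b s = ig b c ((Pz t)^~ s).
Proof.
move=> tt b c s b0 bc cs s1.
have D z y : 0 < z -> z < y -> y < 1 ->
    is_derive (0 : R) 1 (fun h : R => P t (z + h * 1) (y + h * 0)) (Pz t z y).
  move=> z0 zy y1; have [_ _ H _ _] := SK; have [d1 _ _] := H z y t z0 zy y1 tt.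
  rewrite kernel_atE; last by split; [exact: ltW|split; exact: ltW].
  apply: near_eq_is_derive (is_derive_shift d1); have N := near0_interior 1 0 z0 zy y1.
  near=> h; rewrite kernel_atE; first by rewrite mulr1 mulr0 addr0.
  by near: h.
have := @line_integral _ _ _ 0 s 1 0 b c (ker_P tt) (ker_Pz tt) D bc.
have T u : b <= u <= c -> triangle (0 + u * 1) (s + u * 0).
  by move=> /andP[bu uc]; rewrite add0r mulr1 mulr0 addr0; split; [lra|split; lra].
move=> /(_ T); rewrite !add0r !mulr1 !mulr0 !addr0 => ->.
by apply: ig_ext => u _; rewrite add0r mulr1 mulr0 addr0.
Unshelve. all: by end_near. Qed.

Lemma kernel_line_s t : tb < t -> forall z b c, 0 <= z -> z <= b -> b <= c -> c <= 1 ->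
  P t z c - P t z b = ig b c (Ps t z).
Proof.
move=> tt z b c z0 zb bc c1.
have D x y : 0 < x -> x < y -> y < 1 ->
    is_derive (0 : R) 1 (fun h : R => P t (x + h * 0) (y + h * 1)) (Ps t x y).
  move=> x0 xy y1; have [_ _ H _ _] := SK; have [_ d1 _] := H x y t x0 xy y1 tt.
  rewrite kernel_atE; last by split; [exact: ltW|split; exact: ltW].
  apply: near_eq_is_derive (is_derive_shift d1); have N := near0_interior 0 1 x0 xy y1.
  near=> h; rewrite kernel_atE; first by rewrite mulr1 mulr0 addr0.
  by near: h.
have := @line_integral _ _ _ z 0 0 1 b c (ker_P tt) (ker_Ps tt) D bc.
have T u : b <= u <= c -> triangle (z + u * 0) (0 + u * 1).
  by move=> /andP[bu uc]; rewrite add0r mulr1 mulr0 addr0; split; [lra|split; lra].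
move=> /(_ T); rewrite !add0r !mulr1 !mulr0 !addr0 => ->.
by apply: ig_ext => u _; rewrite add0r mulr1 mulr0 addr0.
Unshelve. all: by end_near. Qed.

Lemma lam_gt0 : 0 < lam.
Proof. by have [[]] := std. Qed.

(** The kernel equation, solved for its second order part and integrated along the diagonal u -> (u,
    u + 1 - s). *)
Lemma kernel_line_diag t : tb < t -> forall b c s, 0 <= b -> b <= c -> c <= s -> s <= 1 ->
  (Pz t c (c + 1 - s) - Ps t c (c + 1 - s)) - (Pz t b (b + 1 - s) - Ps t b (b + 1 - s))
  = ig b c (fun y => lam^-1 * (Pt t y (y + 1 - s) - (coef_a t (clamp y) + mu) * P t y (y + 1 - s))).
Proof.
move=> tt b c s b0 bc cs s1.
have l0 := lam_gt0.
pose k y x := Pz t y x - Ps t y x.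
pose g y x := lam^-1 * (Pt t y x - (coef_a t (clamp y) + mu) * P t y x).
have kk : ker k by apply: kerB; [exact: ker_Pz|exact: ker_Ps].
have kg : ker g.
  apply: kerM; first exact: ker_cst.
  apply: kerB; first exact: ker_Pt.
  apply: kerM; last exact: ker_P.
  by apply: kerD; [exact: ker_fst (coef_a_cont tt)|exact: ker_cst].
have D x y : 0 < x -> x < y -> y < 1 ->
    is_derive (0 : R) 1 (fun h : R => k (x + h * 1) (y + h * 1)) (g x y).
  move=> x0 xy y1; have [_ _ H _ _] := SK; have [_ _ [box [d1 E]]] := H x y t x0 xy y1 tt.
  have T : triangle x y by split; [exact: ltW|split; exact: ltW].
  have -> : g x y = box.
    have cx : clamp x = x by rewrite clampE//; apply/andP; split; lra.
    rewrite /g !kernel_atE// /kernel_dt E /coef_a/= !cx.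
    by field; rewrite gt_eqF.
  apply: near_eq_is_derive d1; have N := near0_interior 1 1 x0 xy y1.
  near=> h; rewrite /k !kernel_atE; first by rewrite mulr1.
    by near: h.
  by near: h.
have := @line_integral _ _ _ 0 (1 - s) 1 1 b c kk kg D bc.
have T u : b <= u <= c -> triangle (0 + u * 1) (1 - s + u * 1).
  by move=> /andP[bu uc]; rewrite add0r mulr1; split; [lra|split; lra].
have sE u : 1 - s + u = u + 1 - s by ring.
move=> /(_ T); rewrite !add0r !mulr1 /k !sE => ->.
by apply: ig_ext => u _; rewrite add0r mulr1 sE.
Unshelve. all: by end_near. Qed.

Lemma kernel_diag t : tb < t ->
  prim (fun z => P t z z) (fun z => - ((coef_a t z + mu) / (2 * lam))).
Proof.
move=> tt; have [_ _ _ _ H] := SK.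
have cf : continuous (fun z => (coef_a t z + mu) / (2 * lam)).
  move=> x; apply: cvgM; last exact: cvg_cst.
  by apply: cvgD; [exact: coef_a_cont|exact: cvg_cst].
have i z : intg 0 z (fun z => (coef_a t z + mu) / (2 * lam)) by exact: intg_continuous.
have E z : 0 <= z <= 1 -> P t z z = ag_q A t - ig 0 z (fun z => (coef_a t z + mu) / (2 * lam)).
  move=> /andP[z0 z1]; rewrite kernel_atE; last by split; [|split].
  rewrite H ?z0//; congr (_ - _); apply: ig_ext => x /andP[x0 xz].
  by rewrite /coef_a/= clampE//; apply/andP; split; lra.
split; first exact: intgN.
move=> z z01; rewrite igN// (E z)// (E 0) ?lexx ?ler01//.
by rewrite ig_aa subr0.
Qed.

Lemma kernel_corner t : tb < t -> P t 0 0 = ag_q A t.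
Proof.
move=> tt; have [_ _ _ _ H] := SK; rewrite kernel_atE; last by split => //; split => //; exact: ler01.
by rewrite H ?lexx ?ler01// ig_aa subr0.
Qed.

Lemma continuous_eq_oo (f g : R -> R) : continuous f -> continuous g ->
  (forall x, 0 < x < 1 -> f x = g x) -> forall x, 0 <= x <= 1 -> f x = g x.
Proof.
move=> cf cg fg x /andP[x0 x1].
pose y h := (1 - h) * x + h / 2.
have cy : continuous y.
  move=> h; apply: cvgD; apply: cvgM; try exact: cvg_cst; try exact: cvg_id.
  by apply: cvgB; [exact: cvg_cst|exact: cvg_id].
have y0 : y 0 = x by rewrite /y; ring.
have c1 : f (y h) @[h --> 0^'+] --> f x.
  by rewrite -y0; apply: cvg_at_right_filter; apply: (@continuous_comp _ _ _ y f); [exact: cy|exact: cf].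
have c2 : g (y h) @[h --> 0^'+] --> g x.
  by rewrite -y0; apply: cvg_at_right_filter; apply: (@continuous_comp _ _ _ y g); [exact: cy|exact: cg].
have E : \forall h \near (0 : R)^'+, g (y h) = f (y h).
  near=> h; have h0 : 0 < h by near: h; exact: nbhs_right_gt.
  have h1 : h < 1 by near: h; exact: nbhs_right_lt.
  by rewrite fg// /y; apply/andP; split; nra.
have c3 : f (y h) @[h --> 0^'+] --> g x by apply: cvg_trans c2; exact: near_eq_cvg.
exact: (cvg_unique _ c1 c3).
Unshelve. all: by end_near. Qed.

(** The condition is given for 0 < zeta < 1; continuity on the closed triangle extends it to both
    end points. *)
Lemma kernel_bc t s : tb < t -> 0 <= s <= 1 -> Pz t 0 s = ag_q A t * P t 0 s.
Proof.
move=> tt s01.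
apply: (@continuous_eq_oo (Pz t 0) (fun s => ag_q A t * P t 0 s)) => //.
- exact: ker_row (ker_Pz tt).
- by move=> x; apply: cvgM; [exact: cvg_cst|exact: (@ker_row _ (P t) 0 (ker_P tt) x)].
- move=> x /andP[x0 x1]; have [_ _ _ H _] := SK.
  by rewrite !kernel_atE ?H ?x0//; split => //; split; exact: ltW.
Qed.

Lemma To_invE t f z : 0 <= z <= 1 -> To_inv p f t z = f z - volterra (P t) f z.
Proof.
move=> z01; congr (_ - _); have /andP[z0 z1] := z01; apply: ig_ext => s /andP[zs s1].
by rewrite kernel_atE//; split.
Qed.

Lemma ToP t f : tb < t -> L2 f -> L2 (To f t) /\
  forall z, 0 <= z <= 1 -> To f t z - volterra (P t) (To f t) z = f z.
Proof.
move=> tt Lf; have [LT E _] := HTo tt Lf; split => // z z01.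
by rewrite -To_invE// E.
Qed.

Lemma To_bounded : exists2 C, 0 <= C & forall t f, tb < t -> L2 f ->
  normL2 (To f t) <= C * normL2 f.
Proof.
have [M [N [M0 _ H _]]] := kernel_bounds.
exists (volterra_const M); first exact: sqrtr_ge0.
move=> t f tt Lf; have [LT E] := ToP tt Lf.
have [||//] := @volterra_inverse_bound _ (P t) M (To f t) f (ker_P tt) _ LT.
  by move=> x y; have [] := H t tt x y.
by move=> z z01; rewrite E.
Qed.

End ObserverKernel.

(** * Energy estimates for damped heat equations *)

Section ParabolicEnergy.
Context {R : realType}.
Implicit Types (a b t s z : R) (f g d : R -> R -> R).

Lemma derive_le0_le (F dF : R -> R) a b : a <= b ->
  (forall x : R, a <= x <= b -> is_derive x 1 F (dF x)) ->
  (forall x, a <= x <= b -> dF x <= 0) -> F b <= F a.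
Proof.
move=> ab H H0.
have [||c cab E] := @MVT_segment R F dF a b ab.
- by move=> x; rewrite in_itv/= => /andP[ax xb]; apply: H; apply/andP; split; exact: ltW.
- apply: continuous_in_subspaceT => x; rewrite inE/= in_itv/= => xab.
  exact: (is_derive_cont (H x xab)).
rewrite -subr_le0 E mulr_le0_ge0 ?subr_ge0//.
by apply: H0; move: cab; rewrite in_itv.
Qed.

Lemma H2_prim (f f1 f2 : R -> R) : H2 f f1 f2 -> [/\ L2 f2, prim f1 f2 & prim f f1].
Proof.
move=> [L f1E fE].
have p1 : prim f1 f2 by split => //; exact: L2_intg.
by split => //; split => //; apply: intg_cont; exact: prim_cont p1.
Qed.

Lemma ip_energy (y yz yzz : R -> R) : prim y yz -> prim yz yzz -> L2 yzz ->
  ip y yzz = y 1 * yz 1 - y 0 * yz 0 - ip yz yz.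
Proof.
move=> py pyz L; rewrite /ip (@ibp _ y yz yz yzz 0 1)//.
exact: prim_cont pyz.
Qed.

Lemma prim_L2 (f g : R -> R) : prim f g -> L2 f.
Proof. by move=> /prim_cont; exact: L2_cont. Qed.

(** The boundary terms are estimated by the trace inequality and Young's inequality, the forcing by
    Young's inequality. Of the damping 2 mu |y|^2 each of the two takes a quarter, so that mu |y|^2
    is left. The rotation term is kept exact for a later cancellation. *)
Lemma damped_energy_ineq (lam mu G H om : R) (y yz yzz x h : R -> R) :
  0 < lam -> 0 < mu -> 0 <= G -> 0 <= H ->
  prim y yz -> prim yz yzz -> L2 yzz -> L2 x -> L2 h -> normL2 h <= H ->
  `|yz 0| <= G -> `|yz 1| <= G ->
  2 * ip y (fun z => lam * yzz z - mu * y z + om * x z + h z) <=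
  - mu * ip y y + 2 * om * ip y x
  + (2 * lam * G ^+ 2 * (8 * lam + 2 * mu) / mu + 2 * H ^+ 2 / mu).
Proof.
move=> l0 m0 G0 H0 py pyz Lzz Lx Lh hH g0 g1.
have Ly := prim_L2 py; have Lyz := prim_L2 pyz.
have i1 := L2Z lam Lzz; have i2 := L2Z mu Ly; have i3 := L2Z om Lx.
rewrite ipDr//; last by apply: L2D => //; exact: L2B.
rewrite ipDr//; last exact: L2B.
rewrite ipBr// !ipZr// (ip_energy py pyz Lzz).
set E := ip y y; set D := ip yz yz.
have E0 : 0 <= E by exact: ip_ge0.
have D0 : 0 <= D by exact: ip_ge0.
have t1 : y 1 ^+ 2 <= 2 * E + 2 * D by apply: prim_trace => //; rewrite lexx ler01.
have t0 : y 0 ^+ 2 <= 2 * E + 2 * D by apply: prim_trace => //; rewrite lexx ler01.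
have Yh : 2 * ip y h <= 2^-1 * mu * E + 2 * H ^+ 2 / mu.
  have c := le_trans (ler_norm _) (CauchySchwarz Ly Lh).
  have n0 := normL2_ge0 y; have nh0 := normL2_ge0 h.
  have c2 : ip y h <= normL2 y * H by apply: (le_trans c); exact: ler_wpM2l.
  have : E = normL2 y ^+ 2 by rewrite normL2_sqr.
  move: (normL2 y) n0 c2 => Y Y0 c2 ->.
  have : 0 <= (mu * Y - 2 * H) ^+ 2 / (2 * mu) by rewrite divr_ge0 ?sqr_ge0// mulr_ge0// ltW.
  have -> : (mu * Y - 2 * H) ^+ 2 / (2 * mu) = 2^-1 * mu * Y ^+ 2 - 2 * Y * H + 2 * H ^+ 2 / mu.
    by field; rewrite gt_eqF.
  by lra.
pose k := 8 * lam + 2 * mu.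
have k0 : 0 < k by rewrite /k; lra.
(* Young weight with 4 lam de <= mu / 2 and de <= 1 / 2: together the two boundary terms then cost
   at most mu / 2 times E and the whole dissipation 2 lam D. *)
pose de := mu / k.
have de0 : 0 < de by rewrite divr_gt0.
have bt (u v : R) : `|v| <= G -> u ^+ 2 <= 2 * E + 2 * D ->
    2 * lam * (u * v) <= lam * (G ^+ 2 / de) + lam * de * (2 * E + 2 * D).
  move=> vG uB.
  have v2 : v ^+ 2 <= G ^+ 2 by rewrite -(real_normK (num_real v)) ler_pXn2r ?nnegrE.
  have : 0 <= (de * u - v) ^+ 2 / de by rewrite divr_ge0 ?sqr_ge0// ltW.
  have -> : (de * u - v) ^+ 2 / de = de * u ^+ 2 - 2 * (u * v) + v ^+ 2 / de.
    by field; rewrite gt_eqF.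
  have h1 : v ^+ 2 / de <= G ^+ 2 / de by rewrite ler_wpM2r// invr_ge0 ltW.
  have h2 : de * u ^+ 2 <= de * (2 * E + 2 * D) by rewrite ler_wpM2l// ltW.
  move=> h3; have h4 : 2 * (u * v) <= G ^+ 2 / de + de * (2 * E + 2 * D) by lra.
  have := ler_wpM2l (ltW l0) h4; lra.
have b1 := bt _ _ g1 t1.
have b0 : 2 * lam * ((- y 0) * yz 0) <= lam * (G ^+ 2 / de) + lam * de * (2 * E + 2 * D).
  by apply: bt => //; rewrite sqrrN.
have ld1 : lam * de * 4 <= 2^-1 * mu.
  rewrite /de mulrCA mulrAC [leRHS]mulrC -mulrA ler_wpM2l//; first exact: ltW.
  by rewrite mulrA ler_pdivrMr// /k; lra.
have ld2 : de <= 2^-1.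
  by rewrite /de ler_pdivrMr// /k; lra.
have gE : lam * (G ^+ 2 / de) = lam * G ^+ 2 * k / mu.
  by rewrite /de; field; rewrite !gt_eqF.
rewrite gE in b1 b0.
have e1 : lam * de * 4 * E <= 2^-1 * mu * E by rewrite ler_wpM2r.
have e2 : lam * de * 4 * D <= 2 * lam * D.
  rewrite ler_wpM2r//; have := ler_wpM2l (ltW l0) ld2; lra.
have q1 : lam * de * (2 * E + 2 * D) = 2^-1 * (lam * de * 4 * E) + 2^-1 * (lam * de * 4 * D).
  by field.
rewrite q1 in b1 b0.
have -> : 2 * lam * G ^+ 2 * (8 * lam + 2 * mu) / mu = 2 * (lam * G ^+ 2 * k / mu).
  by rewrite /k; ring.
move: (lam * G ^+ 2 * k / mu) b1 b0 => K b1 b0.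
lra.
Qed.

(* Two components coupled by a rotation [om]: the coupling cancels in the energy. *)
Lemma damped_pair_bound (tb lam mu G H om : R) (y1 y1z y1zz h1 y2 y2z y2zz h2 : R -> R -> R) :
  0 < lam -> 0 < mu -> 0 <= G -> 0 <= H ->
  (forall t, tb < t -> [/\ prim (y1^~ t) (y1z^~ t), prim (y1z^~ t) (y1zz^~ t) & L2 (y1zz^~ t)]) ->
  (forall t, tb < t -> [/\ prim (y2^~ t) (y2z^~ t), prim (y2z^~ t) (y2zz^~ t) & L2 (y2zz^~ t)]) ->
  (forall t, tb < t -> [/\ L2 (h1^~ t), L2 (h2^~ t), normL2 (h1^~ t) <= H & normL2 (h2^~ t) <= H]) ->
  (forall t, tb < t -> [/\ `|y1z 0 t| <= G, `|y1z 1 t| <= G, `|y2z 0 t| <= G & `|y2z 1 t| <= G]) ->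
  (forall t, tb < t -> L2_derive y1 t
     (fun z => lam * y1zz z t - mu * y1 z t + om * y2 z t + h1 z t)) ->
  (forall t, tb < t -> L2_derive y2 t
     (fun z => lam * y2zz z t - mu * y2 z t + (- om) * y1 z t + h2 z t)) ->
  (exists B, \forall s \near tb^'+, normL2 (y1^~ s) <= B /\ normL2 (y2^~ s) <= B) ->
  exists C, forall t, tb < t -> normL2 (y1^~ t) <= C /\ normL2 (y2^~ t) <= C.
Proof.
move=> l0 m0 G0 H0 P1 P2 hL hG d1 d2 [B nB].
pose K0 := 2 * lam * G ^+ 2 * (8 * lam + 2 * mu) / mu + 2 * H ^+ 2 / mu.
have K00 : 0 <= K0.
  by rewrite /K0 addr_ge0// divr_ge0 ?mulr_ge0 ?exprn_ge0// ?ltW// addr_gt0// mulr_gt0.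
pose V s := ip (y1^~ s) (y1^~ s) + ip (y2^~ s) (y2^~ s).
pose dV s := 2 * ip (y1^~ s) (fun z => lam * y1zz z s - mu * y1 z s + om * y2 z s + h1 z s) +
             2 * ip (y2^~ s) (fun z => lam * y2zz z s - mu * y2 z s + (- om) * y1 z s + h2 z s).
have L1 s : tb < s -> L2 (y1^~ s) by move=> /P1[p _ _]; exact: prim_L2 p.
have L2' s : tb < s -> L2 (y2^~ s) by move=> /P2[p _ _]; exact: prim_L2 p.
have nL1 s : tb < s -> \forall r \near s, L2 (y1^~ r).
  by move=> s0; apply: filterS (near_gt s0) => r; exact: L1.
have nL2 s : tb < s -> \forall r \near s, L2 (y2^~ r).
  by move=> s0; apply: filterS (near_gt s0) => r; exact: L2'.
have DV s : tb < s -> is_derive s 1 V (dV s).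
  move=> s0; apply: is_deriveD.
    by apply: L2_derive_energy; [exact: nL1|exact: d1].
  by apply: L2_derive_energy; [exact: nL2|exact: d2].
have dVle s : tb < s -> dV s <= - mu * V s + 2 * K0.
  move=> s0; have [p1 p1z p1zz] := P1 _ s0; have [p2 p2z p2zz] := P2 _ s0.
  have [hl1 hl2 hn1 hn2] := hL _ s0; have [g1 g2 g3 g4] := hG _ s0.
  have e1 := damped_energy_ineq om l0 m0 G0 H0 p1 p1z p1zz (L2' _ s0) hl1 hn1 g1 g2.
  have e2 := damped_energy_ineq (- om) l0 m0 G0 H0 p2 p2z p2zz (L1 _ s0) hl2 hn2 g3 g4.
  rewrite -/K0 in e1 e2; rewrite (ipC (y2^~ s) (y1^~ s)) in e2.
  rewrite /dV /V; lra.
(* The equilibrium of V' = - mu V + 2 K0; the weighted distance [W] to it is nonincreasing. *)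
pose C := 2 * K0 / mu.
have C0 : 0 <= C by rewrite /C divr_ge0 ?mulr_ge0// ltW.
pose W s := expR (mu * s) * (V s - C).
pose dW s := expR (mu * s) * (dV s + mu * (V s - C)).
have DW s : tb < s -> is_derive s 1 W (dW s).
  move=> s0.
  have D : is_derive s 1 (fun x : R => mu * x) mu.
    have Di := @is_derive_id R R s 1.
    by have := is_deriveZ mu Di; rewrite /GRing.scale/= mulr1.
  have De := is_derive1_comp (is_derive_expR (mu * s)) D.
  have Dv : is_derive s 1 (fun s => V s - C) (dV s).
    by rewrite -[X in is_derive _ _ _ X]subr0; apply: is_deriveB; exact: DV.
  have := is_deriveM De Dv; rewrite /GRing.scale/=.
  have -> : dW s = expR (mu * s) * dV s + (V s - C) * (expR (mu * s) * mu) by rewrite /dW; ring.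
  by [].
have dW0 s : tb < s -> dW s <= 0.
  move=> s0; rewrite /dW mulr_ge0_le0 ?expR_ge0//.
  have := dVle s s0; rewrite /C.
  have -> : mu * (V s - 2 * K0 / mu) = mu * V s - 2 * K0 by field; rewrite gt_eqF.
  lra.
pose B1 := Num.max B 0.
exists (1 + C + 2 * B1 ^+ 2) => t tt.
(* The equations hold only after tb, so the comparison starts at some s between tb and t at which
   the bound B is available. *)
have [s [s0 st [n1 n2]]] : exists s, [/\ tb < s, s < t & normL2 (y1^~ s) <= B /\ normL2 (y2^~ s) <= B].
  have : \forall s \near tb^'+, [/\ tb < s, s < t & normL2 (y1^~ s) <= B /\ normL2 (y2^~ s) <= B].
    near=> s; split; near: s; [exact: nbhs_right_gt|exact: nbhs_right_lt|exact: nB].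
  by move=> /filter_ex.
have Wts : W t <= W s.
  apply: (@derive_le0_le W dW) => [|x /andP[sx _]|x /andP[sx _]]; first exact: ltW.
    by apply: DW; exact: lt_le_trans sx.
  by apply: dW0; exact: lt_le_trans sx.
have Vs0 : 0 <= V s by rewrite addr_ge0// ip_ge0.
have Vt : V t <= C + V s.
  have [h|h] := leP (V t) C; first by rewrite (le_trans h)// lerDl.
  have : expR (mu * s) * (V t - C) <= expR (mu * s) * (V s - C).
    apply: le_trans Wts; rewrite /W ler_wpM2r ?subr_ge0 ?(ltW h)//.
    by rewrite ler_expR ler_wpM2l// ltW.
  rewrite ler_pM2l ?expR_gt0//; lra.
have B10 : 0 <= B1 by rewrite /B1 le_max lexx orbT.
have BB : B <= B1 by rewrite /B1 le_max lexx.
have Vs : V s <= 2 * B1 ^+ 2.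
  rewrite /V -!normL2_sqr.
  have h (x : R) : 0 <= x -> x <= B -> x ^+ 2 <= B1 ^+ 2.
    by move=> x0 xB; rewrite ler_pXn2r ?nnegrE// (le_trans xB).
  have := h _ (normL2_ge0 _) n1; have := h _ (normL2_ge0 _) n2; lra.
(* The estimate x <= 1 + x^2 avoids a square root in the constant. *)
have sq (x : R) : 0 <= x -> x ^+ 2 <= V t -> x <= 1 + C + 2 * B1 ^+ 2.
  move=> x0 xV; have : x ^+ 2 <= C + 2 * B1 ^+ 2 by lra.
  have [h|h] := leP x 1; last by nra.
  have := sqr_ge0 B1; lra.
split; apply: sq; rewrite ?normL2_ge0// normL2_sqr /V ?lerDl ?lerDr ip_ge0//.
Unshelve. all: by end_near. Qed.

End ParabolicEnergy.

(** * Finite linear combinations of evolutions *)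

Section LinearCombinations.
Context {R : realType}.
Implicit Types (t s z M : R).

Lemma finite_bound (T : Type) n (F : 'I_n -> T -> R) (Q : T -> Prop) :
  (forall k, exists M, forall x, Q x -> `|F k x| <= M) ->
  exists2 M, 0 <= M & forall k x, Q x -> `|F k x| <= M.
Proof.
move=> /choice[f fF]; exists (\sum_(k < n) `|f k|); first exact: sumr_ge0.
move=> k x Qx; rewrite (bigD1 k)//= (le_trans (fF k x Qx))// (le_trans (ler_norm _))//.
by rewrite lerDl sumr_ge0.
Qed.

Lemma normL2_lincomb n (c : 'I_n -> R) (f : 'I_n -> R -> R) : (forall i, L2 (f i)) ->
  normL2 (fun z => \sum_(i < n) c i * f i z) <= \sum_(i < n) `|c i| * normL2 (f i).
Proof.
move=> Lf; elim: n c f Lf => [|n IH] c f Lf.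
  rewrite big_ord0 (@normL2_ext _ _ (fun=> 0)); last by move=> z _; rewrite big_ord0.
  by rewrite normL2_cst normr0.
rewrite big_ord_recr /=.
rewrite (@normL2_ext _ _ (fun z => \sum_(i < n) c (widen_ord (leqnSn n) i) * f (widen_ord (leqnSn n) i) z
   + c ord_max * f ord_max z)); last by move=> z _; rewrite big_ord_recr.
apply: (le_trans (normL2D _ _)).
- by apply: L2_sum => i; exact: L2Z.
- exact: L2Z.
by rewrite normL2Z// lerD2r; apply: (IH (fun i => c (widen_ord (leqnSn n) i)) (fun i => f (widen_ord (leqnSn n) i))).
Qed.

Lemma prim_lincomb n (c : 'I_n -> R) (f g : 'I_n -> R -> R) : (forall i, prim (f i) (g i)) ->
  prim (fun z => \sum_(i < n) c i * f i z) (fun z => \sum_(i < n) c i * g i z).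
Proof.
move=> pf; elim: n c f g pf => [|n IH] c f g pf.
  by apply: (prim_ext _ _ (prim_cst 0)) => x _; rewrite big_ord0.
have := primD (IH (fun i => c (widen_ord (leqnSn n) i)) _ _ (fun i => pf (widen_ord (leqnSn n) i)))
  (primZ (c ord_max) (pf ord_max)).
by apply: prim_ext => x _; rewrite big_ord_recr.
Qed.

Lemma L2_lincomb n (c : 'I_n -> R) (f : 'I_n -> R -> R) : (forall i, L2 (f i)) ->
  L2 (fun z => \sum_(i < n) c i * f i z).
Proof. by move=> Lf; apply: L2_sum => i; exact: L2Z. Qed.

Lemma L2_derive_lincomb n (e : 'I_n -> R -> R) (e' : 'I_n -> R) (f : 'I_n -> R -> R -> R)
    (d : 'I_n -> R -> R) t :
  (forall i, \forall s \near t, L2 ((f i)^~ s)) -> (forall i, L2_derive (f i) t (d i)) ->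
  (forall i, is_derive t 1 (e i) (e' i)) ->
  L2_derive (fun z s => \sum_(i < n) e i s * f i z s) t
    (fun z => \sum_(i < n) (e i t * d i z + e' i * f i z t)).
Proof.
move=> Lf df de; elim: n e e' f d Lf df de => [|n IH] e e' f d Lf df de.
  apply: (@L2_derive_ext _ (fun _ _ => 0) _ _ (fun=> 0)).
  - by near=> s => z _; rewrite big_ord0.
  - by move=> z _; rewrite big_ord0.
  split; first exact: L2_cst.
  have -> : (fun h : R => normL2 (fun _ : R => h^-1 * ((0 : R) - 0) - 0)) = (fun=> 0).
    apply/funext => h; rewrite (@normL2_ext _ _ (fun=> 0)); last by move=> x _; ring.
    by rewrite normL2_cst normr0.
  exact: cvg_cst.
pose w := widen_ord (leqnSn n).
have IH' := IH (fun i => e (w i)) (fun i => e' (w i)) (fun i => f (w i)) (fun i => d (w i))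
  (fun i => Lf (w i)) (fun i => df (w i)) (fun i => de (w i)).
have D := L2_derive_scal (Lf ord_max) (df ord_max) (de ord_max).
apply: (L2_derive_ext _ _ (L2_deriveD _ _ IH' D)).
- by near=> s => z _; rewrite big_ord_recr.
- by move=> z _; rewrite big_ord_recr.
- have H : \forall s \near t, forall i : 'I_n, L2 ((f (w i))^~ s).
    exact: (@filter_forall _ _ (fun i s => L2 ((f (w i))^~ s)) _ (@nbhs_filter _ t) (fun i => Lf (w i))).
  by apply: filterS H => s Hs; apply: (@L2_lincomb n (fun i => e (w i) s) (fun i => (f (w i))^~ s)).
- by apply: filterS (Lf ord_max) => s Hs; exact: L2Z.
Unshelve. all: by end_near. Qed.

(** Supplies the starting bound for energy estimates, which only run on the open half-line. *)
Lemma evolution_right_bounded (t0 : R) (f fz fzz rhs : R -> R -> R) :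
  evolution t0 f fz fzz rhs -> exists B, \forall s \near t0^'+, normL2 (f^~ s) <= B.
Proof.
move=> [L0 c0 H _ _]; exists (1 + normL2 (f^~ t0)).
have /cvgr0_norm_lt/(_ _ ltr01) N := c0.
near=> s.
have s0 : t0 < s by near: s; exact: nbhs_right_gt.
have [_ _ /prim_L2 Ls] := H2_prim (H s s0).
have h : `|normL2 (fun z => f z s - f z t0)| < 1 by near: s; exact: N.
rewrite (@normL2_ext _ _ (fun z => (f z s - f z t0) + f z t0)); last by move=> z _; rewrite subrK.
apply: (le_trans (normL2D (L2B Ls L0) L0)); rewrite lerD2r.
by rewrite (le_trans (ler_norm _))// ltW.
Unshelve. all: by end_near. Qed.

End LinearCombinations.

(** * Eigenmodes of the signal model *)

Section Modes.
Context {R : realType}.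
Local Notation re := (@complex.Re R).
Local Notation im := (@complex.Im R).

Lemma re_sum (I : Type) (r : seq I) (F : I -> R[i]) : re (\sum_(i <- r) F i) = \sum_(i <- r) re (F i).
Proof. by elim/big_rec2: _ => // i y x _ <-; case: (F i) => a b; case: x. Qed.

Lemma im_sum (I : Type) (r : seq I) (F : I -> R[i]) : im (\sum_(i <- r) F i) = \sum_(i <- r) im (F i).
Proof. by elim/big_rec2: _ => // i y x _ <-; case: (F i) => a b; case: x. Qed.

Lemma re_mul (x y : R[i]) : re (x * y) = re x * re y - im x * im y.
Proof. by case: x => a b; case: y. Qed.

Lemma im_mul (x y : R[i]) : im (x * y) = re x * im y + im x * re y.
Proof. by case: x => a b; case: y. Qed.

(* The columns of rR + i rI are right eigenvectors of [S], for the eigenvalues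
   i om, and qR + i qI is the inverse matrix. *)
Lemma imaginary_modes n (S : 'M[R]_n) : diagonalizable (toC S) ->
  (forall x : R[i], eigenvalue (toC S) x -> re x = 0) ->
  exists (rR rI qR qI : 'M[R]_n) (om : 'I_n -> R),
  [/\ forall j k, (S *m rR) j k = - om k * rI j k,
      forall j k, (S *m rI) j k = om k * rR j k
    & rR *m qR - rI *m qI = 1%:M].
Proof.
move=> [P uP /diagonalizable_forPex[D /(simmxP uP) E]] ev.
pose r := invmx P.
have rE : toC S *m r = r *m diag_mx D.
  by rewrite -[LHS](mulKmx uP) (mulmxA P) E -mulmxA mulmxV// mulmx1.
(* The rows of P are eigenvectors in the row vector convention of [eigenvalue]; they are nonzero
   because P is invertible. *)
have D0 k : re (D 0 k) = 0.
  apply: ev; apply/eigenvalueP; exists (row k P).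
    rewrite -row_mul E; apply/rowP => j; rewrite !mxE (bigD1 k)//= big1.
      by rewrite !mxE eqxx mulr1n addr0.
    by move=> i ik; rewrite !mxE eq_sym (negbTE ik) mulr0n mul0r.
  apply/eqP => Pk; have : row k P *m r = row k 1%:M by rewrite -row_mul mulmxV.
  rewrite Pk mul0mx => /rowP/(_ k); rewrite !mxE eqxx => /eqP.
  by rewrite eq_sym oner_eq0.
have entry j k : \sum_l (S j l)%:C * r l k = r j k * D 0 k.
  have /matrixP/(_ j k) := rE; rewrite !mxE [RHS](bigD1 k)//= [X in _ = _ + X]big1.
    rewrite !mxE eqxx mulr1n addr0 => <-; apply: eq_bigr => l _.
    by rewrite !mxE.
  by move=> i ik; rewrite !mxE (negbTE ik) mulr0n mulr0.
exists (map_mx re r), (map_mx im r), (map_mx re P), (map_mx im P), (fun k => im (D 0 k)).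
split.
- move=> j k; have := congr1 re (entry j k).
  rewrite re_sum re_mul D0 mulr0 sub0r !mxE mulNr [im (D 0 k) * _]mulrC => <-.
  by apply: eq_bigr => l _; rewrite re_mul /= mul0r subr0 !mxE.
- move=> j k; have := congr1 im (entry j k).
  rewrite im_sum im_mul D0 mulr0 addr0 !mxE [im (D 0 k) * _]mulrC => <-.
  by apply: eq_bigr => l _; rewrite im_mul /= mul0r addr0 !mxE.
- apply/matrixP => i j; have /matrixP/(_ i j)/(congr1 re) := mulVmx uP.
  rewrite !mxE re_sum => H.
  transitivity (\sum_l re (r i l * P l j)).
    rewrite -sumrB; apply: eq_bigr => l _; by rewrite re_mul !mxE.
  by rewrite H; case: (i == j).
Qed.

End Modes.

(** * Measurability of piecewise continuous functions *)

Section PiecewiseMeasurable.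
Context {R : realType}.

Lemma measurable_fun_off_seq (f : R -> R) (s : seq R) (D : set R) : measurable D ->
  measurable_fun (D `\` [set` s]) f -> measurable_fun D f.
Proof.
elim: s D => [|x s IH] D mD H.
  by move: H; rewrite set_nil setD0.
have mDx : measurable (D `\` [set x]) by apply: measurableD => //; exact: measurable_set1.
have H1 : measurable_fun (D `\` [set x]) f.
  apply: IH => //; suff -> : D `\` [set x] `\` [set` s] = D `\` [set` x :: s] by [].
  apply/seteqP; split => y /=.
    by move=> [[Dy yx] ys]; split => //; rewrite inE => /orP[/eqP|].
  move=> [Dy]; rewrite inE => /negP; rewrite negb_or => /andP[/eqP yx /negP ys].
  by split.
have -> : D = (D `\` [set x]) `|` (D `&` [set x]).
  move: {H H1 mDx} D mD => D _; apply/seteqP; split => y /=; last by move=> [[]|[]].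
  move=> Dy; have [yx|/eqP yx] := eqVneq y x; [by right|by left].
apply/measurable_funU => //; first by apply: measurableI => //; exact: measurable_set1.
split=> //; exact: (measurable_funS _ _ (@measurable_fun_set1 _ _ _ _ x f)).
Qed.

Lemma piecewise_measurable (f : R -> R) : piecewise_continuous01 f ->
  measurable_fun (`[0, 1] : set R) f.
Proof.
move=> [[s H] _ _]; apply: (@measurable_fun_off_seq _ s) => //.
have mD : measurable (`[0, 1]%classic `\` [set` s] : set R).
  apply: measurableD => //; elim: s {H} => [|x s IH]; first by rewrite set_nil.
  have -> : [set` x :: s] = [set x] `|` [set` s].
    apply/seteqP; split => y /=; rewrite inE; first by move=> /orP[/eqP|]; [left|right].
    by move=> [->|h]; rewrite ?eqxx ?h ?orbT.
  by apply: measurableU => //; exact: measurable_set1.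
apply: subspace_continuous_measurable_fun => //.
apply/subspace_continuousP => x [x01 xs].
have x01' : 0 <= x <= 1 by move: x01; rewrite /= in_itv.
move=> B hB; have := H x x01' (introN idP xs) B hB => h.
have {}h : \forall y \near x, `[0, 1]%classic y -> B (f y) by exact: h.
change (\forall y \near x, (`[0, 1]%classic `\` [set` s]) y -> B (f y)).
near=> y; move=> [y01 _]; move: y01; near: y; exact: h.
Unshelve. all: by end_near. Qed.

End PiecewiseMeasurable.

(** * Boundedness of gamma *)

Section GammaBound.
Context {R : realType} (A : agent R) (alpha tb mu : R) (p pz ps : R -> R -> R -> R).
Variable To : (R -> R) -> R -> R -> R.
Variables gam gamz gamzz : R -> R -> 'cV[R]_(ag_nv A).
Hypotheses (std : standing A alpha tb) (SK : strong_kernel A alpha tb mu p pz ps).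
Hypotheses (HTo : is_To tb p To) (mu0 : 0 < mu).
Hypothesis Hgam : gamma_solution tb mu p To gam gamz gamzz.
Implicit Types (t z s : R) (f : R -> R).
Local Notation P := (kernel_at p).
Local Notation lam := (ag_lam A).
Local Notation hbar := (hbar1 A p To).

Lemma gevrey_bound f : gevrey alpha tb f -> exists M, forall t, tb < t -> `|f t| <= M.
Proof. by move=> [M [r [_ _ H]]]; exists M => t tt; case: (gevrey_bounds H tt). Qed.

Lemma disturbance_bound : exists2 T, 0 <= T &
  forall t, tb < t -> forall j, [/\ `|tg2 A t 0 j| <= T, `|tg3 A t 0 j| <= T
    & forall z, 0 <= z <= 1 -> `|tg1 A z t 0 j| <= T].
Proof.
have [_ [[_ _ _ G1 G23] _]] := std.
have [M2 M20 B2] : exists2 M, 0 <= M & forall k t, tb < t -> `|ag_g2 A t k 0| <= M.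
  apply: (@finite_bound _ _ _ (fun k t => ag_g2 A t k 0) (fun t => tb < t)) => k.
  by have [+ _] := G23 k; exact: gevrey_bound.
have [M3 M30 B3] : exists2 M, 0 <= M & forall k t, tb < t -> `|ag_g3 A t k 0| <= M.
  apply: (@finite_bound _ _ _ (fun k t => ag_g3 A t k 0) (fun t => tb < t)) => k.
  by have [_ +] := G23 k; exact: gevrey_bound.
have [M1 M10 B1] : exists2 M, 0 <= M & forall k (w : R * R), tb < w.2 /\ 0 <= w.1 <= 1 ->
    `|ag_g1 A w.1 w.2 k 0| <= M.
  apply: (@finite_bound _ _ _ (fun k w => ag_g1 A w.1 w.2 k 0) (fun w => tb < w.2 /\ 0 <= w.1 <= 1)) => k.
  have [_ [M [r [_ _ H]]]] := G1 k; exists M => -[z t] [tt z01].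
  have zin : `[0, 1]%classic z by rewrite /= in_itv.
  by case: (gevrey_bounds (H z zin) tt).
pose N := Num.max (mx_norm (ag_P A)) 0; pose M := M1 + M2 + M3.
have m1 : M1 <= M by rewrite /M; lra.
have m2 : M2 <= M by rewrite /M; lra.
have m3 : M3 <= M by rewrite /M; lra.
have BP k j : `|ag_P A k j| <= N by rewrite /N le_max mx_norm_entry.
exists ((ag_ng A)%:R * (M * N)).
  have N0 : 0 <= N by rewrite /N le_max lexx orbT.
  have M0 : 0 <= M by rewrite /M !addr_ge0.
  by rewrite mulr_ge0// mulr_ge0.
move=> t tt j; split=> [||z z01]; apply: mulmx_bound => // k l; rewrite mxE ord1.
- exact: le_trans (B2 _ _ tt) m2.
- exact: le_trans (B3 _ _ tt) m3.
- exact: le_trans (B1 _ (z, t) (conj tt z01)) m1.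
Qed.

Lemma tg1_L2 t j : tb < t -> L2 (fun z => tg1 A z t 0 j).
Proof.
move=> tt; have [T T0 BT] := disturbance_bound.
have [_ [[_ _ _ G1 _] _]] := std.
apply: (@L2_ext _ (fun z => \sum_k ag_P A k j * ag_g1 A z t k 0)).
  by move=> z _; rewrite mxE; apply: eq_bigr => k _; rewrite mxE mulrC.
apply: (@L2_lincomb _ _ (ag_P A ^~ j) (fun k z => ag_g1 A z t k 0)) => k.
have [Gc [M [r [_ _ H]]]] := G1 k.
apply: (@L2_bounded _ M); first exact: piecewise_measurable (Gc t tt).
move=> z z01; have zin : `[0, 1]%classic z by rewrite /= in_itv.
by case: (gevrey_bounds (H z zin) tt).
Qed.

Lemma kernel_boundary_L2 t : tb < t -> L2 (fun y => p y 1 t).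
Proof.
move=> tt; apply: (@L2_ext _ (fun y => P t y 1)).
  by move=> y /andP[y0 y1]; rewrite kernel_atE.
by apply: L2_cont; apply: continuous_subspaceT; exact: ker_col (ker_P SK tt).
Qed.

Lemma hbarE t z j : hbar z t 0 j =
  To (fun y => tg1 A y t 0 j) t z + (lam * tg3 A t 0 j) * To (fun y => p y 1 t) t z.
Proof. by rewrite mxE; congr (_ + _); ring. Qed.

Lemma hbar_L2 t j : tb < t -> L2 (fun z => hbar z t 0 j).
Proof.
move=> tt; apply: (@L2_ext _ (fun z => To (fun y => tg1 A y t 0 j) t z
  + (lam * tg3 A t 0 j) * To (fun y => p y 1 t) t z)); first by move=> z _; rewrite hbarE.
have [L1 _] := ToP HTo tt (tg1_L2 j tt); have [L2' _] := ToP HTo tt (kernel_boundary_L2 tt).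
by apply: L2D => //; exact: L2Z.
Qed.

(** This identity explains the form of hbar: its second term reproduces lam p(z, 1) tg3, the
    boundary term that the backstepping commutator leaves at the end point 1. *)
Lemma hbar_volterra t j z : tb < t -> 0 <= z <= 1 ->
  hbar z t 0 j - volterra (P t) (fun y => hbar y t 0 j) z =
  tg1 A z t 0 j + lam * P t z 1 * tg3 A t 0 j.
Proof.
move=> tt z01; have /andP[z0 z1] := z01.
have [L1 E1] := ToP HTo tt (tg1_L2 j tt); have [L2' E2] := ToP HTo tt (kernel_boundary_L2 tt).
have kP := ker_P SK tt.
have i1 := L2_intg L1; have i2 := L2_intg L2'.
have -> : volterra (P t) (fun y => hbar y t 0 j) z =
  volterra (P t) (fun y => To (fun y => tg1 A y t 0 j) t y + (lam * tg3 A t 0 j) * To (fun y => p y 1 t) t y) z.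
  by apply: volterra_ext => // y _; exact: hbarE.
rewrite volterraD//; last exact: intgZ.
rewrite volterraZ// hbarE; have e1 := E1 z z01; have e2 := E2 z z01.
have Pz1 : P t z 1 = p z 1 t by rewrite kernel_atE.
rewrite Pz1 -e1 -e2; ring.
Qed.

Lemma hbar_bound : exists2 H, 0 <= H & forall t, tb < t -> forall j,
  normL2 (fun z => hbar z t 0 j) <= H.
Proof.
have [T T0 BT] := disturbance_bound; have [C C0 BC] := To_bounded SK HTo.
have [M [N [M0 _ BM _]]] := kernel_bounds SK.
have l0 := lam_gt0 std.
exists (C * T + (lam * T) * (C * M)).
  by rewrite addr_ge0 ?mulr_ge0// ltW.
move=> t tt j; have [B2 B3 B1] := BT t tt j.
have Lg := tg1_L2 j tt; have Lp := kernel_boundary_L2 tt.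
have [L1 _] := ToP HTo tt Lg; have [L2' _] := ToP HTo tt Lp.
rewrite (@normL2_ext _ _ (fun z => To (fun y => tg1 A y t 0 j) t z
  + (lam * tg3 A t 0 j) * To (fun y => p y 1 t) t z)); last by move=> z _; rewrite hbarE.
apply: (le_trans (normL2D L1 (L2Z _ L2'))); rewrite normL2Z//; apply: lerD.
  by apply: (le_trans (BC _ _ tt Lg)); apply: ler_wpM2l => //; exact: normL2_bd.
apply: ler_pM => //; first exact: normL2_ge0.
  by rewrite normrM gtr0_norm// ler_wpM2l// ltW.
apply: (le_trans (BC _ _ tt Lp)); apply: ler_wpM2l => //; apply: normL2_bd => // y /andP[y0 y1].
have := BM t tt y 1; rewrite kernel_atE; last by split; [|split].
by case.
Qed.

Lemma gamma_H2 t j : tb < t -> [/\ prim (fun z => gam z t j 0) (fun z => gamz z t j 0),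
  prim (fun z => gamz z t j 0) (fun z => gamzz z t j 0) & L2 (fun z => gamzz z t j 0)].
Proof.
by move=> tt; have [/(_ j)[_ _ H _ _] _ _ _] := Hgam; have [? ? ?] := H2_prim (H t tt).
Qed.

Definition gamma_dt t j z := lam * gamzz z t j 0 - mu * gam z t j 0
  - \sum_k gam z t k 0 * ag_S A k j + hbar z t 0 j.

Lemma gamma_derive t j : tb < t -> L2_derive (fun z s => gam z s j 0) t (gamma_dt t j).
Proof.
move=> tt; have [/(_ j)[_ _ _ H _] _ _ _] := Hgam; have [L c] := H t tt.
have E z : gamma_dt t j z = (lam *: (gamzz z t)^T - mu *: (gam z t)^T - (gam z t)^T *m ag_S A
    + hbar z t) 0 j.
  rewrite /gamma_dt !mxE; congr (_ - _ + _).
  by apply: eq_bigr => k _; rewrite mxE.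
by have -> : gamma_dt t j = fun z => (lam *: (gamzz z t)^T - mu *: (gam z t)^T - (gam z t)^T *m ag_S A
    + hbar z t) 0 j by apply/funext => z; exact: E.
Qed.

Lemma gamma_L2 t j : tb < t -> L2 (fun z => gam z t j 0).
Proof. by move=> tt; have [h _ _] := gamma_H2 j tt; exact: prim_L2 h. Qed.

Lemma gamma_near_L2 t j : tb < t -> \forall s \near t, L2 (fun z => gam z s j 0).
Proof. by move=> tt; have := near_gt tt; apply: filterS => s; exact: gamma_L2. Qed.

Lemma gamma_bc t j : tb < t -> gamz 0 t j 0 = tg2 A t 0 j /\ gamz 1 t j 0 = tg3 A t 0 j.
Proof.
move=> tt; have [_ /(_ t tt)[e0 e1] _ _] := Hgam.
by split; [rewrite -e0 mxE|rewrite -e1 mxE].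
Qed.

Lemma gamma_combination_derive (c : 'I_(ag_nv A) -> R) t : tb < t ->
  L2_derive (fun z s => \sum_j c j * gam z s j 0) t (fun z => \sum_j c j * gamma_dt t j z).
Proof.
move=> tt; have dc i : is_derive t 1 (fun _ : R => c i) 0 by exact: is_derive_cst.
have := @L2_derive_lincomb _ _ (fun j _ => c j) (fun=> 0) (fun j z s => gam z s j 0)
  (gamma_dt t) t (fun j => gamma_near_L2 j tt) (fun j => gamma_derive j tt) dc.
apply: L2_derive_ext.
- by near=> s.
- by move=> z _; apply: eq_bigr => j _; rewrite mul0r addr0.
Unshelve. all: by end_near. Qed.

Lemma gamma_combination_dtE (c : 'I_(ag_nv A) -> R) t z : \sum_j c j * gamma_dt t j z =
  lam * (\sum_j c j * gamzz z t j 0) - mu * (\sum_j c j * gam z t j 0)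
  - (\sum_k (\sum_j ag_S A k j * c j) * gam z t k 0) + \sum_j c j * hbar z t 0 j.
Proof.
rewrite !mulr_sumr -sumrB.
have -> : \sum_k (\sum_j ag_S A k j * c j) * gam z t k 0 =
    \sum_j \sum_k c j * (gam z t k 0 * ag_S A k j).
  rewrite exchange_big; apply: eq_bigr => k _; rewrite mulr_suml; apply: eq_bigr => j _.
  by ring.
rewrite -sumrB -big_split/=; apply: eq_bigr => j _; rewrite /gamma_dt -mulr_sumr.
by ring.
Qed.

Lemma gamma_bounded : exists2 G, 0 <= G & forall t, tb < t -> forall j,
  normL2 (fun z => gam z t j 0) <= G.
Proof.
have [_ [_ [_ diag ev]]] := std.
have [rR [rI [qR [qI [om [SR SI inv]]]]]] := imaginary_modes diag ev.
have [T T0 BT] := disturbance_bound; have [H H0 BH] := hbar_bound.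
have l0 := lam_gt0 std.
(* Pairing gamma with column k of [rR] and of [rI] gives the real and the imaginary part of the k-th
   mode, which rotate into each other with frequency [om k]. *)
pose y (r : 'M[R]_(ag_nv A)) k z t := \sum_j r j k * gam z t j 0.
pose yz (r : 'M[R]_(ag_nv A)) k z t := \sum_j r j k * gamz z t j 0.
pose yzz (r : 'M[R]_(ag_nv A)) k z t := \sum_j r j k * gamzz z t j 0.
pose h (r : 'M[R]_(ag_nv A)) k z t := \sum_j r j k * hbar z t 0 j.
have yP r k t : tb < t -> [/\ prim ((y r k)^~ t) ((yz r k)^~ t),
    prim ((yz r k)^~ t) ((yzz r k)^~ t) & L2 ((yzz r k)^~ t)].
  move=> tt; split.
  - by apply: (@prim_lincomb _ _ (r^~ k) (fun j z => gam z t j 0) (fun j z => gamz z t j 0)) => j; case: (gamma_H2 j tt).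
  - by apply: (@prim_lincomb _ _ (r^~ k) (fun j z => gamz z t j 0) (fun j z => gamzz z t j 0)) => j; case: (gamma_H2 j tt).
  - by apply: (@L2_lincomb _ _ (r^~ k) (fun j z => gamzz z t j 0)) => j; case: (gamma_H2 j tt).
pose n1 (r : 'M[R]_(ag_nv A)) k := \sum_j `|r j k|.
have n10 r k : 0 <= n1 r k by exact: sumr_ge0.
have hP r k t : tb < t -> L2 ((h r k)^~ t) /\ normL2 ((h r k)^~ t) <= n1 r k * H.
  move=> tt; have Lh j := hbar_L2 j tt; split.
    exact: (@L2_lincomb _ _ (r^~ k) (fun j z => hbar z t 0 j)).
  apply: (le_trans (@normL2_lincomb _ _ (r^~ k) (fun j z => hbar z t 0 j) Lh)).
  rewrite mulr_suml; apply: ler_sum => j _; apply: ler_wpM2l => //; exact: BH.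
have gP r k t : tb < t -> `|yz r k 0 t| <= n1 r k * T /\ `|yz r k 1 t| <= n1 r k * T.
  move=> tt; split; apply: (le_trans (ler_norm_sum _ _ _)); rewrite mulr_suml;
    apply: ler_sum => j _; rewrite normrM; apply: ler_wpM2l => //;
    have [e0 e1] := gamma_bc j tt; have [b2 b3 _] := BT t tt j.
    by rewrite e0.
  by rewrite e1.
have dy r k t : tb < t -> L2_derive (y r k) t (fun z => lam * yzz r k z t - mu * y r k z t
    - (\sum_l (\sum_j ag_S A l j * r j k) * gam z t l 0) + h r k z t).
  move=> tt; have := gamma_combination_derive (r^~ k) tt; apply: L2_derive_ext.
    by near=> s.
  by move=> z _; rewrite gamma_combination_dtE.
have nb r k : exists B, \forall s \near tb^'+, normL2 ((y r k)^~ s) <= B.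
  have [ev' _ _ _] := Hgam.
  have /choice[B HB] j := evolution_right_bounded (ev' j).
  exists (\sum_j `|r j k| * B j).
  have HBA : \forall s \near tb^'+, forall j, normL2 (fun z => gam z s j 0) <= B j.
    exact: (@filter_forall _ _ (fun j s => normL2 (fun z => gam z s j 0) <= B j) _ _ HB).
  near=> s; have s0 : tb < s by near: s; exact: nbhs_right_gt.
  have hs : forall j, normL2 (fun z => gam z s j 0) <= B j by near: s.
  apply: (le_trans (@normL2_lincomb _ _ (r^~ k) (fun j z => gam z s j 0) (fun j => gamma_L2 j s0))).
  by apply: ler_sum => j _; exact: ler_wpM2l.
have mode k : exists C, forall t, tb < t -> normL2 ((y rR k)^~ t) <= C /\ normL2 ((y rI k)^~ t) <= C.
  pose m := n1 rR k + n1 rI k.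
  have [BR HR] := nb rR k; have [BI HI] := nb rI k.
  have mR x : 0 <= x -> n1 rR k * x <= m * x by move=> x0; apply: ler_wpM2r => //; rewrite lerDl.
  have mI x : 0 <= x -> n1 rI k * x <= m * x by move=> x0; apply: ler_wpM2r => //; rewrite lerDr.
  have m0 : 0 <= m by exact: addr_ge0.
  apply: (@damped_pair_bound _ tb lam mu (m * T) (m * H) (om k) (y rR k) (yz rR k) (yzz rR k) (h rR k)
     (y rI k) (yz rI k) (yzz rI k) (h rI k)); rewrite ?mulr_ge0//; try exact: yP.
  - move=> t tt; have [a1 a2] := hP rR k t tt; have [b1 b2] := hP rI k t tt.
    by split => //; [exact: le_trans a2 (mR _ H0)|exact: le_trans b2 (mI _ H0)].
  - move=> t tt; have [a1 a2] := gP rR k t tt; have [b1 b2] := gP rI k t tt.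
    by split; [exact: le_trans a1 (mR _ T0)|exact: le_trans a2 (mR _ T0)
      |exact: le_trans b1 (mI _ T0)|exact: le_trans b2 (mI _ T0)].
  - move=> t tt; apply: (L2_derive_ext _ _ (dy rR k t tt)); first by near=> s.
    move=> z _; congr (_ + _); congr (_ + _); rewrite /y -sumrN mulr_sumr; apply: eq_bigr => j _.
    by have := SR j k; rewrite mxE => ->; ring.
  - move=> t tt; apply: (L2_derive_ext _ _ (dy rI k t tt)); first by near=> s.
    move=> z _; congr (_ + _); congr (_ + _); rewrite /y -sumrN mulr_sumr; apply: eq_bigr => j _.
    by have := SI j k; rewrite mxE => ->; ring.
  - exists (Num.max BR BI); near=> s; split; rewrite le_max; apply/orP.
      by left; near: s; exact: HR.
    by right; near: s; exact: HI.
have /choice[C HC] := mode.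
have C0 k : 0 <= C k.
  have tt : tb < tb + 1 by rewrite ltrDl.
  by have [+ _] := HC k _ tt; apply: le_trans; exact: normL2_ge0.
exists (\sum_j \sum_k (`|qR k j| * C k + `|qI k j| * C k)).
  by apply: sumr_ge0 => j _; apply: sumr_ge0 => k _; rewrite addr_ge0 ?mulr_ge0.
move=> t tt j.
(* The real part of the relation between the eigenvectors and their inverse matrix recovers gamma
   from its modes. *)
have E z : gam z t j 0 = \sum_k qR k j * y rR k z t + \sum_k (- qI k j) * y rI k z t.
  have : ((gam z t)^T *m (rR *m qR - rI *m qI)) 0 j = gam z t j 0 by rewrite inv mulmx1 mxE.
  rewrite mulmxBr !mulmxA !mxE => <-; rewrite -sumrN; congr (_ + _); apply: eq_bigr => k _;
    rewrite /y !mxE; last first.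
    rewrite mulrC mulNr; congr (- (_ * _)).
    by apply: eq_bigr => l _; rewrite mxE mulrC.
  by rewrite mulrC; congr (_ * _); apply: eq_bigr => l _; rewrite mxE mulrC.
have LR k : L2 ((y rR k)^~ t) by have [h1 _ _] := yP rR k t tt; exact: prim_L2 h1.
have LI k : L2 ((y rI k)^~ t) by have [h1 _ _] := yP rI k t tt; exact: prim_L2 h1.
rewrite (@normL2_ext _ _ (fun z => \sum_k qR k j * y rR k z t + \sum_k (- qI k j) * y rI k z t)); last by move=> z _; exact: E.
rewrite (bigD1 j)//=.
apply: (@le_trans _ _ (\sum_k (`|qR k j| * C k + `|qI k j| * C k))); last first.
  rewrite lerDl; apply: sumr_ge0 => l _; apply: sumr_ge0 => k _.
  by rewrite addr_ge0 ?mulr_ge0.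
apply: (le_trans (normL2D (@L2_lincomb _ _ (fun k => qR k j) (fun k z => y rR k z t) LR)
   (@L2_lincomb _ _ (fun k => - qI k j) (fun k z => y rI k z t) LI))).
rewrite big_split/=; apply: lerD.
  apply: (le_trans (@normL2_lincomb _ _ (fun k => qR k j) (fun k z => y rR k z t) LR)).
  by apply: ler_sum => k _; apply: ler_wpM2l => //; case: (HC k t tt).
apply: (le_trans (@normL2_lincomb _ _ (fun k => - qI k j) (fun k z => y rI k z t) LI)).
by apply: ler_sum => k _; rewrite normrN; apply: ler_wpM2l => //; case: (HC k t tt).
Unshelve. all: by end_near. Qed.

End GammaBound.

(** * The error system in backstepping coordinates *)

Section ErrorSystem.
Context {R : realType} (A : agent R) (alpha tb mu : R) (p pz ps : R -> R -> R -> R).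
Variable To : (R -> R) -> R -> R -> R.
Variables (gam gamz gamzz : R -> R -> 'cV[R]_(ag_nv A)) (lv : R -> 'cV[R]_(ag_nv A)).
Hypotheses (std : standing A alpha tb) (SK : strong_kernel A alpha tb mu p pz ps).
Hypotheses (HTo : is_To tb p To) (Hgam : gamma_solution tb mu p To gam gamz gamzz).
Implicit Types (t z s : R) (f : R -> R).
Local Notation P := (kernel_at p).
Local Notation lam := (ag_lam A).
Local Notation c := (ag_c A).
Local Notation hbar := (hbar1 A p To).

(* Satisfied by the real and by the imaginary part of the observer error. *)
Definition error_solution (t0 : R) (lx : R -> R -> R) (l1 : R -> R) (ev : R -> 'cV[R]_(ag_nv A))
    (ex exz exzz : R -> R -> R) : Prop :=
  [/\ forall t, t0 < t -> derive_mx t ev (ag_S A *m ev t - (c * ex 1 t) *: lv t),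
      forall j, ev s j 0 @[s --> t0^'+] --> ev t0 j 0,
      evolution t0 ex exz exzz (fun z t => lam * exzz z t + ag_a A z t * ex z t
        + (tg1 A z t *m ev t) 0 0 - lx z t * (c * ex 1 t)),
      forall t, t0 < t -> exz 0 t = ag_q A t * ex 0 t + (tg2 A t *m ev t) 0 0
    & forall t, t0 < t -> exz 1 t = (tg3 A t *m ev t) 0 0 - l1 t * (c * ex 1 t)].

Variables (t0 : R) (ev : R -> 'cV[R]_(ag_nv A)) (ex exz exzz : R -> R -> R).
Hypothesis tb0 : tb <= t0.
Hypothesis sol : error_solution t0 (gain_lx p ps gam lv) (gain_l1 A p) ev ex exz exzz.

Let tbt t : t0 < t -> tb < t. Proof. exact: le_lt_trans. Qed.

Definition back z t := To (ex^~ t) t z.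
Definition back1 z t := bs_w1 (P t) (kernel_at pz t) (exz^~ t) (back^~ t) z.
Definition back2 z t := bs_w2 (P t) (kernel_at pz t) (kernel_at (kernel_dt p) t) (kernel_at ps t)
  (coef_a A t) lam mu (exz^~ t) (exzz^~ t) (back^~ t) z.

Lemma error_H2 t : t0 < t -> [/\ L2 (exzz^~ t), prim (exz^~ t) (exzz^~ t) & prim (ex^~ t) (exz^~ t)].
Proof. by move=> tt; have [_ _ [_ _ H _ _] _ _] := sol; exact: H2_prim (H t tt). Qed.

Lemma back_L2 t : t0 < t -> L2 (back^~ t).
Proof.
by move=> tt; have [_ _ /prim_L2 L] := error_H2 tt; have [] := ToP HTo (tbt tt) L.
Qed.

Lemma backE t z : t0 < t -> 0 <= z <= 1 ->
  back z t - volterra (P t) (back^~ t) z = ex z t.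
Proof.
move=> tt; have [_ _ /prim_L2 L] := error_H2 tt.
by have [_] := ToP HTo (tbt tt) L; exact.
Qed.

(** The Volterra integral vanishes at z = 1, so the transformation leaves the output error
    unchanged. *)
Lemma back_one t : t0 < t -> ex 1 t = back 1 t.
Proof. by move=> tt; rewrite -backE ?lexx ?ler01// volterra1 subr0. Qed.

Lemma back_prim t : t0 < t -> [/\ prim (back^~ t) (back1^~ t), prim (back1^~ t) (back2^~ t),
  {within `[0, 1], continuous (back1^~ t)} & L2 (back2^~ t)].
Proof.
move=> tt; have t1 := tbt tt; have [Lzz p2 p1] := error_H2 tt.
have kP := ker_P SK t1; have kz := ker_Pz SK t1; have kt := ker_Pt SK t1; have ks := ker_Ps SK t1.
have ca := coef_a_cont std t1; have iw := L2_intg (back_L2 tt).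
have wE z := fun z01 => @backE t z tt z01.
have l0 : lam != 0 by rewrite gt_eqF// (lam_gt0 std).
have lz := kernel_line_z SK t1; have ls := kernel_line_s SK t1.
have ld := kernel_line_diag std SK t1; have pd := kernel_diag std SK t1.
split.
- exact: (backstepping_prim kP kz lz p1 iw wE).
- exact: (backstepping_prim2 kP kz ks kt ca l0 lz ls ld pd p1 p2 iw wE).
- exact: (backstepping_cont1 kP kz lz p1 p2 iw wE).
- apply: L2D => //; apply: L2_cont.
  have cq := @backstepping_q2_cont _ _ _ _ _ _ lam mu kP kz ks kt ca lz _ _ _ _ p1 p2 iw wE.
  exact: cq.
Qed.

Lemma back_commutator t z : t0 < t -> 0 <= z <= 1 ->
  lam * exzz z t + ag_a A z t * ex z t + volterra (kernel_at (kernel_dt p) t) (back^~ t) z =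
  (lam * back2 z t - mu * back z t) - volterra (P t) (fun x => lam * back2 x t - mu * back x t) z
  - lam * ps z 1 t * back 1 t + lam * P t z 1 * back1 1 t.
Proof.
move=> tt z01; have t1 := tbt tt; have [Lzz p2 p1] := error_H2 tt; have [_ _ _ /L2_intg i2] := back_prim tt.
have kP := ker_P SK t1; have kz := ker_Pz SK t1; have kt := ker_Pt SK t1; have ks := ker_Ps SK t1.
have ca := coef_a_cont std t1; have iw := L2_intg (back_L2 tt).
have wE y := fun y01 => @backE t y tt y01.
have l0 : lam != 0 by rewrite gt_eqF// (lam_gt0 std).
have lz := kernel_line_z SK t1; have ls := kernel_line_s SK t1.
have ld := kernel_line_diag std SK t1; have pd := kernel_diag std SK t1.
have := backstepping_commutator kP kz ks kt ca l0 lz ls ld pd p1 p2 iw wE i2 z01.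
have -> : coef_a A t z = ag_a A z t by rewrite /coef_a/= clampE.
have -> : kernel_at ps t z 1 = ps z 1 t.
  by have /andP[z0 z1] := z01; rewrite kernel_atE.
by [].
Qed.

(** The kernel conditions p(0, 0) = q and p_z(0, .) = q p(0, .) remove the Robin term. *)
Lemma back1_zero t : t0 < t -> back1 0 t = (tg2 A t *m ev t) 0 0.
Proof.
move=> tt; have t1 := tbt tt; have [_ _ _ E _] := sol; have iw := L2_intg (back_L2 tt).
have z01 : 0 <= (0 : R) <= 1 by rewrite lexx ler01.
rewrite /back1 /bs_w1 E// -(backE tt z01) (kernel_corner SK t1).
have -> : volterra (kernel_at pz t) (back^~ t) 0 = ag_q A t * volterra (P t) (back^~ t) 0.
  rewrite -(volterra_kZ (fun=> ag_q A t) (ker_P SK t1) iw)//.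
  by apply: ig_ext => s s01; rewrite (kernel_bc SK t1).
ring.
Qed.

(** The choice of l_1 cancels the contribution p(1, 1) w(1) that the transformation produces. *)
Lemma back1_one t : t0 < t -> back1 1 t = (tg3 A t *m ev t) 0 0.
Proof.
move=> tt; have [_ _ _ _ E] := sol; have [[_ _ c0] _] := std.
rewrite /back1 /bs_w1 volterra1 E// (back_one tt) /gain_l1 kernel_atE; last by split; [exact: ler01|split].
by field.
Qed.

Definition back_dt t z := lam * back2 z t - mu * back z t
  - (c * back 1 t) * (\sum_j lv t j 0 * gam z t j 0) + \sum_j ev t j 0 * hbar z t 0 j.

Lemma back_dt_L2 t : t0 < t -> L2 (back_dt t).
Proof.
move=> tt; have t1 := tbt tt; have [_ _ _ i2] := back_prim tt.
apply: L2D; last by apply: (@L2_lincomb _ _ (fun j => ev t j 0) (fun j z => hbar z t 0 j)) => j; exact: (hbar_L2 std SK HTo).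
apply: L2B; first by apply: L2B; [exact: L2Z|apply: L2Z; exact: back_L2].
by apply: L2Z; apply: (@L2_lincomb _ _ (fun j => lv t j 0) (fun j z => gam z t j 0)) => j; exact: (gamma_L2 Hgam).
Qed.

Lemma volterra_lincomb k n (d : 'I_n -> R) (f : 'I_n -> R -> R) z : ker k -> (forall j, intg 0 1 (f j)) ->
  0 <= z -> volterra k (fun x => \sum_j d j * f j x) z = \sum_j d j * volterra k (f j) z.
Proof.
move=> kk jf z0; elim: n d f jf => [|n IH] d f jf.
  rewrite big_ord0; transitivity (volterra k (fun _ : R => 0 * (0 : R)) z).
    by congr volterra; apply/funext => x; rewrite big_ord0 mul0r.
  by rewrite volterraZ ?mul0r//; exact: intg_cst.
rewrite big_ord_recr/=.
rewrite -(IH (fun j => d (widen_ord (leqnSn n) j)) (fun j => f (widen_ord (leqnSn n) j)))//.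
rewrite -volterraZ// -volterraD//; last 2 first.
- by apply: intg_sum => j; exact: intgZ.
- exact: intgZ.
by congr volterra; apply/funext => x; rewrite big_ord_recr.
Qed.

(** Differentiating w - V w = e_x in time gives the Volterra equation that identifies [back_dt] as
    w_t. The three parts match separately: [v1] by the commutator, [v2] by the definition of l_x,
    [v3] by [hbar_volterra]. *)
Lemma back_dtE t z : t0 < t -> 0 <= z <= 1 ->
  back_dt t z - volterra (P t) (back_dt t) z =
  (lam * exzz z t + ag_a A z t * ex z t + (tg1 A z t *m ev t) 0 0
    - gain_lx p ps gam lv z t * (c * ex 1 t))
  + volterra (kernel_at (kernel_dt p) t) (back^~ t) z.
Proof.
move=> tt z01; have t1 := tbt tt; have /andP[z0 z1] := z01; have kP := ker_P SK t1.
have [_ _ _ L2b] := back_prim tt; have Lb := back_L2 tt.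
have [[_ _ c0] _] := std.
pose v1 x := lam * back2 x t - mu * back x t.
pose v2 x := \sum_j lv t j 0 * gam x t j 0.
pose v3 x := \sum_j ev t j 0 * hbar x t 0 j.
have i1 : intg 0 1 v1 by apply: intgB; apply: intgZ; exact: L2_intg.
have ig_ j : intg 0 1 (fun x => gam x t j 0) by apply: L2_intg; exact: (gamma_L2 Hgam).
have ih j : intg 0 1 (fun x => hbar x t 0 j) by apply: L2_intg; exact: (hbar_L2 std SK HTo).
have i2 : intg 0 1 v2 by apply: intg_sum => j; exact: intgZ.
have i3 : intg 0 1 v3 by apply: intg_sum => j; exact: intgZ.
have -> : volterra (P t) (back_dt t) z =
    volterra (P t) v1 z + (- (c * back 1 t)) * volterra (P t) v2 z + volterra (P t) v3 z.
  rewrite -volterraZ// -volterraD//; last exact: intgZ.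
  rewrite -volterraD//; last by apply: intgD => //; exact: intgZ.
  by congr volterra; apply/funext => x; rewrite /back_dt mulNr.
have E3 : v3 z - volterra (P t) v3 z =
    (tg1 A z t *m ev t) 0 0 + lam * P t z 1 * (tg3 A t *m ev t) 0 0.
  rewrite (@volterra_lincomb _ _ (fun j => ev t j 0) (fun j x => hbar x t 0 j))// /v3 -sumrB.
  rewrite !mxE mulr_sumr -big_split/=; apply: eq_bigr => j _.
  have := hbar_volterra std SK HTo j t1 z01.
  by move=> e; rewrite -mulrBr e; ring.
have El : gain_lx p ps gam lv z t = v2 z - volterra (P t) v2 z - lam / c * ps z 1 t.
  rewrite /gain_lx To_invE//; congr (_ - _ - _).
    by rewrite !mxE; apply: eq_bigr => j _; rewrite mxE mulrC.
  congr volterra; apply/funext => x.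
  by rewrite !mxE; apply: eq_bigr => j _; rewrite mxE mulrC.
have C := back_commutator tt z01.
rewrite -/v1 (back1_one tt) in C.
rewrite El (back_one tt) /back_dt -/(v1 z) -/(v2 z) -/(v3 z).
have -> : lam * exzz z t + ag_a A z t * ex z t = (v1 z - volterra (P t) v1 z
  - lam * ps z 1 t * back 1 t + lam * P t z 1 * (tg3 A t *m ev t) 0 0)
  - volterra (kernel_at (kernel_dt p) t) (back^~ t) z by rewrite -C; ring.
have -> : (tg1 A z t *m ev t) 0 0 = v3 z - volterra (P t) v3 z - lam * P t z 1 * (tg3 A t *m ev t) 0 0.
  by rewrite E3; ring.
by field.
Qed.

Lemma error_near (Q : R -> Prop) t : t0 < t -> (forall s, t0 < s -> Q s) -> \forall s \near t, Q s.
Proof. by move=> tt H; have := near_gt tt; apply: filterS. Qed.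

Lemma back_derive t : t0 < t -> L2_derive back t (back_dt t).
Proof.
move=> tt; have t1 := tbt tt.
have [M [N [M0 N0 BM BN]]] := kernel_bounds SK.
(* [L2_derive_volterra] wants a kernel at every time, while p is controlled only after tb; zero is a
   harmless value before. *)
pose K s : R -> R -> R := if tb < s then P s else fun _ _ => 0.
have KE s : tb < s -> K s = P s by rewrite /K => ->.
have [_ _ [_ _ _ D _] _ _] := sol.
apply: (@L2_derive_volterra _ K (kernel_at (kernel_dt p) t) ex back t M N _ _ _ _ _ _ _ _ _ (D t tt)).
- by move=> s; rewrite /K; case: ifP => [h|_]; [exact: (ker_P SK)|exact: ker_cst].
- move=> s x y; rewrite /K; case: ifP => [h|_]; last by rewrite normr0.
  by case: (BM s h x y).
- exact: (ker_Pt SK).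
- have := near_shift (near_gt t1) => th; near=> h => x y.
  have h0 : h != 0 by near: h; exact: nbhs_dnbhs_neq.
  have t2 : tb < t + h by near: h.
  by rewrite !KE//; exact: BN.
- by apply: error_near tt _ => s s0; have [_ _ /prim_L2] := error_H2 s0.
- by apply: error_near tt _ => s s0; exact: back_L2.
- by apply: error_near tt _ => s s0 z z01; rewrite KE ?tbt//; exact: backE.
- exact: back_dt_L2.
- by move=> z z01; rewrite KE//; exact: back_dtE.
Unshelve. all: by end_near. Qed.

Definition eps z t := back z t + \sum_j (- ev t j 0) * gam z t j 0.
Definition eps1 z t := back1 z t + \sum_j (- ev t j 0) * gamz z t j 0.
Definition eps2 z t := back2 z t + \sum_j (- ev t j 0) * gamzz z t j 0.

Lemma eps_prim t : t0 < t -> [/\ prim (eps^~ t) (eps1^~ t), prim (eps1^~ t) (eps2^~ t) & L2 (eps2^~ t)].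
Proof.
move=> tt; have t1 := tbt tt; have [p1 p2 _ Lb] := back_prim tt.
split.
- apply: primD => //; apply: (@prim_lincomb _ _ (fun j => - ev t j 0) (fun j z => gam z t j 0) (fun j z => gamz z t j 0)).
  by move=> j; case: (gamma_H2 Hgam j t1).
- apply: primD => //; apply: (@prim_lincomb _ _ (fun j => - ev t j 0) (fun j z => gamz z t j 0) (fun j z => gamzz z t j 0)).
  by move=> j; case: (gamma_H2 Hgam j t1).
- apply: L2D => //; apply: (@L2_lincomb _ _ (fun j => - ev t j 0) (fun j z => gamzz z t j 0)).
  by move=> j; case: (gamma_H2 Hgam j t1).
Qed.

Lemma eps_bc t : t0 < t -> eps1 0 t = 0 /\ eps1 1 t = 0.
Proof.
move=> tt; have t1 := tbt tt; rewrite /eps1 back1_zero// back1_one// !mxE -!big_split/=.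
by split; apply: big1 => j _; have [e0 e1] := gamma_bc Hgam j t1; rewrite ?e0 ?e1; ring.
Qed.

Lemma back_eps t : t0 < t -> back 1 t = eps 1 t + \sum_j gam 1 t j 0 * ev t j 0.
Proof.
by move=> tt; rewrite /eps -addrA -big_split/= big1 ?addr0// => j _; ring.
Qed.

(** Inserting w(1) = eps(1) + gamma(1)^T e_v into the output injection produces the closed loop
    matrix of Psi, with eps(1) as the only forcing. *)
Lemma ev_derive t : t0 < t -> derive_mx t ev
  ((ag_S A - lv t *m (c *: (gam 1 t)^T)) *m ev t + (- (c * eps 1 t)) *: lv t).
Proof.
move=> tt i j; have [E _ _ _ _] := sol; have := E t tt i j.
suff -> : (ag_S A - lv t *m (c *: (gam 1 t)^T)) *m ev t + (- (c * eps 1 t)) *: lv t =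
  ag_S A *m ev t - (c * ex 1 t) *: lv t by [].
rewrite mulmxBl -addrA; congr (_ + _); apply/esym.
rewrite (back_one tt) (back_eps tt) scaleNr -opprD; congr (- _).
rewrite mulrDr scalerDl addrC; congr (_ + _).
rewrite -mulmxA -scalemxAl -scalemxAr -scalerA; congr (_ *: _).
have -> : (gam 1 t)^T *m ev t = (\sum_j gam 1 t j 0 * ev t j 0)%:M.
  by rewrite [LHS]mx11_scalar; congr (_%:M); rewrite mxE; apply: eq_bigr => l _; rewrite mxE.
by rewrite mul_mx_scalar.
Qed.

(** Three cancellations: the hbar terms of w_t and gamma_t, the S terms of gamma_t and e_v', and the
    l_v terms of w_t and e_v'. *)
Lemma eps_derive t : t0 < t -> L2_derive eps t (fun z => lam * eps2 z t - mu * eps z t).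
Proof.
move=> tt; have t1 := tbt tt; have [E _ _ _ _] := sol.
pose dv j := (ag_S A *m ev t - (c * ex 1 t) *: lv t) j 0.
have de j : is_derive t 1 (fun s => - ev s j 0) (- dv j).
  by apply: is_deriveN; exact: E.
have D2 := @L2_derive_lincomb _ _ (fun j s => - ev s j 0) (fun j => - dv j) (fun j z s => gam z s j 0)
  (fun j => gamma_dt mu p To gam gamzz t j) t (fun j => gamma_near_L2 Hgam j t1)
  (fun j => gamma_derive Hgam j t1) de.
apply: (L2_derive_ext _ _ (L2_deriveD _ _ (back_derive tt) D2)).
- by near=> s.
- move=> z _; rewrite /back_dt /eps /eps2 big_split/=.
  rewrite (gamma_combination_dtE mu p To gam gamzz (fun j => - ev t j 0)).
  have -> : \sum_j (- dv j) * gam z t j 0 =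
      \sum_k (\sum_j ag_S A k j * (- ev t j 0)) * gam z t k 0
      + (c * back 1 t) * (\sum_j lv t j 0 * gam z t j 0).
    rewrite mulr_sumr -big_split/=; apply: eq_bigr => k _.
    rewrite /dv (back_one tt) !mxE.
    have -> : \sum_j ag_S A k j * - ev t j 0 = - \sum_j ag_S A k j * ev t j 0.
      by rewrite -sumrN; apply: eq_bigr => l _; rewrite mulrN.
    by ring.
  have -> : \sum_j (- ev t j 0) * hbar z t 0 j = - \sum_j ev t j 0 * hbar z t 0 j.
    by rewrite -sumrN; apply: eq_bigr => l _; rewrite mulNr.
  ring.
- by apply: error_near tt _ => s s0; exact: back_L2.
- apply: error_near tt _ => s s0.
  apply: (@L2_lincomb _ _ (fun j => - ev s j 0) (fun j z => gam z s j 0)) => j.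
  by apply: (gamma_L2 Hgam); exact: tbt.
Unshelve. all: by end_near. Qed.

Lemma eps_energy t : t0 < t -> is_derive t 1 (fun s => ip (eps^~ s) (eps^~ s))
  (- (2 * lam * ip (eps1^~ t) (eps1^~ t) + 2 * mu * ip (eps^~ t) (eps^~ t))).
Proof.
move=> tt; have [p1 p2 Lzz] := eps_prim tt; have L0 := prim_L2 p1.
have nL : \forall s \near t, L2 (eps^~ s).
  by apply: error_near tt _ => s s0; case: (eps_prim s0) => /prim_L2.
have := L2_derive_energy nL (eps_derive tt).
rewrite ipBr ?ipZr//; last 2 first.
- exact: L2Z.
- exact: L2Z.
rewrite (ip_energy p1 p2 Lzz); have [-> ->] := eps_bc tt.
by rewrite !mulr0 subrr sub0r => h; apply: (is_derive_eq h); ring.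
Qed.

End ErrorSystem.

(** * The exponential estimate *)

Section EstimateTools.
Context {R : realType}.
Implicit Types (s : R).

Definition norm1 (n : nat) (v : 'cV[R]_n) : R := \sum_j `|v j 0|.

Lemma norm1_ge0 (n : nat) (v : 'cV[R]_n) : 0 <= norm1 v.
Proof. exact: sumr_ge0. Qed.

Lemma norm1_entry (n : nat) (v : 'cV[R]_n) j : `|v j 0| <= norm1 v.
Proof. by rewrite /norm1 (bigD1 j)//= lerDl sumr_ge0. Qed.

Lemma is_derive_expR_affine a b s : is_derive s 1 (fun x : R => expR (a * x + b)) (a * expR (a * s + b)).
Proof.
have D : is_derive s 1 (fun x : R => a * x + b) (a + 0).
  apply: is_deriveD.
  have Di := @is_derive_id R R s 1.
  by have := is_deriveZ a Di; rewrite /GRing.scale/= mulr1.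
have := @is_derive1_comp R expR (fun x : R => a * x + b) s _ _ (is_derive_expR _) D.
by rewrite addr0 mulrC.
Qed.

(* AM-GM: the first term of the bound is integrable in time against
   exp(- al (t - s0)) because mu != muv, the second is paid by the dissipation [D]. *)
Lemma energy_split (kk e m a r E D : R) : 0 <= kk -> kk <= e -> 0 <= m -> 0 <= a -> 0 < r -> 0 <= D ->
  a ^+ 2 <= 2 * E + 2 * D -> E * m ^+ 2 <= r ^+ 2 ->
  kk * m * a <= 3 / 2 * r * kk + e / r * (D * m ^+ 2).
Proof.
move=> kk0 ke m0 a0 r0 D0 aED Er.
have h1 : m * a <= 3 / 2 * r + D * m ^+ 2 / r.
  have h2 : (m * a) ^+ 2 <= 2 * r ^+ 2 + 2 * (D * m ^+ 2).
    rewrite exprMn; have := ler_wpM2l (sqr_ge0 m) aED; rewrite expr2 in Er *; lra.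
  have h3 : m * a <= (r + (m * a) ^+ 2 / r) / 2.
    have : 0 <= (r - m * a) ^+ 2 / r by rewrite divr_ge0 ?sqr_ge0// ltW.
    have -> : (r - m * a) ^+ 2 / r = r - 2 * (m * a) + (m * a) ^+ 2 / r by field; rewrite gt_eqF.
    lra.
  have h4 : (m * a) ^+ 2 / r <= (2 * r ^+ 2 + 2 * (D * m ^+ 2)) / r.
    by rewrite ler_wpM2r// invr_ge0 ltW.
  have h5 : (2 * r ^+ 2 + 2 * (D * m ^+ 2)) / r = 2 * r + 2 * (D * m ^+ 2 / r).
    by field; rewrite gt_eqF.
  lra.
have h2 : kk * (D * m ^+ 2 / r) <= e * (D * m ^+ 2 / r).
  by apply: ler_wpM2r => //; rewrite divr_ge0 ?mulr_ge0 ?sqr_ge0// ltW.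
have := ler_wpM2l kk0 h1.
have -> : e / r * (D * m ^+ 2) = e * (D * m ^+ 2 / r) by ring.
lra.
Qed.

End EstimateTools.

Section Estimate.
Context {R : realType} (A : agent R) (alpha tb mu : R) (p pz ps : R -> R -> R -> R).
Variable To : (R -> R) -> R -> R -> R.
Variables (gam gamz gamzz : R -> R -> 'cV[R]_(ag_nv A)) (lv : R -> 'cV[R]_(ag_nv A)).
Variables (Psi : R -> R -> 'M[R]_(ag_nv A)) (muv : R).
Hypotheses (std : standing A alpha tb) (SK : strong_kernel A alpha tb mu p pz ps).
Hypotheses (HTo : is_To tb p To) (Hgam : gamma_solution tb mu p To gam gamz gamzz).
Hypothesis lv_bounded : exists B, forall t, tb < t -> forall k, `|lv t k 0| <= B.
Hypothesis fund : fundamental_matrix tb (fun t => ag_S A - lv t *m (ag_c A *: (gam 1 t)^T)) Psi.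
Hypothesis expb : exp_bounded tb muv Psi.
Hypotheses (mu0 : 0 < mu) (muv0 : 0 < muv) (mu_muv : mu != muv).
Implicit Types (t z s : R) (f : R -> R).
Local Notation lam := (ag_lam A).
Local Notation c := (ag_c A).
Local Notation n := (ag_nv A).
Local Notation al := (Num.min mu muv).
Local Notation sol := (fun t0 => error_solution lv t0 (gain_lx p ps gam lv) (gain_l1 A p)).

Section Solution.
Variables (t0 : R) (ev : R -> 'cV[R]_n) (ex exz exzz : R -> R -> R).
Hypotheses (tb0 : tb <= t0) (es : sol t0 ev ex exz exzz).
Local Notation e_ := (eps To gam ev ex).
Local Notation e1_ := (eps1 p pz To gamz ev ex exz).
Local Notation En s := (ip (e_^~ s) (e_^~ s)).
Local Notation Dn s := (ip (e1_^~ s) (e1_^~ s)).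

(** The weighted dissipation appears as the derivative of a nonnegative function; this stands in for
    a bound on its time integral. *)
Lemma scaled_energy_derive s0 s : t0 < s ->
  is_derive s 1 (fun x => En x * expR (2 * mu * x + - (2 * mu * s0)))
    (- (2 * lam * (Dn s * expR (2 * mu * s + - (2 * mu * s0))))).
Proof.
move=> ts.
have DE := eps_energy std SK HTo Hgam tb0 es ts.
have Dx := is_derive_expR_affine (2 * mu) (- (2 * mu * s0)) s.
have := is_deriveM DE Dx; rewrite /GRing.scale/= => h; apply: (is_derive_eq h); ring.
Qed.

Lemma scaled_energy_le s0 s : t0 < s0 -> s0 <= s -> En s * expR (2 * mu * s + - (2 * mu * s0)) <= En s0.
Proof.
move=> t00 s0s; have l0 := lam_gt0 std.
have := @derive_le0_le _ _ _ s0 s s0s (fun x sx => scaled_energy_derive s0 (lt_le_trans t00 (proj1 (andP sx)))).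
rewrite subrr expR0 mulr1; apply => x _.
by rewrite oppr_le0 !mulr_ge0 ?ip_ge0 ?expR_ge0// ltW.
Qed.

(** Variation of constants without an integral in time. The derivative of Psi t s *m ev s is the
    forcing [F], about whose continuity in s nothing is known; since |F| <= G' for an explicit [G],
    monotonicity of the differences bounds the increment by that of [G]. *)
Lemma observer_forcing_bound kappa B s0 t r i : t0 < s0 -> s0 <= t -> 0 < r -> En s0 <= r ^+ 2 ->
  0 <= kappa -> 0 <= B -> (forall t, tb < t -> forall k, `|lv t k 0| <= B) ->
  (forall t tau, tb < tau -> tau <= t -> mx_norm (Psi t tau) <= kappa * expR (- (muv * (t - tau)))) ->
  `|ev t i 0 - (Psi t s0 *m ev s0) i 0| <=
    n%:R * kappa * (`|c| * B) * (3 / 2 / `|muv - mu| + (2 * lam)^-1) * expR (- (al * (t - s0))) * r.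
Proof.
move=> t00 s0t r0 Er k0 B0 lvB psB; have l0 := lam_gt0 std.
have dm : muv - mu != 0 by rewrite subr_eq0 eq_sym.
pose q := n%:R * kappa * (`|c| * B).
have q0 : 0 <= q by rewrite /q !mulr_ge0.
pose e := expR (- (al * (t - s0))).
pose a1 := muv - mu; pose b1 := mu * s0 - muv * t.
(* This is exp(- muv (t - s)) exp(- mu (s - s0)), the integrand of the convolution. Its primitive kk
   / (muv - mu) is where mu != muv enters. *)
pose kk s := expR (a1 * s + b1).
(* As Y' is - 2 lam times the weighted dissipation, [G] is a primitive of the bound given by
   [energy_split]. *)
pose Y s := En s * expR (2 * mu * s + - (2 * mu * s0)).
pose G s := q * (3 / 2 * r / a1 * kk s - e / r / (2 * lam) * Y s).
pose dG s := q * (3 / 2 * r * kk s + e / r * (Dn s * expR (2 * mu * s + - (2 * mu * s0)))).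
have t1 s : s0 <= s <= t -> t0 < s by move=> /andP[h _]; exact: lt_le_trans h.
have DG s : s0 <= s <= t -> is_derive s 1 G (dG s).
  move=> /t1 ts.
  have d1 := is_deriveZ (3 / 2 * r / a1) (is_derive_expR_affine a1 b1 s).
  have d2 := is_deriveZ (e / r / (2 * lam)) (scaled_energy_derive s0 ts).
  have d3 := is_deriveZ q (is_deriveB d1 d2).
  apply: (is_derive_eq d3); rewrite /GRing.scale/= /dG /kk; field.
  by rewrite (gt_eqF r0) (gt_eqF l0) dm.
have kke s : s0 <= s <= t -> kk s <= e.
  move=> /andP[h1 h2]; rewrite /kk /e ler_expR /a1 /b1.
  have m1 : al <= mu by rewrite ge_min lexx.
  have m2 : al <= muv by rewrite ge_min lexx orbT.
  nra.
pose F s i := (Psi t s *m ((- (c * e_ 1 s)) *: lv s)) i 0.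
have DF s : s0 <= s <= t -> is_derive s 1 (fun s => (Psi t s *m ev s) i 0) (F s i).
  move=> st; have ts := t1 _ st; have /andP[_ st'] := st.
  exact: (duhamel_derive fund expb muv0 (le_lt_trans tb0 ts) st' (ev_derive HTo tb0 es ts)).
have FG s : s0 <= s <= t -> `|F s i| <= dG s.
  move=> st; have ts := t1 _ st; have tbs := le_lt_trans tb0 ts.
  have /andP[s0s st'] := st.
  have h1 : `|F s i| <= n%:R * (kappa * expR (- (muv * (t - s))) * (`|c| * `|e_ 1 s| * B)).
    apply: mulmx_bound => k l.
      by apply: (le_trans (mx_norm_entry _ _ _)); exact: psB.
    by rewrite mxE ord1 normrM normrN normrM; apply: ler_wpM2l; [exact: mulr_ge0|exact: lvB].
  apply: (le_trans h1).
  pose m := expR (mu * s + - (mu * s0)).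
  have m2 : expR (2 * mu * s + - (2 * mu * s0)) = m ^+ 2.
    by rewrite /m expr2 -expRD; congr expR; ring.
  have km : expR (- (muv * (t - s))) = kk s * m.
    by rewrite /kk /m -expRD; congr expR; rewrite /a1 /b1; ring.
  have [pe pe1 _] := eps_prim std SK HTo Hgam tb0 es ts.
  have := @energy_split R (kk s) e m `|e_ 1 s| r (En s) (Dn s) (expR_ge0 _) (kke _ st) (expR_ge0 _) (normr_ge0 _) r0 (ip_ge0 _).
  rewrite (real_normK (num_real _)) => /(_ (prim_trace pe (prim_L2 pe1) _)) H.
  have {}H := H ltac:(by rewrite ler01 lexx) ltac:(by rewrite -m2; apply: le_trans Er; exact: scaled_energy_le).
  rewrite /dG m2 km.
  have -> : n%:R * (kappa * (kk s * m) * (`|c| * `|e_ 1 s| * B)) = q * (kk s * m * `|e_ 1 s|).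
    by rewrite /q; ring.
  exact: ler_wpM2l.
have psi_t : (Psi t t *m ev t) i 0 = ev t i 0.
  have [-> _] := fund (le_lt_trans tb0 (lt_le_trans t00 s0t)).
  by rewrite mul1mx.
have up : (Psi t t *m ev t) i 0 - G t <= (Psi t s0 *m ev s0) i 0 - G s0.
  apply: (@derive_le0_le _ (fun s => (Psi t s *m ev s) i 0 - G s) (fun s => F s i - dG s)) => // s st.
    exact: is_deriveB (DF s st) (DG s st).
  by rewrite subr_le0 (le_trans (ler_norm _))// FG.
have dn : - (Psi t t *m ev t) i 0 - G t <= - (Psi t s0 *m ev s0) i 0 - G s0.
  apply: (@derive_le0_le _ (fun s => - (Psi t s *m ev s) i 0 - G s) (fun s => - F s i - dG s)) => // s st.
    exact: is_deriveB (is_deriveN (DF s st)) (DG s st).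
  by rewrite subr_le0 (le_trans (ler_norm _))// normrN FG.
rewrite psi_t in up dn.
have GG : G t - G s0 <= q * (3 / 2 / `|muv - mu| + (2 * lam)^-1) * e * r.
  have e0 : 0 <= e by exact: expR_ge0.
  have Y0 : Y s0 <= r ^+ 2 by rewrite /Y subrr expR0 mulr1.
  have Yt : 0 <= Y t by rewrite /Y mulr_ge0 ?ip_ge0 ?expR_ge0.
  have k1 : `|kk t - kk s0| <= e.
    have h1 : kk t <= e by apply: kke; rewrite s0t lexx.
    have h2 : kk s0 <= e by apply: kke; rewrite s0t lexx.
    have h3 : 0 <= kk t by exact: expR_ge0.
    have h4 : 0 <= kk s0 by exact: expR_ge0.
    by rewrite ler_norml; apply/andP; split; lra.
  have k2 : (kk t - kk s0) / a1 <= e / `|a1|.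
    by rewrite (le_trans (ler_norm _))// normrM normfV ler_wpM2r// invr_ge0.
  have -> : G t - G s0 = q * (3 / 2 * r * ((kk t - kk s0) / a1) + e / r / (2 * lam) * (Y s0 - Y t)).
    by rewrite /G; field; rewrite (gt_eqF r0) (gt_eqF l0) dm.
  have A1 : 3 / 2 * r * ((kk t - kk s0) / a1) <= 3 / 2 * r * (e / `|a1|).
    by apply: ler_wpM2l => //; rewrite mulr_ge0 ?divr_ge0// ltW.
  have A2 : e / r / (2 * lam) * (Y s0 - Y t) <= e / r / (2 * lam) * r ^+ 2.
    by apply: ler_wpM2l; [rewrite !divr_ge0// ?mulr_ge0// ltW|lra].
  have -> : q * (3 / 2 / `|muv - mu| + (2 * lam)^-1) * e * r =
      q * (3 / 2 * r * (e / `|a1|) + e / r / (2 * lam) * r ^+ 2).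
    by rewrite /a1; field; rewrite normr_eq0 (gt_eqF r0) (gt_eqF l0) dm.
  by apply: ler_wpM2l => //; exact: lerD.
rewrite ler_norml; apply/andP; split; rewrite -/q -/e; lra.
Qed.

Lemma eps_decay s0 t : t0 < s0 -> s0 <= t ->
  normL2 (e_^~ t) <= expR (- (al * (t - s0))) * normL2 (e_^~ s0).
Proof.
move=> t00 s0t.
pose m := expR (mu * (t - s0)).
have m0 : 0 < m by exact: expR_gt0.
have h : normL2 (e_^~ t) * m <= normL2 (e_^~ s0).
  rewrite -(@ler_pXn2r _ 2)// ?nnegrE ?mulr_ge0 ?normL2_ge0 ?(ltW m0)//.
  rewrite exprMn !normL2_sqr; apply: le_trans (scaled_energy_le t00 s0t).
  rewrite /m expr2 -expRD le_eqVlt; apply/orP; left; apply/eqP.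
  by congr (_ * expR _); ring.
have m1 : al <= mu by rewrite ge_min lexx.
rewrite mulrC; apply: (@le_trans _ _ (normL2 (e_^~ s0) * m^-1)).
  by rewrite ler_pdivlMr.
apply: ler_wpM2l; first exact: normL2_ge0.
by rewrite /m -expRN ler_expR lerN2; apply: ler_wpM2r => //; rewrite subr_ge0.
Qed.

Lemma gamma_ev_L2 t : t0 < t -> L2 (fun z => \sum_j (- ev t j 0) * gam z t j 0).
Proof.
move=> tt; apply: (@L2_lincomb _ _ (fun j => - ev t j 0) (fun j z => gam z t j 0)) => j.
by apply: (gamma_L2 Hgam); exact: le_lt_trans tb0 tt.
Qed.

Lemma gamma_ev_bound G t : (forall t, tb < t -> forall j, normL2 (fun z => gam z t j 0) <= G) ->
  t0 < t -> normL2 (fun z => \sum_j (- ev t j 0) * gam z t j 0) <= G * norm1 (ev t).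
Proof.
move=> HG tt; have t1 := le_lt_trans tb0 tt.
apply: (le_trans (@normL2_lincomb _ _ (fun j => - ev t j 0) (fun j z => gam z t j 0) (fun j => gamma_L2 Hgam j t1))).
rewrite mulr_sumr; apply: ler_sum => j _; rewrite normrN mulrC; apply: ler_wpM2r => //; exact: HG.
Qed.

Lemma eps_le G C t : (forall t, tb < t -> forall j, normL2 (fun z => gam z t j 0) <= G) ->
  (forall t f, tb < t -> L2 f -> normL2 (To f t) <= C * normL2 f) ->
  t0 < t -> normL2 (e_^~ t) <= C * normL2 (ex^~ t) + G * norm1 (ev t).
Proof.
move=> HG HC tt; have t1 := le_lt_trans tb0 tt.
have [_ _ /prim_L2 Lx] := error_H2 es tt.
apply: (le_trans (normL2D (back_L2 HTo tb0 es tt) (gamma_ev_L2 tt))).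
by apply: lerD; [exact: HC|exact: gamma_ev_bound].
Qed.

Lemma error_le G M t : (forall t, tb < t -> forall j, normL2 (fun z => gam z t j 0) <= G) ->
  0 <= M -> (forall t, tb < t -> forall x y, `|kernel_at p t x y| <= M) ->
  t0 < t -> normL2 (ex^~ t) <= (1 + M) * (normL2 (e_^~ t) + G * norm1 (ev t)).
Proof.
move=> HG M0 HM tt; have t1 := le_lt_trans tb0 tt.
have Lb := back_L2 HTo tb0 es tt; have Lg := gamma_ev_L2 tt; have kP := ker_P SK t1.
have [/prim_L2 Le _ _] := eps_prim std SK HTo Hgam tb0 es tt.
have Lv : L2 (volterra (kernel_at p t) ((back To ex)^~ t)).
  by apply: L2_cont; apply: volterra_cont => //; exact: L2_intg.
have h1 : normL2 ((back To ex)^~ t) <= normL2 (e_^~ t) + G * norm1 (ev t).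
  rewrite (@normL2_ext _ _ (fun z => e_ z t - \sum_j (- ev t j 0) * gam z t j 0)).
    by apply: (le_trans (normL2B Le Lg)); rewrite lerD2l; exact: gamma_ev_bound.
  by move=> z _; rewrite /eps addrK.
rewrite (@normL2_ext _ _ (fun z => back To ex z t - volterra (kernel_at p t) ((back To ex)^~ t) z)); last first.
  by move=> z z01; rewrite (backE HTo tb0 es tt z01).
apply: (le_trans (normL2B Lb Lv)).
apply: (@le_trans _ _ ((1 + M) * normL2 ((back To ex)^~ t))); last by apply: ler_wpM2l => //; exact: addr_ge0.
rewrite mulrDl mul1r lerD2l; apply: normL2_bd => //; first by rewrite mulr_ge0// normL2_ge0.
by move=> z z01; apply: volterra_bound => //; exact: HM.
Qed.

End Solution.

Lemma error_estimate_interior : exists2 C, 0 <= C &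
  forall t0 (ev : R -> 'cV[R]_n) (ex exz exzz : R -> R -> R), tb <= t0 -> sol t0 ev ex exz exzz ->
  forall s t, t0 < s -> s <= t -> norm1 (ev t) + normL2 (ex^~ t) <=
    C * expR (- (al * (t - s))) * (norm1 (ev s) + normL2 (ex^~ s)).
Proof.
have [B1 HB1] := lv_bounded; have [kappa kappa0 Hk] := expb.
have [G G0 HG] := gamma_bounded std SK HTo mu0 Hgam.
have [M [N [M0 _ HM _]]] := kernel_bounds SK; have [CT CT0 HCT] := To_bounded SK HTo.
have {}HM t : tb < t -> forall x y, `|kernel_at p t x y| <= M by move=> tt x y; case: (HM t tt x y).
have l0 := lam_gt0 std; have k0 := ltW kappa0.
pose B := Num.max B1 0.
have B0 : 0 <= B by rewrite /B le_max lexx orbT.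
have HB t : tb < t -> forall k, `|lv t k 0| <= B.
  by move=> tt k; rewrite /B le_max HB1.
pose K1 := n%:R * kappa * (`|c| * B) * (3 / 2 / `|muv - mu| + (2 * lam)^-1).
have K10 : 0 <= K1 by rewrite /K1 !mulr_ge0// addr_ge0 ?divr_ge0// ?invr_ge0 ?mulr_ge0// ltW.
(* [a] and [b] bound the homogeneous and the forced part of ev, with a factor n for summing the
   entries; [k] bounds the passage from (ev, ex) to eps. *)
pose a := n%:R * (n%:R * kappa); pose b := n%:R * K1; pose k := CT + G.
have a0 : 0 <= a by rewrite /a !mulr_ge0.
have b0 : 0 <= b by exact: mulr_ge0.
have k0' : 0 <= k by exact: addr_ge0.
exists ((1 + (1 + M) * G) * (a + b * k) + (1 + M) * k).
  have M10 : 0 <= 1 + M by exact: addr_ge0.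
  have h : 0 <= a + b * k by apply: addr_ge0 => //; exact: mulr_ge0.
  by apply: addr_ge0; apply: mulr_ge0 => //; apply: addr_ge0 => //; exact: mulr_ge0.
move=> t0 ev ex exz exzz tb0 es s t t0s st.
have ts := lt_le_trans t0s st.
have tbs := le_lt_trans tb0 t0s.
pose e := expR (- (al * (t - s))); have e0 : 0 <= e by exact: expR_ge0.
pose E0 := normL2 ((eps To gam ev ex)^~ s).
have E00 : 0 <= E0 by exact: normL2_ge0.
pose Ns := norm1 (ev s); have N0 : 0 <= Ns by exact: norm1_ge0.
have X0 := normL2_ge0 (ex^~ s).
have entry i : `|ev t i 0| <= e * (n%:R * kappa * Ns + K1 * E0).
  have h1 : `|(Psi t s *m ev s) i 0| <= e * (n%:R * kappa * Ns).
    apply: (@le_trans _ _ (n%:R * (kappa * expR (- (muv * (t - s))) * Ns))).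
      apply: mulmx_bound => [x y|x y]; last by rewrite ord1; exact: norm1_entry.
      by apply: (le_trans (mx_norm_entry _ _ _)); exact: Hk.
    have -> : n%:R * (kappa * expR (- (muv * (t - s))) * Ns) = expR (- (muv * (t - s))) * (n%:R * kappa * Ns) by ring.
    apply: ler_wpM2r; first by rewrite !mulr_ge0.
    rewrite ler_expR lerN2; apply: ler_wpM2r; first by rewrite subr_ge0.
    by rewrite ge_min lexx orbT.
  apply/ler_addgt0Pr => d d0.
  (* The forcing bound divides by r, while [E0] may vanish; hence a positive perturbation, whose
     contribution stays below the arbitrary d. Adding 1 to K1 avoids a division by zero. *)
  pose r := E0 + d / (K1 + 1).
  have K1p : 0 < K1 + 1 by rewrite ltr_wpDl.
  have r0 : 0 < r by rewrite /r ltr_wpDl// divr_gt0.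
  have Er : ip ((eps To gam ev ex)^~ s) ((eps To gam ev ex)^~ s) <= r ^+ 2.
    rewrite -normL2_sqr ler_pXn2r ?nnegrE ?(ltW r0) ?E00// /r lerDl.
    by rewrite divr_ge0// ltW.
  have h2 := observer_forcing_bound tb0 es i t0s st r0 Er k0 B0 HB Hk.
  rewrite -/K1 -/e in h2.
  have e1 : e <= 1.
    rewrite -expR0 ler_expR oppr_le0 mulr_ge0 ?subr_ge0// le_min; apply/andP; split; exact: ltW.
  have h3 : K1 * e * r <= e * (K1 * E0) + d.
    have -> : K1 * e * r = e * (K1 * E0) + e * (K1 * (d / (K1 + 1))) by rewrite /r; ring.
    rewrite lerD2l; apply: (@le_trans _ _ (1 * d)); last by rewrite mul1r.
    apply: ler_pM => //; first by rewrite mulr_ge0// divr_ge0// ltW.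
    by rewrite mulrA ler_pdivrMr// mulrC ler_wpM2l ?lerDl// ltW.
  have := ler_normD (ev t i 0 - (Psi t s *m ev s) i 0) ((Psi t s *m ev s) i 0).
  rewrite subrK; lra.
have Nt : norm1 (ev t) <= e * (a * Ns + b * E0).
  rewrite /norm1; apply: (@le_trans _ _ (\sum_(i < n) e * (n%:R * kappa * Ns + K1 * E0))).
    by apply: ler_sum => i _; exact: entry.
  rewrite sumr_const card_ord -mulr_natr le_eqVlt; apply/orP; left; apply/eqP.
  by rewrite /a /b; ring.
have E0k : E0 <= k * (Ns + normL2 (ex^~ s)).
  have h0 := eps_le tb0 es HG HCT t0s; rewrite -/E0 in h0; apply: (le_trans h0).
  rewrite -/Ns /k; have := mulr_ge0 CT0 N0; have := mulr_ge0 G0 X0; lra.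
have Et := eps_decay tb0 es t0s st.
rewrite -/e -/E0 in Et.
have Xt := error_le tb0 es HG M0 HM ts.
set S := Ns + normL2 (ex^~ s) in E0k *.
have S0 : 0 <= S by exact: addr_ge0.
have NS : Ns <= S by rewrite /S lerDl.
have h1 : a * Ns + b * E0 <= (a + b * k) * S.
  have := ler_wpM2l a0 NS; have := ler_wpM2l b0 E0k; lra.
have h2 : norm1 (ev t) <= e * ((a + b * k) * S).
  by apply: (le_trans Nt); exact: ler_wpM2l.
have h3 : normL2 ((eps To gam ev ex)^~ t) <= e * (k * S).
  by apply: (le_trans Et); exact: ler_wpM2l.
have h4 : normL2 (ex^~ t) <= (1 + M) * (e * (k * S) + G * (e * ((a + b * k) * S))).
  apply: (le_trans Xt); apply: ler_wpM2l; first exact: addr_ge0.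
  by apply: lerD => //; exact: ler_wpM2l.
apply: (le_trans (lerD h2 h4)); rewrite -/e le_eqVlt; apply/orP; left; apply/eqP; ring.
Qed.

(** The interior estimate is passed to the limit s -> t0. On the right hand side the norm of ex at s
    is replaced by |ex(t0)| + |ex(s) - ex(t0)|, whose limit is known from the continuity of the
    solution at t0 in L_2. *)
Lemma error_estimate : exists2 C, 0 <= C &
  forall t0 (ev : R -> 'cV[R]_n) (ex exz exzz : R -> R -> R), tb <= t0 -> sol t0 ev ex exz exzz ->
  forall t, t0 < t -> norm1 (ev t) + normL2 (ex^~ t) <=
    C * expR (- (al * (t - t0))) * (norm1 (ev t0) + normL2 (ex^~ t0)).
Proof.
have [C C0 H] := error_estimate_interior; exists C => // t0 ev ex exz exzz tb0 es t tt.
have [_ cv [L0 cx HH _ _] _ _] := es.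
pose u s := C * expR (al * s + - (al * t)) *
  (norm1 (ev s) + (normL2 (ex^~ t0) + normL2 (fun z => ex z s - ex z t0))).
have cu : u s @[s --> t0^'+] --> C * expR (al * t0 + - (al * t)) * (norm1 (ev t0) + (normL2 (ex^~ t0) + 0)).
  apply: cvgM.
    apply: cvgM; first exact: cvg_cst.
    apply: cvg_at_right_filter.
    exact: (is_derive_cont (is_derive_expR_affine al (- (al * t)) t0)).
  apply: cvgD; last by apply: cvgD => //; exact: cvg_cst.
  by apply: cvg_sum_ord => j; apply: cvg_norm; exact: cv.
have -> : - (al * (t - t0)) = al * t0 + - (al * t) by ring.
rewrite -[normL2 (ex^~ t0)]addr0.
apply: (cvgr_to_ge cu).
near=> s.
have s0 : t0 < s by near: s; exact: nbhs_right_gt.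
have st : s <= t by near: s; exact: nbhs_right_le.
apply: (le_trans (H t0 ev ex exz exzz tb0 es s t s0 st)).
have -> : - (al * (t - s)) = al * s + - (al * t) by ring.
apply: ler_wpM2l; first by rewrite mulr_ge0 ?expR_ge0.
rewrite lerD2l; have [_ _ /prim_L2 Ls] := H2_prim (HH s s0).
rewrite (@normL2_ext _ _ (fun z => ex z t0 + (ex z s - ex z t0))); last by move=> z _; rewrite addrC subrK.
by apply: normL2D => //; exact: L2B.
Unshelve. all: by end_near. Qed.

End Estimate.

(** * Differences of solutions *)

Section EvolutionDifference.
Context {R : realType}.

Lemma H2B (f f1 f2 g g1 g2 : R -> R) : H2 f f1 f2 -> H2 g g1 g2 ->
  H2 (fun z => f z - g z) (fun z => f1 z - g1 z) (fun z => f2 z - g2 z).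
Proof.
move=> /H2_prim[Lf pf1 pf] /H2_prim[Lg pg1 pg].
by split; [exact: L2B|case: (primB pf1 pg1)|case: (primB pf pg)].
Qed.

Lemma cvg_normL2B (F : set_system R) {FF : ProperFilter F} (f g : R -> R -> R) (f0 g0 : R -> R) :
  (\forall s \near F, L2 (f^~ s)) -> (\forall s \near F, L2 (g^~ s)) -> L2 f0 -> L2 g0 ->
  normL2 (fun z => f z s - f0 z) @[s --> F] --> 0 ->
  normL2 (fun z => g z s - g0 z) @[s --> F] --> 0 ->
  normL2 (fun z => (f z s - g z s) - (f0 z - g0 z)) @[s --> F] --> 0.
Proof.
move=> Lf Lg L0 M0 cf cg.
apply: (cvg_dist_le _ (u := fun s => normL2 (fun z => f z s - f0 z) + normL2 (fun z => g z s - g0 z))).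
  near=> s; rewrite subr0 ger0_norm ?normL2_ge0//.
  have Ls : L2 (f^~ s) by near: s.
  have Ms : L2 (g^~ s) by near: s.
  apply: le_trans (normL2B (L2B Ls L0) (L2B Ms M0)).
  rewrite le_eqVlt; apply/orP; left; apply/eqP; apply: normL2_ext => z _; ring.
by apply: (cvg_to_eq (l := 0 + 0)); [exact: cvgD|rewrite addr0].
Unshelve. all: by end_near. Qed.

Lemma evolutionB (t0 : R) (f fz fzz r g gz gzz q : R -> R -> R) :
  evolution t0 f fz fzz r -> evolution t0 g gz gzz q ->
  evolution t0 (fun z t => f z t - g z t) (fun z t => fz z t - gz z t)
    (fun z t => fzz z t - gzz z t) (fun z t => r z t - q z t).
Proof.
move=> [Lf0 cf0 Hf Df cf] [Lg0 cg0 Hg Dg cg].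
have Lf t : t0 < t -> L2 (f^~ t) by move=> tt; have [_ _ /prim_L2] := H2_prim (Hf t tt).
have Lg t : t0 < t -> L2 (g^~ t) by move=> tt; have [_ _ /prim_L2] := H2_prim (Hg t tt).
have nr (k : R -> R -> R) : (forall t, t0 < t -> L2 (k^~ t)) -> \forall s \near t0^'+, L2 (k^~ s).
  by move=> H; near=> s; apply: H; near: s; exact: nbhs_right_gt.
have nn (k : R -> R -> R) t : (forall t, t0 < t -> L2 (k^~ t)) -> t0 < t -> \forall s \near t, L2 (k^~ s).
  by move=> H tt; have := near_gt tt; apply: filterS => s; exact: H.
split.
- exact: L2B.
- by apply: cvg_normL2B => //; exact: nr.
- by move=> t tt; apply: H2B; [exact: Hf|exact: Hg].
- move=> t tt.
  have dm : is_derive t 1 (fun _ : R => -1 : R) 0 by exact: is_derive_cst.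
  have D := L2_derive_scal (nn _ _ Lg tt) (Dg t tt) dm.
  have nm : \forall s \near t, L2 (fun z => -1 * g z s).
    by have := nn _ _ Lg tt; apply: filterS => s; exact: L2Z.
  apply: (L2_derive_ext _ _ (L2_deriveD (nn _ _ Lf tt) nm (Df t tt) D)).
    by near=> s => z _; ring.
  by move=> z _; ring.
- have Lr t : t0 < t -> L2 (r^~ t) by move=> /Df[].
  have Lq t : t0 < t -> L2 (q^~ t) by move=> /Dg[].
  move=> t tt.
  exact: (cvg_normL2B (nn r t Lr tt) (nn q t Lq tt) (Lr t tt) (Lq t tt) (cf t tt) (cg t tt)).
Unshelve. all: by end_near. Qed.

End EvolutionDifference.

(** * Reduction to real and imaginary parts *)

Section RealParts.
Context {R : realType}.
Variable rho : R[i] -> R.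
Hypotheses (rhoB : forall x y, rho (x - y) = rho x - rho y)
  (rhoC : forall (r : R) x, rho (r%:C * x) = r * rho x).

Let rho0 : rho 0 = 0. Proof. by rewrite -(subrr 0) rhoB subrr. Qed.
Let rhoD x y : rho (x + y) = rho x + rho y.
Proof. by rewrite -[y]opprK rhoB -(sub0r (- y)) !rhoB rho0 sub0r. Qed.

Lemma part_mul m k (B : 'M[R]_(m, k)) (v : 'cV[R[i]]_k) i :
  rho ((toC B *m v) i 0) = (B *m map_mx rho v) i 0.
Proof.
rewrite !mxE; apply: (@big_rec2 _ _ (fun x y => rho x = y)) => // j x y _ <-.
by rewrite rhoD !mxE rhoC.
Qed.

Variables (A : agent R) (t0 : R) (lv : R -> 'cV[R]_(ag_nv A)) (lx : R -> R -> R) (l1 : R -> R).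
Variables (u : R -> R[i]) (v vh : R -> 'cV[R[i]]_(ag_nv A)) (x xz xzz xh xhz xhzz : R -> R -> R[i]).

Definition part_ode (w rhs : R -> 'cV[R[i]]_(ag_nv A)) : Prop := forall k,
  rho (w s k 0) @[s --> t0^'+] --> rho (w t0 k 0) /\
  forall t, t0 < t -> is_derive t 1 (fun s => rho (w s k 0)) (rho (rhs t k 0)).

Definition part_evolution (f fz fzz r : R -> R -> R[i]) : Prop :=
  evolution t0 (fun z t => rho (f z t)) (fun z t => rho (fz z t)) (fun z t => rho (fzz z t))
    (fun z t => rho (r z t)).

Hypothesis c0 : ag_c A != 0.
Local Notation innov t := (output A x t - output A xh t).

Hypothesis ode_v : part_ode v (fun t => toC (ag_S A) *m v t).
Hypothesis ode_vh : part_ode vh (fun t => toC (ag_S A) *m vh t + innov t *: toC (lv t)).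
Hypothesis evo_x : part_evolution x xz xzz (fun z t =>
  (ag_lam A)%:C * xzz z t + (ag_a A z t)%:C * x z t + (toC (tg1 A z t) *m v t) 0 0).
Hypothesis evo_xh : part_evolution xh xhz xhzz (fun z t =>
  (ag_lam A)%:C * xhzz z t + (ag_a A z t)%:C * xh z t
  + (toC (tg1 A z t) *m vh t) 0 0 + (lx z t)%:C * innov t).
Hypothesis bc0_x : forall t, t0 < t -> xz 0 t = (ag_q A t)%:C * x 0 t + (toC (tg2 A t) *m v t) 0 0.
Hypothesis bc1_x : forall t, t0 < t -> xz 1 t = (ag_ql A t)%:C * x 1 t + (ag_b A)%:C * u t
  + (toC (tg3 A t) *m v t) 0 0.
Hypothesis bc0_xh : forall t, t0 < t ->
  xhz 0 t = (ag_q A t)%:C * xh 0 t + (toC (tg2 A t) *m vh t) 0 0.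
Hypothesis bc1_xh : forall t, t0 < t ->
  xhz 1 t = (ag_ql A t / ag_c A)%:C * output A x t + (ag_b A)%:C * u t
            + (toC (tg3 A t) *m vh t) 0 0 + (l1 t)%:C * innov t.

(** All coefficients are real, so they commute with [rho], the real or the imaginary part. The input
    cancels in the difference, and so does the q^l term, which the observer feeds back from the
    measured output c x(1). *)
Lemma part_error_solution : error_solution lv t0 lx l1 (fun t => map_mx rho (v t - vh t))
  (fun z t => rho (x z t - xh z t)) (fun z t => rho (xz z t - xhz z t))
  (fun z t => rho (xzz z t - xhzz z t)).
Proof.
have rhoI t : rho (innov t) = ag_c A * rho (x 1 t - xh 1 t).
  by rewrite /output -mulrBr rhoC.
have mapB t : map_mx rho (v t - vh t) = map_mx rho (v t) - map_mx rho (vh t).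
  by apply/matrixP => i j; rewrite !mxE rhoB.
have subE m (M N : 'cV[R]_m) i : (M - N) i 0 = M i 0 - N i 0 by rewrite !mxE.
split.
- move=> t tt i j; rewrite (ord1 j).
  have [_ /(_ t tt) d1] := ode_v i; have [_ /(_ t tt) d2] := ode_vh i.
  have -> : (fun s => map_mx rho (v s - vh s) i 0) = (fun s => rho (v s i 0) - rho (vh s i 0)).
    by apply/funext => s; rewrite !mxE rhoB.
  apply: (is_derive_eq (is_deriveB d1 d2)).
  have addE (M N : 'cV[R[i]]_(ag_nv A)) : rho ((M + N) i 0) = rho (M i 0) + rho (N i 0).
    by rewrite [(M + N) i 0]mxE rhoD.
  rewrite mapB mulmxBr addE !part_mul.
  have -> : rho ((innov t *: toC (lv t)) i 0) = ag_c A * rho (x 1 t - xh 1 t) * lv t i 0.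
    by rewrite !mxE mulrC rhoC rhoI mulrC.
  by rewrite !subE [(_ *: lv t) i 0]mxE; ring.
- move=> j; have [c1 _] := ode_v j; have [c2 _] := ode_vh j.
  have -> : (fun s => map_mx rho (v s - vh s) j 0) = (fun s => rho (v s j 0) - rho (vh s j 0)).
    by apply/funext => s; rewrite !mxE rhoB.
  by rewrite !mxE rhoB; exact: cvgB.
- have := evolutionB evo_x evo_xh.
  have E (f g : R -> R -> R[i]) : (fun z t => rho (f z t - g z t)) = (fun z t => rho (f z t) - rho (g z t)).
    by apply/funext => z; apply/funext => t; rewrite rhoB.
  rewrite !E; congr (evolution _ _ _ _ _); apply/funext => z; apply/funext => t.
  have := rhoI t; move: (innov t) => I rI.
  by rewrite mapB mulmxBr subE !rhoB !rhoD !rhoC rI !part_mul rhoB; ring.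
- move=> t tt; rewrite bc0_x// bc0_xh// mapB mulmxBr subE !rhoB !rhoD !rhoC !part_mul.
  by ring.
- move=> t tt; rewrite bc1_x// bc1_xh// mapB mulmxBr subE.
  have := rhoI t; move: (innov t) => I rI.
  rewrite !rhoB !rhoD !rhoC rI !part_mul rhoB.
  by field.
Qed.

End RealParts.

(** * The state norm in terms of real and imaginary parts *)

Section NormX.
Context {R : realType}.
Local Notation re := (@complex.Re R).
Local Notation im := (@complex.Im R).

Lemma normc_sqr (x : R[i]) : Normc.normc x ^+ 2 = re x ^+ 2 + im x ^+ 2.
Proof. by case: x => a b; rewrite /Normc.normc sqr_sqrtr// addr_ge0 ?sqr_ge0. Qed.

Lemma sum_sqr_le_norm1 n (v : 'cV[R]_n) : \sum_k v k 0 ^+ 2 <= norm1 v ^+ 2.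
Proof.
rewrite [leRHS]expr2 {2}/norm1 mulr_sumr; apply: ler_sum => k _.
rewrite -(real_normK (num_real _)) expr2; apply: ler_wpM2r => //; exact: norm1_entry.
Qed.

Variables (n : nat) (v : 'cV[R[i]]_n) (f : R -> R[i]).
Hypotheses (Lre : L2 (re \o f)) (Lim : L2 (im \o f)).

Lemma normX_sqr : normX v f ^+ 2 = \sum_k re (v k 0) ^+ 2 + \sum_k im (v k 0) ^+ 2
  + ip (re \o f) (re \o f) + ip (im \o f) (im \o f).
Proof.
rewrite /normX sqr_sqrtr; last first.
  by apply: addr_ge0; [apply: sumr_ge0 => k _; exact: sqr_ge0|apply: ig_ge0 => x _; exact: sqr_ge0].
rewrite -big_split/= -addrA; congr (_ + _).
  by apply: eq_bigr => k _; rewrite normc_sqr.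
rewrite /ip -igD; [|exact: L2_intgM|exact: L2_intgM].
by apply: ig_ext => z _; rewrite normc_sqr !expr2.
Qed.

Lemma normX_ge0 : 0 <= normX v f.
Proof. exact: sqrtr_ge0. Qed.

Local Notation part rho := (norm1 (map_mx rho v) + normL2 (rho \o f)).

Lemma normX_le_parts : normX v f <= part re + part im.
Proof.
have a0 := norm1_ge0 (map_mx re v); have b0 := norm1_ge0 (map_mx im v).
have x0 := normL2_ge0 (re \o f); have y0 := normL2_ge0 (im \o f).
rewrite -(@ler_pXn2r _ 2)// ?nnegrE ?normX_ge0 ?addr_ge0// normX_sqr -!normL2_sqr.
have ha : \sum_k re (v k 0) ^+ 2 <= norm1 (map_mx re v) ^+ 2.
  apply: le_trans (sum_sqr_le_norm1 _); apply: ler_sum => k _; by rewrite mxE.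
have hb : \sum_k im (v k 0) ^+ 2 <= norm1 (map_mx im v) ^+ 2.
  apply: le_trans (sum_sqr_le_norm1 _); apply: ler_sum => k _; by rewrite mxE.
move: (norm1 _) (norm1 _) (normL2 _) (normL2 _) a0 b0 x0 y0 ha hb => a b x y a0 b0 x0 y0 ha hb.
have -> : (b + y + (a + x)) ^+ 2 = a ^+ 2 + b ^+ 2 + x ^+ 2 + y ^+ 2
  + 2 * (a * x + a * b + a * y + x * b + x * y + b * y) by ring.
have : 0 <= a * x + a * b + a * y + x * b + x * y + b * y.
  by rewrite !addr_ge0 ?mulr_ge0.
lra.
Qed.

(** Each entry of v and each L_2 norm is at most the state norm; per part, n entries and one L_2
    norm give n + 1. *)
Lemma parts_le_normX : part re + part im <= (2 * (n%:R + 1)) * normX v f.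
Proof.
have X0 := normX_ge0; have E := normX_sqr.
have s1 : 0 <= \sum_k re (v k 0) ^+ 2 by apply: sumr_ge0 => k _; exact: sqr_ge0.
have s2 : 0 <= \sum_k im (v k 0) ^+ 2 by apply: sumr_ge0 => k _; exact: sqr_ge0.
have i1 := ip_ge0 (re \o f); have i2 := ip_ge0 (im \o f).
have sq (y : R) : y ^+ 2 <= normX v f ^+ 2 -> `|y| <= normX v f.
  by move=> h; rewrite -(@ler_pXn2r _ 2)// ?nnegrE// real_normK ?num_real.
have b1 : norm1 (map_mx re v) <= n%:R * normX v f.
  apply: (@le_trans _ _ (\sum_(k < n) normX v f)); last by rewrite sumr_const card_ord mulr_natl.
  apply: ler_sum => k _; rewrite mxE; apply: sq.
  have : re (v k 0) ^+ 2 <= \sum_k re (v k 0) ^+ 2.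
    by rewrite (bigD1 k)//= lerDl sumr_ge0// => j _; exact: sqr_ge0.
  lra.
have b2 : norm1 (map_mx im v) <= n%:R * normX v f.
  apply: (@le_trans _ _ (\sum_(k < n) normX v f)); last by rewrite sumr_const card_ord mulr_natl.
  apply: ler_sum => k _; rewrite mxE; apply: sq.
  have : im (v k 0) ^+ 2 <= \sum_k im (v k 0) ^+ 2.
    by rewrite (bigD1 k)//= lerDl sumr_ge0// => j _; exact: sqr_ge0.
  lra.
have b3 : normL2 (re \o f) <= normX v f.
  by apply: (le_trans (ler_norm _)); apply: sq; rewrite normL2_sqr; lra.
have b4 : normL2 (im \o f) <= normX v f.
  by apply: (le_trans (ler_norm _)); apply: sq; rewrite normL2_sqr; lra.
lra.
Qed.

End NormX.

Lemma part_error_of_solutions (R : realType) (rho : R[i] -> R) (A : agent R) (t0 : R)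
    (lv : R -> 'cV[R]_(ag_nv A)) (lx : R -> R -> R) (l1 : R -> R) (u : R -> R[i])
    (v vh : R -> 'cV[R[i]]_(ag_nv A)) (x xz xzz xh xhz xhzz : R -> R -> R[i]) :
  (rho = @complex.Re R \/ rho = @complex.Im R) -> ag_c A != 0 ->
  agent_solution t0 u v x xz xzz ->
  observer_solution t0 lv lx l1 u (output A x) vh xh xhz xhzz ->
  error_solution lv t0 lx l1 (fun t => map_mx rho (v t - vh t))
    (fun z t => rho (x z t - xh z t)) (fun z t => rho (xz z t - xhz z t))
    (fun z t => rho (xzz z t - xhzz z t)).
Proof.
move=> [->|->] c0 [ov [erx eix] b0 b1] [ovh [erh eih] bh0 bh1];
  (apply: part_error_solution => //; try exact: b0; try exact: b1; try exact: bh0; try exact: bh1).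
- by move=> [a b] [c d].
- by move=> r [a b]; rewrite /= mul0r subr0.
- by move=> k; have [cr ci d] := ov k; split => // t tt; case: (d t tt).
- by move=> k; have [cr ci d] := ovh k; split => // t tt; case: (d t tt).
- by move=> [a b] [c d].
- by move=> r [a b]; rewrite /= mul0r addr0.
- by move=> k; have [cr ci d] := ov k; split => // t tt; case: (d t tt).
- by move=> k; have [cr ci d] := ovh k; split => // t tt; case: (d t tt).
Qed.

(* The coefficients live on (tb, oo); the estimate is uniform in the initial
   time t0 >= tb, t0 = tb included. *)
Theorem theorem7 (R : realType) (N : nat) (A : 'I_N -> agent R)
    (alpha tb : R) (mu muv : 'I_N -> R)
    (p pz pzeta : 'I_N -> R -> R -> R -> R)
    (To : 'I_N -> (R -> R) -> R -> R -> R)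
    (gam gamz gamzz : forall i : 'I_N, R -> R -> 'cV[R]_(ag_nv (A i)))
    (lv : forall i : 'I_N, R -> 'cV[R]_(ag_nv (A i)))
    (Psi : forall i : 'I_N, R -> R -> 'M[R]_(ag_nv (A i))) :
  0 <= tb -> 1 <= alpha -> alpha < 2 ->
  forall i : 'I_N,
  standing (A i) alpha tb ->
  strong_kernel (A i) alpha tb (mu i) (p i) (pz i) (pzeta i) ->
  is_To tb (p i) (To i) ->
  gamma_solution tb (mu i) (p i) (To i) (gam i) (gamz i) (gamzz i) ->
  (exists B : R, forall t, tb < t -> forall k, `|lv i t k 0| <= B) ->
  fundamental_matrix tb
    (fun t => ag_S (A i) - lv i t *m (ag_c (A i) *: (gam i 1 t)^T)) (Psi i) ->
  exp_bounded tb (muv i) (Psi i) ->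
  0 < mu i -> 0 < muv i -> mu i != muv i ->
  let l1 := gain_l1 (A i) (p i) in
  let lx := gain_lx (p i) (pzeta i) (gam i) (lv i) in
  let alpha_o := Num.min (mu i) (muv i) in
  exists2 M : R, 1 <= M &
    forall (t0 : R) (u : R -> R[i])
      (v vh : R -> 'cV[R[i]]_(ag_nv (A i)))
      (x xz xzz xh xhz xhzz : R -> R -> R[i]),
    tb <= t0 ->
    agent_solution t0 u v x xz xzz ->
    observer_solution t0 (lv i) lx l1 u (output (A i) x) vh xh xhz xhzz ->
    let ev t := v t - vh t in
    let ex t z := x z t - xh z t in
    admissible_error t0 l1 (ev t0) (ex t0) ->
    forall t, t0 <= t ->
      normX (ev t) (ex t)
      <= M * expR (- (alpha_o * (t - t0))) * normX (ev t0) (ex t0).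
Proof.
move=> _ _ _ i std SK HTo Hgam lvB fund expb mu0 muv0 mm l1 lx alpha_o.
have [C C0 est] := error_estimate std SK HTo Hgam lvB fund expb mu0 muv0 mm.
pose K : R := 2 * ((ag_nv (A i))%:R + 1).
(* C is uniform in t0 and in the solution, and K converts the norms of the two parts into the state
   norm. The maximum with 1 serves t = t0, which the estimate for t > t0 leaves out. *)
exists (Num.max 1 (C * K)); first by rewrite le_max lexx.
move=> t0 u v vh x xz xzz xh xhz xhzz tb0 ag ob ev ex _ t t0t.
have M1 : 1 <= Num.max 1 (C * K) by rewrite le_max lexx.
have [[_ _ c0] _] := std.
have er := part_error_of_solutions (or_introl erefl) c0 ag ob.
have ei := part_error_of_solutions (or_intror erefl) c0 ag ob.
have [->|tt0] := eqVneq t t0.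
  rewrite subrr mulr0 oppr0 expR0 mulr1 -[leLHS]mul1r.
  by apply: ler_wpM2r => //; exact: normX_ge0.
have {t0t tt0}tt : t0 < t by rewrite lt_neqAle eq_sym tt0.
have L2ex rho (e : error_solution (lv i) t0 lx l1 (fun t => map_mx rho (ev t)) (fun z t => rho (ex t z))
    (fun z t => rho (xz z t - xhz z t)) (fun z t => rho (xzz z t - xhzz z t))) :
    L2 (rho \o ex t0) /\ L2 (rho \o ex t).
  split; first by have [_ _ []] := e.
  by have [_ _ /prim_L2] := error_H2 e tt.
have [Lr0 Lrt] := L2ex _ er; have [Li0 Lit] := L2ex _ ei.
apply: (le_trans (normX_le_parts (ev t) Lrt Lit)).
apply: (le_trans (lerD (est _ _ _ _ _ tb0 er t tt) (est _ _ _ _ _ tb0 ei t tt))).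
rewrite -mulrDr.
have H := parts_le_normX (ev t0) Lr0 Li0.
apply: (@le_trans _ _ (C * expR (- (alpha_o * (t - t0))) * (K * normX (ev t0) (ex t0)))).
  by apply: ler_wpM2l => //; rewrite mulr_ge0 ?expR_ge0.
have -> : C * expR (- (alpha_o * (t - t0))) * (K * normX (ev t0) (ex t0)) =
  (C * K) * (expR (- (alpha_o * (t - t0))) * normX (ev t0) (ex t0)) by ring.
rewrite -[leRHS]mulrA; apply: ler_wpM2r; last by rewrite le_max lexx orbT.
by rewrite mulr_ge0 ?expR_ge0 ?normX_ge0.
Qed.
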